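(* Let $d\ge1$, let $F:\mathbb{R}\to[0,1]$ be a univariate CDF, let $\alpha>0$, let $f:\mathbb{R}^d\to\mathbb{R}$ be of class $C^d$, let $\pi$ be a probability density on $\mathbb{R}^d$ of class $C^d$, and let $\boldsymbol\tau:(0,1)^d\to\mathbb{R}^d$ be a diffeomorphism (onto $\mathbb{R}^d$) of class $C^{d+1}$. Assume: (i) for every multi-index $\lambda\in\mathbb{N}_0^d$ with $|\lambda|\le d$ and every $B>0$ there is $C_1>0$ with $|\partial^\lambda f(\mathbf x)|\le C_1\prod_{k=1}^d[\min(F(x_k),1-F(x_k))]^{-B}$ for all $\mathbf x\in\mathbb{R}^d$; (ii) there is $C_2>0$ such that for every multi-index $\lambda\in\mathbb{N}_0^d$ with $|\lambda|\le d$, $|\partial^\lambda\pi(\mathbf x)|\le C_2\prod_{k=1}^d e^{-\alpha|x_k|}$ for all $\mathbf x\in\mathbb{R}^d$; (iii) $\boldsymbol\tau$ satisfies the transport growth assumption with respect to $F$ and $\alpha$ (see context). Let $h(\mathbf u)=f(\boldsymbol\tau(\mathbf u))\,\pi(\boldsymbol\tau(\mathbf u))\,|\det J_{\boldsymbol\tau}(\mathbf u)|$, and let $\mathbf u_1,\dots,\mathbf u_n$ be the points of a scrambled net. Then the estimator $\hat\mu_n=\frac1n\sum_{i=1}^n h(\mathbf u_i)$ of $\mu=\mathbb{E}_{X\sim\pi}[f(X)]$ satisfies $\big(\mathbb{E}|\hat\mu_n-\mu|^2\big)^{1/2}=O(n^{-1+\epsilon})$ for every $\epsilon>0$.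
   Context: For $v\subseteq\{1,\dots,d\}$, $\partial^v=\prod_{j\in v}\partial/\partial u_j$ (with $\partial^\emptyset$ the identity); for a multi-index $\lambda$, $\partial^\lambda$ is the usual partial derivative of order $|\lambda|=\sum_i\lambda_i$. $J_{\boldsymbol\tau}=(\partial\boldsymbol\tau_i/\partial u_j)_{i,j}$. Negative powers of $0$ are read as $+\infty$. Transport growth assumption with respect to $F$ and $\alpha$: (a) for all $v\subseteq\{1,\dots,d\}$, all $m,j\in\{1,\dots,d\}$ and every $B>0$ there is $C_3>0$ such that for all $\mathbf u\in(0,1)^d$, $$|\partial^v(\partial^{\{m\}}\boldsymbol\tau_j)(\mathbf u)|\le C_3\min(u_m,1-u_m)^{-1}\prod_{k=1}^d\min(u_k,1-u_k)^{-B-\mathbf 1_{\{k\in v\}}};$$ (b) there are constants $B_0>0$, $C_4>0$ such that for all $k\in\{1,\dots,d\}$ and $\mathbf u\in(0,1)^d$, $$\min\big(F(\boldsymbol\tau_k(\mathbf u)),1-F(\boldsymbol\tau_k(\mathbf u))\big)^{-1}\le C_4\prod_{l=1}^d\min(u_l,1-u_l)^{-B_0};$$ (c) there are constants $C_5>1/\alpha$ and $C'\in\mathbb{R}$ such that for all $j\in\{1,\dots,d\}$ and $\mathbf u\in(0,1)^d$, $|\boldsymbol\tau_j(\mathbf u)|\ge C_5|\ln(\min(u_j,1-u_j))|-C'$. Scrambled net: for fixed base $b\ge2$ and quality parameter $t\ge 0$, the $n=b^m$ points are obtained by applying Owen's nested uniform scrambling to a $(t,m,d)$-net in base $b$; each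 point is then uniformly distributed on $[0,1]^d$. The $O(n^{-1+\epsilon})$ statement is as $m\to\infty$, with a constant not depending on $n$. *)

(* Defs.v *)
From HB Require Import structures.
From mathcomp Require Import all_boot all_order all_algebra all_fingroup.
From mathcomp Require Import all_classical all_reals all_analysis.
Import Order.TTheory GRing.Theory Num.Theory.
Import numFieldNormedType.Exports.

Set Implicit Arguments.
Unset Strict Implicit.
Unset Printing Implicit Defensive.

Local Open Scope classical_set_scope.
Local Open Scope ring_scope.

Section Calculus.
Context {R : realType} {d : nat}.
Implicit Types (f : 'rV[R]_d -> R) (tau : 'rV[R]_d -> 'rV[R]_d).

Definition pderiv (j : 'I_d) f : 'rV[R]_d -> R :=
  fun x => 'D_(delta_mx 0 j) f x.

Definition pderivs (s : seq 'I_d) f : 'rV[R]_d -> R := foldr pderiv f s.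

(* For functions of class C^k the order of differentiation is immaterial;
   coordinates are taken in increasing order from the outside in. *)
Definition pderiv_set (v : {set 'I_d}) f := pderivs (enum v) f.

Definition pderiv_multi (l : {ffun 'I_d -> nat}) f :=
  pderivs (flatten [seq nseq (l j) j | j <- enum 'I_d]) f.

Definition class_C (k : nat) (U : set 'rV[R]_d) f :=
  forall s : seq 'I_d, (size s <= k)%N ->
    (forall x, U x -> {for x, continuous (pderivs s f)}) /\
    ((size s < k)%N -> forall (j : 'I_d) (x : 'rV[R]_d), U x ->
       derivable (pderivs s f) x (delta_mx 0 j)).

Definition coordf tau (i : 'I_d) : 'rV[R]_d -> R := fun u => tau u 0 i.

Definition class_C_vec (k : nat) (U : set 'rV[R]_d) tau :=
  forall i, class_C k U (coordf tau i).

Definition open_cube : set 'rV[R]_d := [set u | forall j, 0 < u 0 j < 1].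

Definition diffeo_cube (k : nat) tau :=
  class_C_vec k open_cube tau /\
  exists g : 'rV[R]_d -> 'rV[R]_d,
    [/\ forall x, open_cube (g x),
        forall u, open_cube u -> g (tau u) = u,
        forall x, tau (g x) = x
      & class_C_vec k setT g].

Definition jac tau (u : 'rV[R]_d) : 'M[R]_d :=
  \matrix_(i, j) pderiv j (coordf tau i) u.

Definition mindist (x : R) : R := Num.min x (1 - x).

(* On nonnegative x and for B > 0: the value at x = 0 is +oo. *)
Definition negpow (x B : R) : \bar R := ((x `^ B)%:E)^-1%E.

Definition transport_growth (F : R -> R) (alpha : R) tau :=
  [/\ forall (v : {set 'I_d}) (m j : 'I_d) (B : R), 0 < B ->
        exists2 C3 : R, 0 < C3 & forall u, open_cube u ->
          `|pderiv_set v (pderiv m (coordf tau j)) u| <=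
            C3 * (mindist (u 0 m))^-1 *
            \prod_(k < d) mindist (u 0 k) `^ (- B - (k \in v)%:R),
      exists B0 C4 : R, [/\ 0 < B0, 0 < C4 &
        forall (k : 'I_d) u, open_cube u ->
          (negpow (mindist (F (tau u 0%R k))) 1 <=
             (C4 * \prod_(l < d) mindist (u 0 l) `^ (- B0))%:E)%E]
    & exists C5 C' : R, alpha^-1 < C5 /\
        forall (j : 'I_d) u, open_cube u ->
          C5 * `|ln (mindist (u 0 j))| - C' <= `|tau u 0 j| ].

(* Extended by 0 outside the open cube; the boundary of the cube is hit by a
   scrambled point with probability 0. *)
Definition transported_integrand (f p : 'rV[R]_d -> R) tau
    (u : 'rV[R]_d) : R :=
  if u \in open_cube
  then f (tau u) * p (tau u) * `|\det (jac tau u)| else 0.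

End Calculus.

(* The d-dimensional Lebesgue measure, on d.-tuple R with its Borel
   sigma-algebra, by iterated products. *)
Section LebesgueStep.
Context {R : realType} {n : nat}.
Variable m : {sigma_finite_measure set (n.-tuple R) -> \bar R}.

Definition cons_pair (p : measurableTypeR R * n.-tuple R) : n.+1.-tuple R :=
  [tuple of p.1 :: p.2].

Lemma measurable_cons_pair : measurable_fun setT cons_pair.
Proof. exact: measurable_cons. Qed.

Definition lebesgue_cons : set (n.+1.-tuple R) -> \bar R :=
  pushforward (lebesgue_measure \x m)%E cons_pair.

Let lebesgue_cons0 : lebesgue_cons set0 = 0%E.
Proof. by rewrite /lebesgue_cons /pushforward preimage_set0 measure0. Qed.

Let lebesgue_cons_ge0 A : (0 <= lebesgue_cons A)%E.
Proof. by rewrite /lebesgue_cons /pushforward; exact: measure_ge0. Qed.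

Let lebesgue_cons_sigma_additive : semi_sigma_additive lebesgue_cons.
Proof.
move=> F mF tF mUF; rewrite /lebesgue_cons /pushforward preimage_bigcup.
have mpre A : measurable A -> measurable (cons_pair @^-1` A).
  by move=> mA; rewrite -[X in measurable X]setTI; exact: measurable_cons_pair.
apply: measure_semi_sigma_additive => [k||]; first exact: mpre.
  apply/trivIsetP => i j _ _ ij; rewrite -preimage_setI.
  by move/trivIsetP : tF => /(_ _ _ _ _ ij) ->//; rewrite preimage_set0.
by rewrite -preimage_bigcup; exact: mpre.
Qed.

HB.instance Definition _ := isMeasure.Build _ _ _ lebesgue_cons
  lebesgue_cons0 lebesgue_cons_ge0 lebesgue_cons_sigma_additive.

Let lebesgue_cons_sigma_finite : sigma_finite setT lebesgue_cons.
Proof.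
pose mu : {sigma_finite_measure set (measurableTypeR R) -> \bar R} :=
  lebesgue_measure.
have /sigma_finiteP[F [FT ndF Foo]] := sigma_finiteT mu.
have /sigma_finiteP[G [GT ndG Goo]] := sigma_finiteT m.
pose uncons (t : n.+1.-tuple R) : measurableTypeR R * n.-tuple R :=
  (thead t, [tuple of behead t]).
have consK : cancel cons_pair uncons.
  move=> [x t]; rewrite /uncons /cons_pair; congr pair; exact: val_inj.
have munc : measurable_fun setT uncons.
  apply: measurable_fun_pair; first exact: measurable_tnth.
  exact: measurable_behead.
exists (fun k => uncons @^-1` (F k `*` G k)).
  rewrite -preimage_bigcup (_ : \bigcup_k _ = setT) ?preimage_setT //.
  apply/seteqP; split=> // -[x t] _.
  have [i _ Fix] : (\bigcup_k F k) x by rewrite -FT.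
  have [k _ Gkt] : (\bigcup_k G k) t by rewrite -GT.
  exists (maxn i k) => //; split => /=.
    by move: x Fix; exact/subsetPset/ndF/leq_maxl.
  by move: t Gkt; exact/subsetPset/ndG/leq_maxr.
move=> k; have [mF Fk] := Foo k; have [mG Gk] := Goo k; split.
  by rewrite -[X in measurable X]setTI; apply: munc => //; exact: measurableX.
rewrite /lebesgue_cons /pushforward -comp_preimage.
rewrite (_ : uncons \o _ = id); last by apply/funext => p /=; rewrite consK.
rewrite preimage_id product_measure1E// lte_mul_pinfty// ?ge0_fin_numE//.
Qed.

HB.instance Definition _ := Measure_isSigmaFinite.Build _ _ _ lebesgue_cons
  lebesgue_cons_sigma_finite.
End LebesgueStep.

Fixpoint lebesgue_tuple (R : realType) (n : nat) :
    {sigma_finite_measure set (n.-tuple R) -> \bar R} :=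
  match n with
  | 0 => \d_([tuple] : 0.-tuple R)
  | n'.+1 => lebesgue_cons (lebesgue_tuple R n')
  end.

Section Density.
Context {R : realType} {d : nat}.

Definition row_of_tuple (x : d.-tuple R) : 'rV[R]_d := \row_i tnth x i.

Definition is_density (p : 'rV[R]_d -> R) :=
  (forall x, 0 <= p x) /\
  (\int[lebesgue_tuple R d]_x (p (row_of_tuple x))%:E = 1)%E.

Definition has_density {dO : measure_display} {Omega : measurableType dO}
    (Q : probability Omega R) (X : {RV Q >-> d.-tuple R})
    (p : 'rV[R]_d -> R) :=
  forall A : set (d.-tuple R), measurable A ->
    (distribution Q X A =
     \int[lebesgue_tuple R d]_(x in A) (p (row_of_tuple x))%:E)%E.

End Density.

Section Nets.
Context {R : realType} {d : nat}.

Definition elementary_interval (b : nat) (k a : {ffun 'I_d -> nat})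
    (x : 'rV[R]_d) : bool :=
  [forall j, (a j)%:R / b%:R ^+ k j <= x 0 j < (a j).+1%:R / b%:R ^+ k j].

Definition tmd_net (t m b : nat) (x : 'I_(b ^ m) -> 'rV[R]_d) :=
  [/\ (t <= m)%N,
      forall i j, 0 <= x i 0 j < 1
    & forall k a : {ffun 'I_d -> nat},
        (\sum_j k j = m - t)%N -> (forall j, a j < b ^ k j)%N ->
        #|[set i | elementary_interval b k a (x i)]| = (b ^ t)%N ].

End Nets.

Section Scrambling.
Context {R : realType} {d b : nat}.

(* The k-th base-b digit (counting from k = 0) of x in [0, 1). *)
Definition digit (hb : (1 < b)%N) (x : R) (k : nat) : 'I_b :=
  Ordinal (ltn_pmod (Num.truncn (b%:R ^+ k.+1 * x)) (ltnW hb)).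

(* Each digit is permuted by the permutation attached to the string of digits
   preceding it. *)
Definition scramble_coord (hb : (1 < b)%N) (s : seq 'I_b -> {perm 'I_b})
    (x : R) : R :=
  limn (series (fun k : nat => (
    (s (mkseq (digit hb x) k) (digit hb x k) : nat)%:R / b%:R ^+ k.+1 : R))).

Context {dO : measure_display} {Omega : measurableType dO}.

Definition scramble (hb : (1 < b)%N)
    (sigma : 'I_d -> seq 'I_b -> Omega -> {perm 'I_b})
    (x : 'rV[R]_d) (w : Omega) : 'rV[R]_d :=
  \row_j scramble_coord hb (fun s => sigma j s w) (x 0 j).

(* The random permutations indexed by a coordinate and a digit string are
   uniform and mutually independent. *)
Definition nested_uniform (P : probability Omega R)
    (sigma : 'I_d -> seq 'I_b -> Omega -> {perm 'I_b}) :=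
  [/\ forall j s (q : {perm 'I_b}), measurable [set w | sigma j s w = q],
      forall j s (q : {perm 'I_b}),
        P [set w | sigma j s w = q] = ((b`!)%:R^-1)%:E
    & forall (J : seq ('I_d * seq 'I_b))
             (A : 'I_d * seq 'I_b -> {set {perm 'I_b}}),
        uniq J ->
        (P [set w | forall i, i \in J -> sigma i.1 i.2 w \in A i] =
         \prod_(i <- J) P [set w | sigma i.1 i.2 w \in A i])%E ].

Definition sample_mean (n : nat) (h : 'rV[R]_d -> R)
    (u : 'I_n -> Omega -> 'rV[R]_d) (w : Omega) : R :=
  n%:R^-1 * \sum_(i < n) h (u i w).

(* Taken in the extended reals: it is +oo when mu or the second moment is
   infinite, so a finite bound on it entails that both are finite. *)
Definition rmse (P : probability Omega R) (Y : Omega -> R) (mu : \bar R)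
    : \bar R :=
  (poweR (\int[P]_w (`|(Y w)%:E - mu| ^+ 2)) 2^-1)%E.

End Scrambling.

(* Main.v *)
(** Because alpha C_5 > 1, the decay of the density beats the growth of the
    transport map, so that the transported integrand h and its mixed derivatives
    satisfy |d^v h(u)| <= C prod_k min(u_k, 1-u_k)^(delta - 1_{k in v}) for some
    delta > 0. Hence h extends continuously by 0 to the boundary of the cube,
    d^{1..d} h is integrable, and h(y) is the integral of d^{1..d} h over the box
    of the points below y. This gives a Koksma-Hlawka inequality: the quadrature
    error of a (t,m,d)-net is at most b^(t-m) (mb+1)^d times the L^1 norm of
    d^{1..d} h. A scrambled point is the limit of its truncations to finitely many
    digits, and the truncated points form a (t,m,d)-net again, so the bound holds
    for every outcome of the scrambling; no averaging over the randomness is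
    needed. The change of variables x = tau(u) identifies the integral of h with
    mu. *)
Require Import Defs.
From HB Require Import structures.
From mathcomp Require Import all_boot all_order all_algebra all_fingroup.
From mathcomp Require Import all_classical all_reals all_analysis.
From mathcomp Require Import measurable_realfun.
From mathcomp Require Import ring lra zify.
Import Order.TTheory GRing.Theory Num.Theory.
Import numFieldNormedType.Exports.
Set Implicit Arguments.
Unset Strict Implicit.
Unset Printing Implicit Defensive.
Local Open Scope classical_set_scope.
Local Open Scope ring_scope.

(** * Lebesgue measure and linear maps *)

(** The exponents decide everything. In every coordinate, the density composed with [tau] gains
    [alpha C5]; the Jacobian determinant costs 1 and an arbitrarily small amount, because each term
    of its expansion differentiates exactly once in each coordinate; [f] and the chain rule cost an
    amount that can be chosen as small as desired. What remains is a fraction of [alpha C5 - 1]. The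
    absolute value of the determinant does no harm, since its sign is constant on the cube.

    The growth assumption on [tau] concerns sets of coordinates, hence derivatives in one fixed
    order. Mixed derivatives on the cube are therefore taken along subsequences of a reversed
    enumeration of the coordinates; the order is permuted only for [f] and [p], on the whole space.

    Discrepancy is measured on upper boxes: h(y) integrates the mixed derivative over the t below y,
    so after summing over the points each t is weighted by the number of points above it.

    The change of variables comes from an inequality on small dyadic cells, used for [tau] and for
    its inverse. The factor (mb+1)^d is a power of log n and is absorbed by n^eps. *)

Section TupleMeasure.
Context {R : realType}.
Local Notation lam := (lebesgue_tuple R).

Lemma ge0_integral_lebesgue_cons n (f : n.+1.-tuple R -> \bar R) :
  measurable_fun setT f -> (forall x, 0 <= f x)%E ->
  (\int[lam n.+1]_z f z = \int[lebesgue_measure]_x \int[lam n]_t f (cons_pair (x, t)))%E.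
Proof.
move=> mf f0 /=.
rewrite [LHS](@ge0_integral_pushforward _ _ _ _ _ _ measurable_cons_pair (lebesgue_measure \x lam n)%E)//=.
rewrite preimage_setT fubini_tonelli1//.
exact: measurableT_comp mf measurable_cons_pair.
Qed.

Lemma ge0_integral_lebesgue_cons2 n (f : n.+1.-tuple R -> \bar R) :
  measurable_fun setT f -> (forall x, 0 <= f x)%E ->
  (\int[lam n.+1]_z f z = \int[lam n]_t \int[lebesgue_measure]_x f (cons_pair (x, t)))%E.
Proof.
move=> mf f0 /=.
rewrite [LHS](@ge0_integral_pushforward _ _ _ _ _ _ measurable_cons_pair (lebesgue_measure \x lam n)%E)//=.
rewrite preimage_setT fubini_tonelli2//.
exact: measurableT_comp mf measurable_cons_pair.
Qed.

Lemma ge0_integral_lebesgue_0 (f : 0.-tuple R -> \bar R) : 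
  (\int[lam 0]_z f z = f [tuple])%E.
Proof.
rewrite /= integral_dirac//.
  by rewrite diracT mul1e.
(* Every function on [0.-tuple R] is measurable: the type has a single point, so a preimage is
   everything or empty. *)
move=> _ Y mY; have [h|h] := pselect ((f @^-1` Y) [tuple]).
  rewrite (_ : _ `&` _ = setT)//; apply/seteqP; split=> // x _; split=> //.
  by rewrite tuple0.
rewrite (_ : _ `&` _ = set0)//; apply/seteqP; split=> // x [_]; by rewrite [x]tuple0.
Qed.

Lemma integrable_lebesgue_cons n (f : n.+1.-tuple R -> \bar R) :
  (lam n.+1).-integrable setT f ->
  (\int[lam n.+1]_z f z = \int[lam n]_t \int[lebesgue_measure]_x f (cons_pair (x, t)))%E.
Proof.
move=> intf.
have mf := measurable_int _ intf.
have i2 : (lebesgue_measure \x lam n)%E.-integrable setT (f \o cons_pair).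
  apply/integrableP; split; first exact: measurableT_comp mf measurable_cons_pair.
  move/integrableP : intf => [_].
  rewrite [X in (X < _)%E -> _](@ge0_integral_pushforward _ _ _ _ _ _ measurable_cons_pair (lebesgue_measure \x lam n)%E)//=.
  exact: measurableT_comp.
rewrite /= [LHS](@integral_pushforward _ _ _ _ _ _ measurable_cons_pair (lebesgue_measure \x lam n)%E)//=.
by rewrite preimage_setT -integral21_prod_meas1.
Qed.

End TupleMeasure.

(** * Affine substitutions on the line *)

Section Affine.
Context {R : realType}.
Local Notation leb := (@lebesgue_measure R).

Lemma measurable_affine (a c : R) :
  measurable_fun setT (fun x : measurableTypeR R => a * x + c : measurableTypeR R).
Proof. by apply: measurable_funD => //; apply: measurable_funM. Qed.

(** The image of Lebesgue measure under the affine map, scaled by [a], gives half-open intervals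
    their length, so by uniqueness it is Lebesgue measure. *)
Lemma ge0_integral_affine_pos (a c : R) (f : R -> \bar R) : 0 < a ->
  measurable_fun setT f -> (forall x, 0 <= f x)%E ->
  (a%:E * \int[leb]_x f (a * x + c)%R = \int[leb]_x f x)%E.
Proof.
move=> a0 mf f0.
pose g := fun x : measurableTypeR R => a * x + c : measurableTypeR R.
have mg : measurable_fun setT g by exact: measurable_affine.
pose nn := NngNum (ltW a0).
pose mu_ : measure (measurableTypeR R) R := mscale nn (pushforward leb g). pose mu := mu_ mg.
transitivity (\int[mu]_x f x)%E; last first.
  apply: eq_measure_integral => A mA _; apply/esym.
  apply: (@lebesgue_measure_unique _ mu) => // X [[p q] _ /= <-].
  rewrite /mu /mu_/= /mscale/= /pushforward.
  rewrite (_ : g @^-1` `]p, q] = `](p - c) / a, (q - c) / a]%classic); last first.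
    apply/seteqP; split => x /=; rewrite !in_itv/= ltr_pdivrMr// ler_pdivlMr//.
      by rewrite /g => /andP[? ?]; apply/andP; split; lra.
    by rewrite /g => /andP[? ?]; apply/andP; split; lra.
  rewrite !lebesgue_measure_itv/= !lte_fin ltr_pM2r ?invr_gt0// ltrD2r.
  case: ifPn => // _; last by rewrite mule0.
  by rewrite -!EFinB -EFinM; congr EFin; field; rewrite gt_eqF.
rewrite ge0_integral_mscale//= ge0_integral_pushforward//.
Qed.

(** A negative slope is reduced to a positive one by the invariance of Lebesgue measure under
    reflection. *)
Lemma ge0_integral_affine (a c : R) (f : R -> \bar R) : a != 0 ->
  measurable_fun setT f -> (forall x, 0 <= f x)%E ->
  (`|a|%:E * \int[leb]_x f (a * x + c)%R = \int[leb]_x f x)%E.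
Proof.
move=> a0 mf f0; have [a1|a1|a1] := ltgtP 0 a; last by rewrite -a1 eqxx in a0.
  by rewrite gtr0_norm// ge0_integral_affine_pos.
rewrite ltr0_norm// -(@ge0_integral_affine_pos (- a) c f) ?oppr_gt0//; congr (_ * _)%E.
have mN : measurable_fun setT (-%R : R -> measurableTypeR R) by exact: oppr_measurable.
transitivity (\int[pushforward leb (-%R : R -> measurableTypeR R)]_x f (- a * x + c)%R)%E.
  rewrite ge0_integral_pushforward//=; last first.
    by apply: measurableT_comp => //; exact: measurable_affine.
  by rewrite preimage_setT; apply: eq_integral => x _ /=; rewrite mulrNN.
by apply: eq_measure_integral => A mA _; apply: lebesgue_measureN.
Qed.

End Affine.

(** * Translations and linear maps of row vectors *)

Section RowVectors.
Context {R : realType}.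
Local Notation lam := (lebesgue_tuple R).
Local Notation leb := (@lebesgue_measure R).

Definition tuple_of_row n (v : 'rV[R]_n) : n.-tuple R := [tuple v 0 i | i < n].

Lemma tuple_of_rowK n : cancel (@tuple_of_row n) row_of_tuple.
Proof. by move=> v; apply/rowP => i; rewrite mxE tnth_mktuple. Qed.

Lemma measurable_row_coord n (i : 'I_n) :
  measurable_fun setT (fun t : n.-tuple R => row_of_tuple t 0 i).
Proof.
rewrite (_ : (fun _ => _) = (@tnth n R)^~ i); first exact: measurable_tnth.
by apply/funext => t; rewrite mxE.
Qed.

(** Throughout, measurability of a function [g] of row vectors means measurability of
    [g \o row_of_tuple]. This lemma carries that notion over to compositions with maps whose
    coordinates are measurable. *)
Lemma measurable_comp_row d (T : measurableType d) d' (U : measurableType d') n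
    (F : T -> 'rV[R]_n) (g : 'rV[R]_n -> U) :
  (forall j, measurable_fun setT (fun t => F t 0 j)) ->
  measurable_fun setT (g \o row_of_tuple) -> measurable_fun setT (g \o F).
Proof.
move=> mF mg; rewrite (_ : g \o F = (g \o row_of_tuple) \o (@tuple_of_row n \o F)).
  apply: measurableT_comp => //; apply/measurable_fun_tnthP => i.
  rewrite (_ : _ \o _ = fun t => F t 0 i)//.
  by apply/funext => t /=; rewrite tnth_mktuple.
by apply/funext => t /=; rewrite tuple_of_rowK.
Qed.

Lemma row_of_tuple_cons n (x : R) (t : n.-tuple R) :
  row_of_tuple (cons_pair (x, t)) = row_mx x%:M (row_of_tuple t) :> 'rV_(1 + n).
Proof.
apply/rowP => i; rewrite [LHS]mxE.
case: (splitP i) => j ij.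
  have -> : i = lshift n j by exact: val_inj.
  by rewrite row_mxEl mxE ord1 eqxx mulr1n /tnth /=.
have -> : i = rshift 1 j by exact: val_inj.
by rewrite row_mxEr mxE (tnth_nth 0) (tnth_nth 0).
Qed.

Lemma measurable_row_mulmx n k (A : 'M[R]_(n, k)) j :
  measurable_fun setT (fun t : n.-tuple R => (row_of_tuple t *m A) 0 j).
Proof.
rewrite (_ : (fun _ => _) = fun t => \sum_i row_of_tuple t 0 i * A i j).
  apply: measurable_sum => i; apply: measurable_funM => //.
  exact: measurable_row_coord.
by apply/funext => t; rewrite mxE.
Qed.

Lemma measurable_row_addr n (c : 'rV[R]_n) j :
  measurable_fun setT (fun t : n.-tuple R => (row_of_tuple t + c) 0 j).
Proof.
rewrite (_ : (fun _ => _) = fun t => row_of_tuple t 0 j + c 0 j).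
  by apply: measurable_funD => //; exact: measurable_row_coord.
by apply/funext => t; rewrite mxE.
Qed.

Lemma measurable_row_mxl n (t : 'rV[R]_n) (j : 'I_(1 + n)) :
  measurable_fun setT (fun x : measurableTypeR R => row_mx x%:M t 0 j).
Proof.
case: (splitP j) => i ij.
  rewrite (_ : (fun _ => _) = id)//; apply/funext => x.
  rewrite (_ : j = lshift n i); last exact: val_inj.
  by rewrite row_mxEl mxE ord1 eqxx mulr1n.
rewrite (_ : (fun _ => _) = cst (t 0 i))//; apply/funext => x.
rewrite (_ : j = rshift 1 i); last exact: val_inj.
by rewrite row_mxEr.
Qed.

Lemma measurable_row_mxr n (x : R) (j : 'I_(1 + n)) :
  measurable_fun setT (fun t : n.-tuple R => row_mx x%:M (row_of_tuple t) 0 j).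
Proof.
case: (splitP j) => i ij.
  rewrite (_ : (fun _ => _) = cst x)//; apply/funext => t.
  rewrite (_ : j = lshift n i); last exact: val_inj.
  by rewrite row_mxEl mxE ord1 eqxx mulr1n.
rewrite (_ : (fun _ => _) = (fun t => row_of_tuple t 0 i)).
  exact: measurable_row_coord.
apply/funext => t; rewrite (_ : j = rshift 1 i); last exact: val_inj.
by rewrite row_mxEr.
Qed.

Section Row.
Variables (n : nat) (f : 'rV[R]_(1 + n) -> \bar R).
Hypothesis mf : measurable_fun setT (f \o (@row_of_tuple R n.+1)).
Hypothesis f0 : (forall v, 0 <= f v)%E.

Let f_cons t : f (row_of_tuple (cons_pair t)) = f (row_mx t.1%:M (row_of_tuple t.2)).
Proof. by case: t => x t /=; rewrite row_of_tuple_cons. Qed.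

Lemma ge0_integral_row : (\int[lam n.+1]_t f (row_of_tuple t) =
  \int[leb]_x \int[lam n]_t f (row_mx x%:M (row_of_tuple t)))%E.
Proof.
etransitivity; first exact: (ge0_integral_lebesgue_cons mf (fun _ => f0 _)).
apply: eq_integral => x _; by apply: eq_integral => t _ /=; rewrite f_cons.
Qed.

Lemma ge0_integral_row2 : (\int[lam n.+1]_t f (row_of_tuple t) =
  \int[lam n]_t \int[leb]_x f (row_mx x%:M (row_of_tuple t)))%E.
Proof.
etransitivity; first exact: (ge0_integral_lebesgue_cons2 mf (fun _ => f0 _)).
apply: eq_integral => t _; by apply: eq_integral => x _ /=; rewrite f_cons.
Qed.

Lemma measurable_row_section2 :
  measurable_fun setT ((fun v => \int[leb]_x f (row_mx x%:M v))%E \o (@row_of_tuple R n)).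
Proof.
rewrite (_ : _ \o _ = (fubini_G leb ((f \o (@row_of_tuple R n.+1)) \o cons_pair))).
  apply: measurable_fun_fubini_tonelli_G => //.
    exact: measurableT_comp mf measurable_cons_pair.
  by move=> t /=.
by apply/funext => t; apply: eq_integral => x _ /=; rewrite f_cons.
Qed.

Lemma measurable_row_section1 : measurable_fun setT
  (fun x : measurableTypeR R => \int[lam n]_t f (row_mx x%:M (row_of_tuple t)))%E.
Proof.
rewrite (_ : (fun x => _) = (fubini_F (lam n) ((f \o (@row_of_tuple R n.+1)) \o cons_pair))).
  apply: measurable_fun_fubini_tonelli_F => //.
    exact: measurableT_comp mf measurable_cons_pair.
  by move=> t /=.
by apply/funext => t; apply: eq_integral => x _ /=; rewrite f_cons.
Qed.

Lemma measurable_row_section x :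
  measurable_fun setT ((fun v => f (row_mx x%:M v)) \o (@row_of_tuple R n)).
Proof.
apply: (@measurable_comp_row _ _ _ _ n.+1 (fun t => row_mx x%:M (row_of_tuple t))) => //.
exact: measurable_row_mxr.
Qed.

Lemma measurable_row_sectionl v :
  measurable_fun setT (fun x : measurableTypeR R => f (row_mx x%:M v)).
Proof.
apply: (@measurable_comp_row _ _ _ _ n.+1 (fun x : measurableTypeR R => row_mx x%:M v)) => //.
exact: measurable_row_mxl.
Qed.

End Row.

(** Induction on the dimension: Tonelli splits off the first coordinate, which is translated by the
    one-dimensional result. *)
Lemma ge0_integral_translate n (f : 'rV[R]_n -> \bar R) c :
  measurable_fun setT (f \o row_of_tuple) -> (forall v, 0 <= f v)%E ->
  (\int[lam n]_t f (row_of_tuple t + c)%R = \int[lam n]_t f (row_of_tuple t))%E.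
Proof.
elim: n f c => [|n IH] f c mf f0.
  by apply: eq_integral => t _; congr f; apply/rowP => -[].
have mfc : measurable_fun setT ((fun v : 'rV_(1 + n) => f (v + c)) \o (@row_of_tuple R n.+1)).
  apply: (@measurable_comp_row _ _ _ _ n.+1 (fun t => row_of_tuple t + c)) => //.
  exact: measurable_row_addr.
rewrite [RHS](ge0_integral_row mf f0) [LHS](ge0_integral_row mfc (fun=> f0 _)).
have -> : c = row_mx (c 0 0)%:M (rsubmx (c : 'rV_(1 + n))) :> 'rV_(1 + n).
  rewrite -{1}(@hsubmxK _ 1 1 n c); congr row_mx; rewrite [LHS]mx11_scalar; congr (_%:M).
  by rewrite mxE; congr (c _ _); exact: val_inj.
move: (c 0 0) (rsubmx _) => c1 c2.
transitivity (\int[leb]_x \int[lam n]_t f (row_mx (1 * x + c1)%:M (row_of_tuple t)))%E.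
  apply: eq_integral => x _; rewrite mul1r.
  rewrite -[RHS](IH (fun v => f (row_mx (x + c1)%:M v)) c2)//; last exact: measurable_row_section.
  apply: eq_integral => t _; congr f.
  by rewrite add_row_mx raddfD.
pose g x := (\int[lam n]_t f (row_mx x%:M (row_of_tuple t)))%E.
rewrite -[RHS](@ge0_integral_affine _ 1 c1 g)//; last 2 first.
- exact: measurable_row_section1.
- by move=> x; exact: integral_ge0.
by rewrite normr1 mul1e.
Qed.

End RowVectors.

Section RowVectors2.
Context {R : realType}.
Local Notation lam := (lebesgue_tuple R).
Local Notation leb := (@lebesgue_measure R).

(** The map sends [(x, t)] to [(a x + t c, t S)]. For fixed [t] this is affine in [x], and once [x]
    is integrated out only the substitution by [S] remains, which is the assumption on [S]. *)
Lemma ge0_integral_block n (f : 'rV[R]_(1 + n) -> \bar R) a (c : 'M[R]_(n, 1)) (S : 'M[R]_n) :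
  (forall g : 'rV[R]_n -> \bar R, measurable_fun setT (g \o row_of_tuple) ->
     (forall v, 0 <= g v)%E ->
     (`|\det S|%:E * \int[lam n]_t g (row_of_tuple t *m S)%R =
      \int[lam n]_t g (row_of_tuple t))%E) -> a != 0 ->
  measurable_fun setT (f \o (@row_of_tuple R n.+1)) -> (forall v, 0 <= f v)%E ->
  (`|a * \det S|%:E * \int[lam n.+1]_t f ((row_of_tuple t : 'rV_(1 + n)) *m block_mx a%:M 0 c S)%R
   = \int[lam n.+1]_t f (row_of_tuple t))%E.
Proof.
move=> HS a0 mf f0; set A := block_mx _ _ _ _.
have mfA : measurable_fun setT ((fun v : 'rV_(1 + n) => f (v *m A)) \o (@row_of_tuple R n.+1)).
  apply: (@measurable_comp_row _ _ _ _ _ n.+1 (fun t => (row_of_tuple t : 'rV_(1 + n)) *m A)) => //.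
  exact: measurable_row_mulmx.
rewrite [RHS](ge0_integral_row2 mf f0) [X in (_ * X)%E](ge0_integral_row2 mfA (fun=> f0 _)).
rewrite normrM EFinM (muleC `|a|%:E) -muleA -ge0_integralZl//; last 2 first.
- exact: measurable_row_section2 mfA _.
- by move=> t _; exact: integral_ge0.
pose g v := (\int[leb]_x f (row_mx x%:M v))%E.
rewrite -[RHS](HS g); last 2 first.
- exact: measurable_row_section2.
- by move=> t; exact: integral_ge0.
congr (_ * _)%E; apply: eq_integral => t _ /=.
have := @ge0_integral_affine R a ((row_of_tuple t *m c) 0 0) (fun x => f (row_mx x%:M (row_of_tuple t *m S))) a0.
rewrite /g => <-//; last exact: measurable_row_sectionl.
congr (_ * _)%E; apply: eq_integral => x _; congr f.
rewrite mul_row_block mulmx0 add0r; congr row_mx.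
by rewrite -scalar_mxM [X in _ + X]mx11_scalar -raddfD mulrC.
Qed.

(** The map sends [(x, t)] to [(x, x b + t)], a translation in [t] for every fixed [x]. *)
Lemma ge0_integral_shear n (f : 'rV[R]_(1 + n) -> \bar R) (b : 'rV_n) :
  measurable_fun setT (f \o (@row_of_tuple R n.+1)) -> (forall v, 0 <= f v)%E ->
  (\int[lam n.+1]_t f ((row_of_tuple t : 'rV_(1 + n)) *m block_mx 1 b 0 1%:M)%R
   = \int[lam n.+1]_t f (row_of_tuple t))%E.
Proof.
move=> mf f0; set A := block_mx _ _ _ _.
have mfA : measurable_fun setT ((fun v : 'rV_(1 + n) => f (v *m A)) \o (@row_of_tuple R n.+1)).
  apply: (@measurable_comp_row _ _ _ _ _ n.+1 (fun t => (row_of_tuple t : 'rV_(1 + n)) *m A)) => //.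
  exact: measurable_row_mulmx.
rewrite [RHS](ge0_integral_row mf f0) [LHS](ge0_integral_row mfA (fun=> f0 _)).
apply: eq_integral => x _.
rewrite -[RHS](@ge0_integral_translate _ _ (fun v => f (row_mx x%:M v)) (x%:M *m b))//; last exact: measurable_row_section.
apply: eq_integral => t _; congr f.
by rewrite mul_row_block mulmx1 mulmx0 addr0 mulmx1 addrC.
Qed.

(** Block elimination writes an invertible matrix as a shear, a block lower triangular matrix and
    another shear. The diagonal block [S'] is the Schur complement, one dimension smaller, so the
    induction hypothesis applies to it. *)
Lemma ge0_integral_linear n (A : 'M[R]_n) (f : 'rV[R]_n -> \bar R) :
  A \in unitmx -> measurable_fun setT (f \o row_of_tuple) -> (forall v, 0 <= f v)%E ->
  (`|\det A|%:E * \int[lam n]_t f (row_of_tuple t *m A)%R =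
   \int[lam n]_t f (row_of_tuple t))%E.
Proof.
elim: n A f => [|n IH] A f uA mf f0.
  rewrite det_mx00 normr1 mul1e; apply: eq_integral => t _; congr f.
  by apply/rowP => -[].
rewrite -[A](@submxK _ 1 n 1 n) in uA *.
move: (ulsubmx _) (ursubmx _) (dlsubmx _) (drsubmx _) uA => a b c S {A} uA.
(* The pivot [a] may be 0. Adding a combination [w] of the other rows to the first row then makes it
   nonzero, since otherwise the first column would vanish. *)
have [w aw0] : exists w : 'rV_n, a 0 0 + (w *m c) 0 0 != 0.
  have [a0|a0] := eqVneq (a 0 0) 0; last by exists 0; rewrite mul0mx mxE addr0.
  have [j cj] : exists j, c j 0 != 0.
    apply/existsP; rewrite -[X in is_true X]negbK negb_exists; apply/negP => /forallP c0.
    have c00 : c = 0.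
      by apply/matrixP => i k; rewrite ord1 mxE; apply/eqP; have := c0 i; rewrite negbK.
    have a00 : a = 0 by apply/matrixP => i k; rewrite !ord1 mxE.
    move: uA; rewrite unitmxE c00 a00 (@det_ublock _ 1 n) det0 mul0r.
    by rewrite unitr0.
  by exists (delta_mx 0 j); rewrite a0 add0r -rowE mxE.
pose a' := a 0 0 + (w *m c) 0 0; pose b' := b + w *m S.
pose S' := S - c *m (a'^-1 *: b').
have AE : block_mx a b c S = block_mx 1 (- w) 0 1%:M *m
    (block_mx a'%:M 0 c S' *m block_mx 1 (a'^-1 *: b') 0 1%:M).
  rewrite !mulmx_block !mulmx1 !mul1mx !mul0mx !mulmx0 !addr0 !add0r.
  have -> : c *m (a'^-1 *: b') + S' = S by rewrite addrC subrK.
  have -> : a'%:M *m (a'^-1 *: b') = b' by rewrite mul_scalar_mx scalerA mulfV// scale1r.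
  congr block_mx; last by rewrite /b' mulNmx addrK.
  rewrite /a' raddfD/= -[(a 0 0)%:M]mx11_scalar -[((w *m c) 0 0)%:M]mx11_scalar.
  by rewrite mulNmx addrK.
have detE : \det (block_mx a b c S) = a' * \det S'.
  rewrite AE (@det_mulmx _ n.+1) (@det_mulmx _ n.+1) !(@det_ublock _ 1 n) (@det_lblock _ 1 n).
  by rewrite !det1 !mul1r mulr1 det_scalar1.
have uS : S' \in unitmx.
  by move: uA; rewrite !unitmxE detE !unitfE mulf_eq0 negb_or => /andP[].
rewrite detE.
pose f1 (v : 'rV_(1 + n)) := f (v *m block_mx 1 (a'^-1 *: b') 0 1%:M).
pose f2 (v : 'rV_(1 + n)) := f1 (v *m block_mx a'%:M 0 c S').
have mf1 : measurable_fun setT (f1 \o (@row_of_tuple R n.+1)).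
  apply: (@measurable_comp_row _ _ _ _ _ n.+1 (fun t => (row_of_tuple t : 'rV_(1 + n)) *m _)) => //.
  exact: measurable_row_mulmx.
have mf2 : measurable_fun setT (f2 \o (@row_of_tuple R n.+1)).
  apply: (@measurable_comp_row _ _ _ _ _ n.+1 (fun t => (row_of_tuple t : 'rV_(1 + n)) *m _)) => //.
  exact: measurable_row_mulmx.
transitivity (`|(a' * \det S')%R|%:E * \int[lam n.+1]_t f2 (row_of_tuple t : 'rV_(1 + n)))%E.
  congr (_ * _)%E; rewrite -[RHS](@ge0_integral_shear n f2 (- w))//; last by move=> v; exact: f0.
  by apply: eq_integral => t _; rewrite AE /f2 /f1 !mulmxA.
rewrite [LHS](@ge0_integral_block n f1)//; last by move=> v; exact: f0.
- by rewrite [LHS](@ge0_integral_shear n f).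
- by move=> g mg g0; exact: IH.
Qed.

End RowVectors2.

(** * Change of variables *)

Section RowTopology.
Context {R : realType}.
Local Notation leb := (@lebesgue_measure R).

Lemma nbhs_rowP n (x : 'rV[R]_n) (A : set 'rV[R]_n) :
  nbhs x A <-> exists2 e : R, 0 < e &
    forall y : 'rV[R]_n, (forall j, `|y 0 j - x 0 j| < e) -> A y.
Proof.
split=> [/nbhs_ballP[e /= e0 eA]|[e e0 eA]].
  exists e => // y xy; apply: eA; split=> // i j; rewrite ord1.
  by rewrite -ball_normE /= distrC xy.
apply/nbhs_ballP; exists e => //= y [_ xy]; apply: eA => j.
by have := xy 0 j; rewrite -ball_normE /= distrC.
Qed.

Lemma continuous_row_coord n (j : 'I_n) : continuous (fun x : 'rV[R]_n => x 0 j).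
Proof.
exact: coord_continuous. Qed.

Lemma cvg_row (T : Type) (F : set_system T) {FF : Filter F} n
  (f : T -> 'rV[R]_n) (l : 'rV[R]_n) :
  (forall j, f x 0 j @[x --> F] --> l 0 j) -> f @ F --> l.
Proof.
move=> fl A /nbhs_rowP[e e0 eA].
have : \forall x \near F, forall j, `|f x 0 j - l 0 j| < e.
  apply: filter_forall => j; move/cvgrPdist_lt : (fl j) => /(_ e e0).
  by apply: filterS => x; rewrite distrC.
by apply: filterS => x /eA.
Qed.

(** An open set is a countable union of cubes with rational centre and side [2 / (k + 1)], and each
    cube is a finite intersection of coordinate conditions. *)
Lemma open_measurable_row n (U : set 'rV[R]_n) : open U ->
  measurable (@row_of_tuple R n @^-1` U).
Proof.
move=> oU.
pose B (q : 'rV[rat]_n) (k : nat) : set 'rV[R]_n :=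
  [set y | forall j, `|y 0 j - ratr (q 0 j)| < k.+1%:R^-1].
have mB q k : measurable (@row_of_tuple R n @^-1` B q k).
  rewrite (_ : _ @^-1` _ = \bigcap_(j in [set: 'I_n])
     (@row_of_tuple R n @^-1` [set y | `|y 0 j - ratr (q 0 j)| < k.+1%:R^-1])).
    apply: fin_bigcap_measurable => // j _; rewrite -[X in measurable X]setTI.
    have : measurable_fun setT (fun t : n.-tuple R => `|row_of_tuple t 0 j - ratr (q 0 j)|).
      apply: measurableT_comp => //; apply: measurable_funB => //.
      exact: measurable_row_coord.
    move=> /(_ measurableT `]-oo, k.+1%:R^-1[%classic (measurable_itv _)).
    congr (measurable (_ `&` _)); apply/seteqP; split => t /=; rewrite in_itv//=.
  by apply/seteqP; split => [t tB j _|t tB j]; [exact: tB|exact: (tB j I)].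
pose I := [set qk : 'rV[rat]_n * nat | B qk.1 qk.2 `<=` U].
rewrite (_ : _ @^-1` _ = \bigcup_(qk in I) (@row_of_tuple R n @^-1` B qk.1 qk.2)).
  rewrite bigcup_mkcond; apply: countable_bigcupT_measurable => // -[q k].
  by case: ifPn => // _; exact: mB.
apply/seteqP; split => t /=; last by move=> [[q k] /= qkU tB]; exact: qkU.
move=> Ut; have /nbhs_rowP[e e0 eU] : nbhs (row_of_tuple t) U by exact: open_nbhs_nbhs.
pose k := Num.truncn (2 / e).
have ke : k.+1%:R^-1 < e / 2.
  rewrite -[e / 2]invrK ltf_pV2 ?posrE ?invr_gt0 ?divr_gt0// invf_div.
  by rewrite truncnS_gt.
have qP j : exists q : rat, `|row_of_tuple t 0 j - ratr q| < k.+1%:R^-1.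
  have [q qP] := @rat_in_itvoo _ (row_of_tuple t 0 j - k.+1%:R^-1) (row_of_tuple t 0 j + k.+1%:R^-1) ltac:(by rewrite ltrD2l gtrN).
  by exists q; rewrite distrC ltr_distl; move: qP; rewrite in_itv/= => ->.
have [q qt] := choice qP.
exists (\row_j q j, k) => /=; last by move=> j; rewrite [(\row__ _) _ _]mxE; exact: qt.
move=> y yB; apply: eU => j; have := qt j; have := yB j => /=; rewrite !mxE.
move=> h2 h1; rewrite -(subrKA (ratr (q j))) (le_lt_trans (ler_normD _ _))//.
rewrite (distrC (ratr _)) (lt_trans (ltrD h2 h1))//.
by rewrite [ltRHS](splitr e) ltrD.
Qed.

Lemma open_continuous_measurable n (U : set 'rV[R]_n) (g : 'rV[R]_n -> R) :
  open U -> (forall x, U x -> {for x, continuous g}) ->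
  measurable_fun (@row_of_tuple R n @^-1` U) (g \o row_of_tuple).
Proof.
move=> oU cg.
apply: (measurability _ (RGenOInfty.measurableE R)) => _ [_ [a ->] <-] /=.
rewrite (_ : _ `&` _ = @row_of_tuple R n @^-1` (U `&` [set x | a < g x])).
  apply: open_measurable_row; rewrite openE => x [Ux gx].
  have h1 : nbhs x U by exact: open_nbhs_nbhs.
  have h2 : nbhs x [set x | a < g x].
    by apply: (cg x Ux [set y | a < y]); apply: open_nbhs_nbhs; split; [exact: open_gt|].
  exact: filterI.
by apply/seteqP; split => t /=; rewrite in_itv/= andbT.
Qed.

Lemma continuous_measurable_row n (g : 'rV[R]_n -> R) : continuous g ->
  measurable_fun setT (g \o row_of_tuple).
Proof.
move=> cg; rewrite -(preimage_setT (@row_of_tuple R n)).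
by apply: open_continuous_measurable => [|x _]; [exact: openT|exact: cg].
Qed.

Lemma ge0_integral_prod n (g : 'I_n -> R -> R) :
  (forall j, measurable_fun setT (g j)) -> (forall j x, 0 <= g j x) ->
  (\int[lebesgue_tuple R n]_t (\prod_j g j (row_of_tuple t 0 j))%:E =
   \prod_j \int[leb]_x (g j x)%:E)%E.
Proof.
elim: n g => [|n IH] g mg g0.
  by rewrite ge0_integral_lebesgue_0 !big_ord0.
have mprod : forall m (h : 'I_m -> R -> R), (forall j, measurable_fun setT (h j)) ->
    measurable_fun setT (fun t : m.-tuple R => \prod_j h j (row_of_tuple t 0 j)).
  move=> m h mh; apply: measurable_prod => j _.
  by apply: measurableT_comp => //; exact: measurable_row_coord.
pose f (v : 'rV[R]_(1 + n)) := (\prod_j g j (v 0 j))%:E.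
rewrite [LHS](@ge0_integral_row _ _ f); last 2 first.
- by apply/measurable_EFinP; exact: mprod.
- by move=> v; rewrite lee_fin prodr_ge0.
rewrite big_ord_recl -IH// -ge0_integralZr//; last 3 first.
- by apply/measurable_EFinP; exact: mg.
- by move=> x _; rewrite lee_fin.
- by apply: integral_ge0 => t _; rewrite lee_fin prodr_ge0.
apply: eq_integral => x _; rewrite -ge0_integralZl_EFin//; last 2 first.
- by move=> t _; rewrite lee_fin prodr_ge0.
- by apply/measurable_EFinP; exact: (mprod n (fun j => g (lift ord0 j))).
apply: eq_integral => t _; rewrite /f big_ord_recl EFinM; congr (_ * _)%:E.
  congr g; rewrite -[RHS](_ : row_mx x%:M (row_of_tuple t) 0 (lshift n ord0) = x).
    by congr (row_mx _ _ _ _); exact: val_inj.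
  by rewrite row_mxEl mxE eqxx mulr1n.
apply: eq_bigr => j _; congr g.
by rewrite -[RHS](row_mxEr x%:M); congr (row_mx _ _ _ _); exact: val_inj.
Qed.

End RowTopology.

(** * Dyadic cells *)

Section DyadicCells.
Context {R : realType}.
Local Notation leb := (@lebesgue_measure R).
Local Notation lam := (lebesgue_tuple R).

Lemma lebesgue_tuple_box n (D : 'I_n -> set R) : (forall j, measurable (D j)) ->
  lam n [set t | forall j, D j (tnth t j)] = (\prod_j leb (D j))%E.
Proof.
move=> mD; have mB : measurable [set t : n.-tuple R | forall j, D j (tnth t j)].
  rewrite (_ : mkset _ = \bigcap_(j in [set: 'I_n]) ((@tnth n R)^~ j @^-1` D j)).
    apply: fin_bigcap_measurable => // j _; rewrite -[X in measurable X]setTI.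
    by apply: measurable_tnth => //; exact: mD.
  by apply/seteqP; split => [t tB j _|t tB j]; [exact: tB|exact: (tB j I)].
transitivity (\int[lam n]_t (\1_[set t : n.-tuple R | forall j, D j (tnth t j)] t)%:E)%E.
  by rewrite integral_indic// setIT.
transitivity (\int[lam n]_t (\prod_j \1_(D j) (row_of_tuple t 0 j))%:E)%E.
  apply: eq_integral => t _; congr EFin; rewrite indicE.
  have [/set_mem/= h|/negP h] := boolP (t \in _).
    by rewrite big1// => j _; rewrite indicE mxE mem_set//; exact: h.
  apply/esym/eqP/prodf_eq0; apply: contrapT => h'; apply: h; apply/mem_set => j /=.
  apply: contrapT => nD; apply: h'; exists j => //.
  by rewrite mxE indicE memNset.
rewrite (@ge0_integral_prod _ n (fun j => \1_(D j)))//; apply: eq_bigr => j _.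
by rewrite integral_indic ?setIT//; exact: mD.
Qed.

(** The half-open dyadic cube of side [2^-N] with lower corner [z / 2^N]. With the floor function,
    the cells of one level form a partition indexed by integer vectors. *)
Definition cell n N (z : 'rV[int]_n) : set 'rV[R]_n :=
  [set y | forall j, Num.floor (2 ^+ N * y 0 j) = z 0 j].

Lemma floor_dyadic N (x : R) (z : int) : (Num.floor (2 ^+ N * x) = z) <->
  z%:~R / 2 ^+ N <= x < (z%:~R + 1) / 2 ^+ N.
Proof.
have N0 : 0 < 2 ^+ N :> R by rewrite exprn_gt0.
rewrite ler_pdivrMr// ltr_pdivlMr// [x * _]mulrC.
by split => [<-|?]; [have := floor_itv (2 ^+ N * x); rewrite intrD|apply: floor_def; rewrite intrD].
Qed.

Lemma measurable_preimage_cell n N (z : 'rV[int]_n) d (T : measurableType d) (D : set T)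
    (F : T -> 'rV[R]_n) : measurable D ->
  (forall j, measurable_fun D (fun t => F t 0 j)) -> measurable (D `&` F @^-1` cell N z).
Proof.
move=> mD mF.
rewrite (_ : _ `&` _ = D `&` \bigcap_(j in [set: 'I_n])
    (D `&` (fun t => F t 0 j) @^-1` `[(z 0 j)%:~R / 2 ^+ N, ((z 0 j)%:~R + 1) / 2 ^+ N[)).
  by apply: measurableI => //; apply: fin_bigcap_measurable => // j _; exact: mF.
apply/seteqP; split => t [Dt]; rewrite /cell/=.
  by move=> h; split=> // j _; split=> //=; rewrite in_itv/=; exact/floor_dyadic.
by move=> h; split=> // j; have [_/=] := h j I; rewrite in_itv/= => /floor_dyadic.
Qed.

Lemma measurable_cell n N (z : 'rV[int]_n) : measurable (@row_of_tuple R n @^-1` cell N z).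
Proof.
rewrite -[X in measurable X]setTI; apply: measurable_preimage_cell => // j.
exact: measurable_row_coord.
Qed.

Lemma prod_cst_EFin n (x : R) : (\prod_(j < n) x%:E = (x ^+ n)%:E)%E.
Proof. by elim: n => [|n IH]; rewrite ?big_ord0// big_ord_recl IH exprS EFinM. Qed.

Lemma lebesgue_cell n N (z : 'rV[int]_n) :
  lam n (@row_of_tuple R n @^-1` cell N z) = (((2 ^+ N)^-1) ^+ n)%:E.
Proof.
have N0 : 0 < 2 ^+ N :> R by rewrite exprn_gt0.
pose D j : set R := `[(z 0 j)%:~R / 2 ^+ N, ((z 0 j)%:~R + 1) / 2 ^+ N[%classic.
rewrite (_ : _ @^-1` _ = [set t | forall j, D j (tnth t j)]).
  rewrite lebesgue_tuple_box -?prod_cst_EFin; last by move=> j; exact: measurable_itv.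
  apply: eq_bigr => j _.
  rewrite lebesgue_measure_itv/= lte_fin ltr_pM2r ?invr_gt0// ltrDl ltr01.
  by rewrite -EFinB -mulrBl addrAC subrr add0r mul1r.
apply/seteqP; split => t /= h j; first by rewrite /D/= in_itv/=; apply/floor_dyadic; rewrite -(h j) mxE.
by rewrite mxE; apply/floor_dyadic; have := h j; rewrite /D/= in_itv.
Qed.

(** This makes the cells nested: the index at level [N + 1] determines the index at level [N]. *)
Lemma floor_halve (a b : R) : Num.floor (2 * a) = Num.floor (2 * b) -> Num.floor a = Num.floor b.
Proof.
move=> ab; apply/eqP; rewrite eq_le; apply/andP; split; rewrite floor_ge_int.
  have := floor_le a; have := floor_le (2 * b); rewrite -ab.
  have : (2 * Num.floor a <= Num.floor (2 * a)) by rewrite floor_ge_int intrM ler_pM2l// floor_le.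
  rewrite -(ler_int R) intrM; lra.
have := floor_le b; have := floor_le (2 * a); rewrite ab.
have : (2 * Num.floor b <= Num.floor (2 * b)) by rewrite floor_ge_int intrM ler_pM2l// floor_le.
rewrite -(ler_int R) intrM; lra.
Qed.

Definition cellidx n N (y : 'rV[R]_n) : 'rV[int]_n := \row_j Num.floor (2 ^+ N * y 0 j).

Lemma cellP n N (z : 'rV[int]_n) y : cell N z y <-> cellidx N y = z.
Proof.
split=> [h|<- j]; last by rewrite mxE.
by apply/rowP => j; rewrite mxE.
Qed.

Lemma cell_subset n N M (y : 'rV[R]_n) : (N <= M)%N ->
  cell M (cellidx M y) `<=` cell N (cellidx N y).
Proof.
move=> /subnK <-; elim: (M - N)%N => [//|k IH] v vc; apply: IH => j.
have := vc j; rewrite !mxE; rewrite addSn exprS -!mulrA.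
exact: floor_halve.
Qed.

Lemma cell_near n (y : 'rV[R]_n) (A : set 'rV[R]_n) : nbhs y A ->
  exists N, cell N (cellidx N y) `<=` A.
Proof.
move=> /nbhs_rowP[e e0 eA].
(* [N > 1 / e] is enough, since [2^N > N] makes the side of the cell smaller than [e]. *)
exists (Num.truncn e^-1).+1 => v vc; apply: eA => j.
set N := (Num.truncn _).+1 in vc *.
have N0 : 0 < 2 ^+ N :> R by rewrite exprn_gt0.
have Ne : (2 ^+ N)^-1 < e.
  rewrite -[e]invrK ltf_pV2 ?posrE ?invr_gt0//.
  rewrite (lt_le_trans (truncnS_gt _))// -natrX ler_nat.
  by apply: ltnW; exact: ltn_expl.
have /floor_dyadic h1 := vc j.
have /floor_dyadic h2 := erefl (Num.floor (2 ^+ N * y 0 j)).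
rewrite mxE in h1; apply: le_lt_trans Ne; rewrite ler_norml.
rewrite !mulrDl !mul1r in h1 h2.
by apply/andP; split; lra.
Qed.

End DyadicCells.

Section ForContinuous.
Context {R : realType} {T : topologicalType}.
Implicit Types (f g : T -> R) (x : T).

Lemma for_continuous_cst x (a : R) : {for x, continuous (fun=> a : R)}.
Proof. exact: cvg_cst. Qed.

Lemma for_continuousD f g x : {for x, continuous f} -> {for x, continuous g} ->
  {for x, continuous (fun y => f y + g y)}.
Proof. exact: cvgD. Qed.

Lemma for_continuousM f g x : {for x, continuous f} -> {for x, continuous g} ->
  {for x, continuous (fun y => f y * g y)}.
Proof. exact: cvgM. Qed.

Lemma for_continuous_norm f x : {for x, continuous f} ->
  {for x, continuous (fun y => `|f y|)}.
Proof. exact: cvg_norm. Qed.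

Lemma for_continuous_sum I (s : seq I) (F : I -> T -> R) x :
  (forall i, {for x, continuous (F i)}) ->
  {for x, continuous (fun y => \sum_(i <- s) F i y)}.
Proof.
move=> cF; elim: s => [|i s IH].
  rewrite (_ : (fun _ => _) = fun=> 0); first exact: for_continuous_cst.
  by apply/funext => y; rewrite big_nil.
rewrite (_ : (fun _ => _) = fun y => F i y + \sum_(i <- s) F i y).
  exact: for_continuousD.
by apply/funext => y; rewrite big_cons.
Qed.

Lemma for_continuous_prod I (s : seq I) (F : I -> T -> R) x :
  (forall i, {for x, continuous (F i)}) ->
  {for x, continuous (fun y => \prod_(i <- s) F i y)}.
Proof.
move=> cF; elim: s => [|i s IH].
  rewrite (_ : (fun _ => _) = fun=> 1); first exact: for_continuous_cst.
  by apply/funext => y; rewrite big_nil.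
rewrite (_ : (fun _ => _) = fun y => F i y * \prod_(i <- s) F i y).
  exact: for_continuousM.
by apply/funext => y; rewrite big_cons.
Qed.

End ForContinuous.

Lemma near_continuous_lt {R : realType} (T : topologicalType) (g : T -> R) x a :
  {for x, continuous g} -> g x < a -> nbhs x [set y | g y < a].
Proof. by move=> cg gx; apply: (cvgr_lt (g x)). Qed.

Lemma near_continuous_gt {R : realType} (T : topologicalType) (g : T -> R) x a :
  {for x, continuous g} -> a < g x -> nbhs x [set y | a < g y].
Proof. by move=> cg gx; apply: (cvgr_gt (g x)). Qed.

(** Both points move near [u], unlike in the ordinary derivative; this is what controls [T] on a
    whole cell. Vectors are rows and [L] acts on the right, so [L] is the transpose of the Jacobian
    matrix. The bound [r] is on the sup norm. *)
Definition strict_derivative {R : realType} {n : nat} (T : 'rV[R]_n -> 'rV[R]_n)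
    (u : 'rV[R]_n) (L : 'M[R]_n) :=
  forall e : R, 0 < e -> exists2 d : R, 0 < d & forall (y y' : 'rV[R]_n) (r : R),
    (forall k, `|y 0 k - u 0 k| < d) -> (forall k, `|y' 0 k - u 0 k| < d) ->
    (forall k, `|y 0 k - y' 0 k| <= r) ->
    forall j, `|((T y - T y') - (y - y') *m L) 0 j| <= e * r.

Section ChangeOfVariables.
Context {R : realType} {n : nat}.
Variables (U V : set 'rV[R]_n) (T S : 'rV[R]_n -> 'rV[R]_n)
  (J : 'rV[R]_n -> 'M[R]_n) (psi : 'rV[R]_n -> R).
Local Notation leb := (@lebesgue_measure R).
Local Notation lam := (lebesgue_tuple R n).
Local Notation row := (@row_of_tuple R n).

Hypotheses (oU : open U) (oV : open V) (SU : forall x, V x -> U (S x))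
  (TS : forall x, V x -> T (S x) = x) (cS : forall x, V x -> {for x, continuous S})
  (uJ : forall u, U u -> J u \in unitmx) (psi0 : forall u, U u -> 0 < psi u)
  (cpsi : forall u, U u -> {for u, continuous psi})
  (cdet : forall u, U u -> {for u, continuous (fun u => \det (J u))}).
Hypothesis strictJ : forall u, U u -> strict_derivative T u (J u).

(* [Q] is small enough for [T] to be within relative error [e] of a linear map
   and for [psi] and the Jacobian determinant to be constant up to a factor
   [1 + e]. *)
Definition good_set (e : R) (Q : set 'rV[R]_n) := exists (L : 'M[R]_n) (c : R),
  [/\ Q `<=` U, L \in unitmx, 0 < c,
     forall y y' r, Q y -> Q y' -> (forall k, `|y 0 k - y' 0 k| <= r) ->
       forall j, `|((T y - T y') *m invmx L - (y - y')) 0 j| <= e * r &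
     forall y, Q y -> psi y <= (1 + e) * c /\
       c * `|\det L| <= (1 + e) * (psi y * `|\det (J y)|)].

Lemma good_subset (e : R) P Q : P `<=` Q -> good_set e Q -> good_set e P.
Proof.
move=> PQ [L [c [QU uL c0 h1 h2]]]; exists L, c; split => //.
- exact: subset_trans QU.
- by move=> y y' r /PQ Qy /PQ Qy'; exact: h1.
- by move=> y /PQ; exact: h2.
Qed.

(** [L] and [c] are the values of the derivative and of [psi] at [u]. Each required estimate holds
    in a neighbourhood of [u], by strict differentiability or continuity, and a small enough cell
    fits inside. *)
Lemma good_near (e : R) u : 0 < e -> U u -> exists N, good_set e (cell N (cellidx N u)).
Proof.
move=> e0 Uu.
(* [K] bounds the column sums of the inverse Jacobian in absolute value, so tolerance [e / K] for
   [T] becomes tolerance [e] after multiplication by the inverse. The added 1 makes [K] positive. *)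
pose K := \sum_i \sum_j `|invmx (J u) i j| + 1.
have K0 : 0 < K by rewrite ltr_wpDl// sumr_ge0// => i _; rewrite sumr_ge0.
have eK0 : 0 < e / K by rewrite divr_gt0.
have [d d0 dJ] := strictJ Uu eK0.
have n1 : nbhs u [set y | forall k, `|y 0 k - u 0 k| < d] by apply/nbhs_rowP; exists d.
have n2 : nbhs u U by exact: open_nbhs_nbhs.
have n3 : nbhs u [set y | psi y < (1 + e) * psi u].
  apply: near_continuous_lt; first exact: cpsi.
  by rewrite ltr_pMl ?psi0// ltrDl.
have det0 : 0 < `|\det (J u)|.
  by rewrite normr_gt0 -unitfE -unitmxE; exact: uJ.
have n4 : nbhs u [set y | psi u * `|\det (J u)| < (1 + e) * (psi y * `|\det (J y)|)].
  have cw : {for u, continuous (fun y => (1 + e) * (psi y * `|\det (J y)|))}.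
    apply: for_continuousM; first exact: for_continuous_cst.
    by apply: for_continuousM; [exact: cpsi|apply: for_continuous_norm; exact: cdet].
  apply: near_continuous_gt; first exact: cw.
  by rewrite ltr_pMl ?mulr_gt0 ?psi0// ltrDl.
have [N cN] := cell_near (filterI (filterI n1 n2) (filterI n3 n4)).
exists N, (J u), (psi u); split.
- by move=> y /cN[[]].
- exact: uJ.
- exact: psi0.
- move=> y y' r /cN[[yd _] _] /cN[[yd' _] _] yr j.
  have r0 : 0 <= r by exact: le_trans (yr j).
  have -> : (T y - T y') *m invmx (J u) - (y - y') =
      ((T y - T y') - (y - y') *m J u) *m invmx (J u).
    by rewrite [RHS]mulmxBl mulmxK//; exact: uJ.
  rewrite mxE (le_trans (ler_norm_sum _ _ _))//.
  apply: (@le_trans _ _ (\sum_i (e / K * r) * `|invmx (J u) i j|)).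
    by apply: ler_sum => i _; rewrite normrM ler_wpM2r//; exact: dJ.
  have colK : \sum_i `|invmx (J u) i j| <= K.
    rewrite /K exchange_big/= [in leRHS](bigD1 j)//= -addrA lerDl addr_ge0// sumr_ge0// => i _.
    by rewrite sumr_ge0.
  have erK : 0 <= e / K * r by rewrite mulr_ge0// ltW.
  by rewrite -mulr_sumr (le_trans (ler_wpM2l erK colK))// mulrAC divfK ?gt_eqF.
- by move=> y /cN[_ [/ltW h3 /ltW h4]].
Qed.

Let mV : measurable (row @^-1` V).
Proof. exact: open_measurable_row. Qed.

Let mSV j : measurable_fun (row @^-1` V) (fun t => S (row t) 0 j).
Proof.
apply: (@open_continuous_measurable _ _ V (fun x => S x 0 j)) => // x Vx.
apply: (@continuous_comp _ _ _ S (fun x => x 0 j)); first exact: cS.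
exact: continuous_row_coord.
Qed.

Let mpsiS : measurable_fun (row @^-1` V) (fun t => psi (S (row t))).
Proof.
apply: (@open_continuous_measurable _ _ V (psi \o S)) => // x Vx.
by apply: continuous_comp; [exact: cS|exact/cpsi/SU].
Qed.

Let mU : measurable (row @^-1` U).
Proof. exact: open_measurable_row. Qed.

Let mw : measurable_fun (row @^-1` U) (fun t => psi (row t) * `|\det (J (row t))|).
Proof.
apply: (@open_continuous_measurable _ _ U (fun u => psi u * `|\det (J u)|)) => // u Uu.
by apply: for_continuousM; [exact: cpsi|apply: for_continuous_norm; exact: cdet].
Qed.

(** If [S x] lies in the cell, then [x] lies in the image under an affine map with linear part [L]
    of the cell widened by the factor [1 + 2 e] in every direction. This image has volume
    [(1 + 2 e)^n] times the determinant of [L] in absolute value times the volume of the cell. The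
    two factors [1 + e] come from replacing [psi] and the determinant by constants. *)
Lemma good_cell_le (e : R) N z : 0 < e -> good_set e (cell N z) ->
  (\int[lam]_(t in row @^-1` (V `&` S @^-1` cell N z)) (psi (S (row t)))%:E <=
   ((1 + e) ^+ 2 * (1 + 2 * e) ^+ n)%:E *
   \int[lam]_(t in row @^-1` cell N z) (psi (row t) * `|\det (J (row t))|)%:E)%E.
Proof.
move=> e0 [L [c [QU uL c0 h1 h2]]].
set s := (2 ^+ N)^-1 : R.
have s0 : 0 < s by rewrite invr_gt0 exprn_gt0.
(* The lower corner of the cell; relative to it the cell is [[0, s[] in every coordinate, and [D]
   widens this by the error [e * s] on both sides. *)
pose u0 : 'rV[R]_n := \row_j ((z 0 j)%:~R * s).
have Qu0 : cell N z u0.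
  by move=> j; apply/floor_dyadic; rewrite mxE lexx ltr_pM2r// ltrDl ltr01.
pose D (j : 'I_n) : set R := `[- (e * s), s + e * s]%classic.
pose B : set 'rV[R]_n := [set v | forall j, D j (v 0 j)].
have mB : measurable (row @^-1` B).
  rewrite (_ : _ @^-1` _ = \bigcap_(j in [set: 'I_n]) ((fun t => row t 0 j) @^-1` D j)).
    apply: fin_bigcap_measurable => // j _; rewrite -[X in measurable X]setTI.
    by apply: measurable_row_coord => //; exact: measurable_itv.
  by apply/seteqP; split => [t tB j _|t tB j]; [exact: tB|exact: (tB j I)].
have mQ : measurable (row @^-1` cell N z) by exact: measurable_cell.
have mSQ : measurable (row @^-1` (V `&` S @^-1` cell N z)).
  exact: (@measurable_preimage_cell _ _ _ _ _ _ _ (S \o row)).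
have inB t : (V `&` S @^-1` cell N z) (row t) -> B ((row t - T u0) *m invmx L).
  move=> [Vt SQ] j; have us k : `|S (row t) 0 k - u0 0 k| <= s.
    have /floor_dyadic := SQ k; rewrite mxE -/s mulrDl mul1r => /andP[? ?].
    by rewrite ler_norml; apply/andP; split; lra.
  have := h1 (S (row t)) u0 s SQ Qu0 us j; rewrite TS// [in X in X -> _]mxE [(- (S _ - _)) _ _]mxE.
  rewrite ler_norml /D/= in_itv/=; have /floor_dyadic := SQ j; rewrite -/s.
  rewrite [(S _ - u0) _ _]mxE [(- u0) _ _]mxE [u0 _ _]mxE mulrDl mul1r.
  set X := (_ *m _) 0 j; move: X => X; lra.
have mB' : measurable_fun setT (fun t => \1_B ((row t - T u0) *m invmx L) : R).
  rewrite (_ : (fun t => _) = (\1_B : _ -> R) \o (fun t => (row t - T u0) *m invmx L))//.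
  apply: measurable_comp_row; last by rewrite (_ : _ \o _ = \1_(row @^-1` B))//; exact: measurable_indic.
  move=> j; rewrite (_ : (fun _ => _) = fun t => \sum_k (row t 0 k - T u0 0 k) * invmx L k j).
    apply: measurable_sum => k; apply: measurable_funM => //.
    by apply: measurable_funB => //; exact: measurable_row_coord.
  by apply/funext => t; rewrite mxE; apply: eq_bigr => k _; rewrite !mxE.
apply: (@le_trans _ _ (((1 + e) * c * `|\det L| * (s ^+ n * (1 + 2 * e) ^+ n))%:E)).
  have indE : (\int[lam]_t (\1_B ((row t - T u0) *m invmx L))%:E =
      (`|\det L| * (s ^+ n * (1 + 2 * e) ^+ n))%:E)%E.
    pose f v := (\1_B v)%:E : \bar R.
    have mf : measurable_fun setT (f \o row).
      rewrite (_ : f \o row = EFin \o \1_(row @^-1` B))//.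
      by apply/measurable_EFinP; exact: measurable_indic.
    have f0 v : (0 <= f v)%E by rewrite lee_fin.
    have mfL : measurable_fun setT ((fun v => f (v *m invmx L)) \o row).
      by apply: (measurable_comp_row (measurable_row_mulmx _)).
    rewrite [LHS](@ge0_integral_translate _ _ (fun v => f (v *m invmx L)))//.
    have := ge0_integral_linear (_ : invmx L \in unitmx) mf f0.
    rewrite unitmx_inv => /(_ uL).
    have -> : (\int[lam]_t f (row t) = (s ^+ n * (1 + 2 * e) ^+ n)%:E)%E.
      transitivity (\int[lam]_t (\1_(row @^-1` B) t)%:E)%E; first by [].
      rewrite integral_indic// setIT (_ : _ @^-1` _ = [set t | forall j, D j (tnth t j)]).
        transitivity (\prod_j leb (D j))%E.
          by apply: lebesgue_tuple_box => j; exact: measurable_itv.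
        rewrite -exprMn -prod_cst_EFin; apply: eq_bigr => j _.
        rewrite lebesgue_measure_itv/= lte_fin -EFinB.
        have es : 0 < e * s by rewrite mulr_gt0.
        rewrite ifT; last by lra.
        by congr EFin; ring.
      by apply/seteqP; split => t /= h j; have := h j; rewrite mxE.
    move=> Lint; rewrite EFinM -Lint det_inv normfV muleA -EFinM divff ?mul1e//.
    by rewrite normr_eq0 -unitfE -unitmxE.
  have -> : ((1 + e) * c * `|\det L| * (s ^+ n * (1 + 2 * e) ^+ n))%:E =
      (\int[lam]_t (((1 + e) * c)%:E * (\1_B ((row t - T u0) *m invmx L))%:E))%E.
    rewrite ge0_integralZl_EFin//; last 2 first.
    - by apply/measurable_EFinP; exact: mB'.
    - by rewrite mulr_ge0 ?addr_ge0 ?(ltW e0) ?(ltW c0).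
    by rewrite indE -EFinM; congr EFin; ring.
  rewrite integral_mkcond; apply: ge0_le_integral => //.
  - move=> t _; rewrite patchE; case: ifPn => // /set_mem[Vt _].
    by rewrite lee_fin ltW//; exact/psi0/SU.
  - apply/(measurable_restrictT _ mSQ)/measurable_EFinP.
    by apply: measurable_funS mpsiS => // t [].
  - exact/measurable_EFinP/measurable_funM.
  - move=> t _; rewrite patchE; case: ifPn => [/set_mem tSQ|_].
      rewrite -EFinM indicE mem_set ?mulr1; last exact: inB.
      by rewrite lee_fin; have [] := h2 _ tSQ.2.
    by rewrite -EFinM lee_fin !mulr_ge0 ?addr_ge0 ?(ltW e0) ?(ltW c0).
have e1 : 0 < 1 + e by rewrite addr_gt0.
(* The bound is rewritten as a multiple of the integral over the cell of a constant that lies below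
   the integrand there. *)
have -> : ((1 + e) * c * `|\det L| * (s ^+ n * (1 + 2 * e) ^+ n))%:E =
    (((1 + e) ^+ 2 * (1 + 2 * e) ^+ n)%:E *
     \int[lam]_(t in row @^-1` cell N z) (c * `|\det L| / (1 + e))%:E)%E.
  rewrite integral_cst//; transitivity (((1 + e) ^+ 2 * (1 + 2 * e) ^+ n)%:E *
      ((c * `|\det L| / (1 + e))%:E * (s ^+ n)%:E))%E; last first.
    by congr (_ * (_ * _))%E; apply/esym; exact: lebesgue_cell.
  rewrite -!EFinM; congr EFin.
  by rewrite -/s; field; rewrite gt_eqF.
rewrite lee_pmul2l//; last by rewrite lte_fin mulr_gt0// exprn_gt0// addr_gt0// mulr_gt0.
apply: ge0_le_integral => //.
- by move=> t _; rewrite lee_fin divr_ge0// ?mulr_ge0// ltW.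
- by apply/measurable_EFinP; apply: measurable_funS mw => // t /QU.
- move=> t /h2[_ h]; by rewrite lee_fin ler_pdivrMr// [leRHS]mulrC.
Qed.

Lemma cellidx_eq N z (y : 'rV[R]_n) : cell N z y -> cellidx N y = z.
Proof. by move/cellP. Qed.

Let goodpart (e : R) N : set 'rV[R]_n := [set u | good_set e (cell N (cellidx N u))].

(** The cell estimate is summed over the good cells of level [N]. They are numbered by [pickle],
    with the empty set for every code that belongs to no good cell; disjointness of the cells turns
    both sides into sums. *)
Let goodpart_le (e : R) N : 0 < e ->
  measurable (row @^-1` (V `&` S @^-1` goodpart e N)) /\
  (\int[lam]_(t in row @^-1` (V `&` S @^-1` goodpart e N)) (psi (S (row t)))%:E <=
   ((1 + e) ^+ 2 * (1 + 2 * e) ^+ n)%:E *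
   \int[lam]_(t in row @^-1` U) (psi (row t) * `|\det (J (row t))|)%:E)%E.
Proof.
move=> e0.
pose G k : set 'rV[R]_n := match @pickle_inv 'rV[int]_n k with
  | Some z => if `[< good_set e (cell N z) >] then cell N z else set0
  | None => set0 end.
have GP k : G k = set0 \/ exists z, [/\ G k = cell N z, pickle z = k & good_set e (cell N z)].
  rewrite /G; have := @pickle_invK 'rV[int]_n k.
  case: (pickle_inv k) => [z|] /=; last by left.
  by move=> <-; case: ifPn => [/asboolP gz|_]; [right; exists z|left].
have GU : goodpart e N = \bigcup_k G k.
  apply/seteqP; split => [u gu|u [k _]].
    exists (pickle (cellidx N u)) => //; rewrite /G pickleK_inv ifT; last exact/asboolP.
    exact/cellP.
  by case: (GP k) => [->//|[z [-> _ gz]]] /cellidx_eq uz; rewrite /goodpart /= uz.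
have trG : trivIset setT G.
  move=> i j _ _ [u []]; case: (GP i) => [->//|[z [-> <- _]]] /cellidx_eq <-.
  by case: (GP j) => [->//|[z' [-> <- _]]] /cellidx_eq <-.
have mG k : measurable (row @^-1` G k).
  by case: (GP k) => [->|[z [-> _ _]]]; [rewrite preimage_set0|exact: measurable_cell].
have mVG k : measurable (row @^-1` (V `&` S @^-1` G k)).
  case: (GP k) => [->|[z [-> _ _]]]; first by rewrite preimage_set0 setI0 preimage_set0.
  exact: (@measurable_preimage_cell _ _ _ _ _ _ _ (S \o row)).
have GsubU k : G k `<=` U.
  by case: (GP k) => [->//|[z [-> _ [L [c []]]]]].
have VGE : row @^-1` (V `&` S @^-1` goodpart e N) = \bigcup_k row @^-1` (V `&` S @^-1` G k).
  rewrite GU; apply/seteqP; split => [t [Vt [k _ Gt]]|t [k _ [Vt Gt]]]; first by exists k.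
  by split => //; exists k.
have K0 : 0 <= (1 + e) ^+ 2 * (1 + 2 * e) ^+ n.
  by rewrite mulr_ge0// exprn_ge0// addr_ge0// ?mulr_ge0// ltW.
split; first by rewrite VGE; exact: bigcup_measurable.
rewrite VGE [X in (X <= _)%E]ge0_integral_bigcup//=; last 3 first.
- apply/measurable_EFinP; apply: measurable_funS mpsiS => //.
  by apply: bigcup_sub => k _ t [].
- by move=> t [k _ [Vt _]]; rewrite lee_fin ltW//; exact/psi0/SU.
- move=> i j _ _ [t [[_ ti] [_ tj]]].
  exact: (trG i j I I (ex_intro _ (S (row t)) (conj ti tj))).
have w0 t : U (row t) -> (0 <= (psi (row t) * `|\det (J (row t))|)%:E)%E.
  by move=> Ut; rewrite lee_fin mulr_ge0// ltW//; exact: psi0.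
apply: (@le_trans _ _ (\sum_(0 <= k <oo) (((1 + e) ^+ 2 * (1 + 2 * e) ^+ n)%:E *
   \int[lam]_(t in row @^-1` G k) (psi (row t) * `|\det (J (row t))|)%:E))%E).
  apply: lee_nneseries => [k _ _|k _].
    by apply: integral_ge0 => t [Vt _]; rewrite lee_fin ltW//; exact/psi0/SU.
  case: (GP k) => [->|[z [-> _ gz]]]; last exact: good_cell_le.
  by rewrite !preimage_set0 setI0 preimage_set0 !integral_set0 mule0.
rewrite [X in (X <= _)%E]nneseriesZl//; last first.
  by move=> k _; apply: integral_ge0 => t /GsubU Ut; exact: w0.
apply: lee_wpmul2l; first by rewrite lee_fin.
have bU : \bigcup_k row @^-1` G k `<=` row @^-1` U.
  by apply: bigcup_sub => k _ t /GsubU.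
rewrite -ge0_integral_bigcup//=; last 3 first.
- by apply/measurable_EFinP; exact: measurable_funS mw.
- by move=> t /bU; exact: w0.
- by move=> i j _ _ [t [ti tj]]; exact: (trG i j I I (ex_intro _ (row t) (conj ti tj))).
apply: ge0_subset_integral => //; first exact: bigcup_measurable.
exact/measurable_EFinP.
Qed.

(* Applied both to a diffeomorphism and to its inverse, this inequality becomes an
   equality. *)
Lemma change_of_variables_le :
  (\int[lam]_(t in row @^-1` V) (psi (S (row t)))%:E <=
   \int[lam]_(t in row @^-1` U) (psi (row t) * `|\det (J (row t))|)%:E)%E.
Proof.
set B := (X in (_ <= X)%E).
have B0 : (0 <= B)%E.
  by apply: integral_ge0 => t Ut; rewrite lee_fin mulr_ge0// ltW//; exact: psi0.
have step (e : R) : 0 < e -> (\int[lam]_(t in row @^-1` V) (psi (S (row t)))%:E <=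
    ((1 + e) ^+ 2 * (1 + 2 * e) ^+ n)%:E * B)%E.
  (* As [N] grows these sets increase to the preimage of [V], because cells are nested and every
     point lies in a good cell of some level. The bound does not depend on [N], so it survives
     monotone convergence; afterwards [e] tends to 0 along the harmonic sequence. *)
  move=> e0; pose F N := row @^-1` (V `&` S @^-1` goodpart e N).
  have VE : row @^-1` V = \bigcup_N F N.
    apply/seteqP; split => [t Vt|t [N _ []//]].
    by have [N gN] := good_near e0 (SU Vt); exists N.
  rewrite VE; apply: (cvge_le _ (ge0_nondecreasing_set_cvg_integral _ _ _ _)).
  - by apply: nearW => N; exact: (goodpart_le N e0).2.
  - move=> N M NM; apply/subsetPset => t [Vt gt]; split => //.
    by apply: good_subset gt; exact: cell_subset.
  - by move=> N; exact: (goodpart_le N e0).1.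
  - by move=> N; apply/measurable_EFinP; apply: measurable_funS mpsiS => // t [].
  - by move=> N t [Vt _]; rewrite lee_fin ltW//; exact/psi0/SU.
have [Boo|Boo] := eqVneq B +oo%E; first by rewrite Boo leey.
rewrite -[B]fineK ?ge0_fin_numE ?lt_neqAle ?Boo ?leey//.
rewrite -[B]fineK ?ge0_fin_numE ?lt_neqAle ?Boo ?leey// in step.
set b := fine B in step *.
pose g (h : R) : R := (1 + h) ^+ 2 * (1 + 2 * h) ^+ n * b.
have cg : {for 0, continuous g}.
  have c1 : {for 0, continuous (fun h : R => 1 + h)}.
    by apply: for_continuousD; [exact: for_continuous_cst|exact: cvg_id].
  have c2 : {for 0, continuous (fun h : R => 1 + 2 * h)}.
    apply: for_continuousD; first exact: for_continuous_cst.
    by apply: for_continuousM; [exact: for_continuous_cst|exact: cvg_id].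
  have cX k (f : R -> R) : {for 0, continuous f} -> {for 0, continuous (fun h => f h ^+ k)}.
    move=> cf; elim: k => [|k IH]; first exact: for_continuous_cst.
    rewrite (_ : (fun h => _) = fun h => f h * f h ^+ k); first exact: for_continuousM.
    by apply/funext => h; rewrite exprS.
  by apply: for_continuousM; [apply: for_continuousM; exact: cX|exact: for_continuous_cst].
have -> : b = g 0 by rewrite /g mulr0 addr0 !expr1n !mul1r.
have cgh : (g (harmonic k))%:E @[k --> \oo] --> (g 0)%:E.
  apply: cvg_EFin; first by apply: nearW.
  exact: (cvg_comp _ _ cvg_harmonic cg).
apply: (cvge_ge _ cgh); apply: nearW => k.
by rewrite /g EFinM; apply: step; rewrite /= invr_gt0.
Qed.

End ChangeOfVariables.

Lemma cvg_sumr {R : realType} (T : Type) (F : set_system T) {FF : Filter F} (I : Type)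
    (r : seq I) (f : I -> T -> R) (l : I -> R) : (forall i, f i x @[x --> F] --> l i) ->
  \sum_(i <- r) f i x @[x --> F] --> \sum_(i <- r) l i.
Proof.
move=> fl; elim: r => [|i r IH].
  rewrite big_nil (_ : (fun _ => _) = fun=> 0); first exact: cvg_cst.
  by apply/funext => x; rewrite big_nil.
rewrite big_cons (_ : (fun _ => _) = fun x => f i x + \sum_(i <- r) f i x).
  exact: cvgD.
by apply/funext => x; rewrite big_cons.
Qed.

Lemma near_continuous_dist {R : realType} (T : topologicalType) (g : T -> R) x (e : R) :
  {for x, continuous g} -> 0 < e -> nbhs x [set y | `|g y - g x| < e].
Proof.
move=> /cvgrPdist_lt cg e0; have := cg e e0.
by apply: filterS => y /=; rewrite distrC.
Qed.

Lemma nbhs_forall (T : topologicalType) (I : finType) (P : I -> set T) (x : T) :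
  (forall i, nbhs x (P i)) -> nbhs x [set y | forall i, P i y].
Proof. exact: filter_forall. Qed.

(** * Partial derivatives of class C^1 maps *)

Section PartialDerivatives.
Context {R : realType} {n : nat}.
Implicit Types (f g : 'rV[R]_n -> R) (x y z u : 'rV[R]_n).
Local Notation "''e_' j" := (delta_mx 0 j : 'rV[R]_n) (at level 8, j at level 2, format "''e_' j").

Lemma is_derive_line f x v (t : R) : derivable f (x + t *: v) v ->
  is_derive t 1 (fun s : R => f (x + s *: v)) ('D_v f (x + t *: v)).
Proof.
move=> df.
have E : (fun h : R => h^-1 *: ((fun s : R => f (x + s *: v)) (h *: 1 + t) - f (x + t *: v))) =
   (fun h : R => h^-1 *: (f (h *: v + (x + t *: v)) - f (x + t *: v))).
  apply/funext => h; congr (_ *: (f _ - _)).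
  have -> : h%:A = h by exact: mulr1.
  by rewrite scalerDl addrCA.
by split; [rewrite /derivable E|rewrite /derive E].
Qed.

Lemma is_derive_shift f x v w : derivable f (x + w) v ->
  is_derive x v (fun z => f (z + w)) ('D_v f (x + w)).
Proof.
move=> df.
have E : (fun h : R => h^-1 *: ((fun z => f (z + w)) (h *: v + x) - f (x + w))) =
   (fun h : R => h^-1 *: (f (h *: v + (x + w)) - f (x + w))).
  by apply/funext => h; rewrite addrA.
by split; [rewrite /derivable E|rewrite /derive E].
Qed.

(** The segment is parametrised by [t * a] with [t] in [[0, 1]], which avoids a case distinction on
    the sign of [a]. *)
Lemma line_MVT f x j (a : R) :
  (forall c : R, 0 <= c <= 1 -> derivable f (x + (c * a) *: 'e_j) 'e_j) ->
  exists2 c : R, 0 <= c <= 1 & f (x + a *: 'e_j) - f x = a * pderiv j f (x + (c * a) *: 'e_j).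
Proof.
move=> df; pose phi (t : R) := f (x + (t * a) *: 'e_j).
have dphi (t : R) : 0 <= t <= 1 -> is_derive t 1 phi (a * pderiv j f (x + (t * a) *: 'e_j)).
  move=> t01; have D := is_derive_line (df t t01).
  have D2 : is_derive t 1 (fun s : R => s * a) a.
    have := @is_deriveM R R id (cst a) t 1 1 0 _ _.
    rewrite !scaler0 add0r scaler1.
    by move=> /(_ (is_derive_id t 1) (is_derive_cst a t 1)).
  have := @is_derive1_comp R (fun s : R => f (x + s *: 'e_j)) (fun s => s * a) t _ _ D D2.
  by rewrite mulrC.
have [c c01 E] : exists2 c, c \in `[0, 1]%R &
    phi 1 - phi 0 = (a * pderiv j f (x + (c * a) *: 'e_j)) * (1 - 0).
  apply: MVT_segment => //.
    by move=> t; rewrite in_itv/= => /andP[t0 t1]; apply: dphi; rewrite !ltW.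
  apply: derivable_within_continuous => t; rewrite in_itv/= => t01.
  by have [] := dphi t t01.
exists c; first by rewrite in_itv in c01.
by move: E; rewrite /phi mul1r mul0r scale0r addr0 subr0 mulr1.
Qed.

(** The closed box spanned by [x] and [y], whichever of them is smaller in a given coordinate. *)
Definition inbox x y z := forall k : 'I_n, exists2 c : R, 0 <= c <= 1 &
  z 0 k = x 0 k + c * (y 0 k - x 0 k).

Lemma box_MVT f x y : (forall z, inbox x y z -> forall j, derivable f z 'e_j) ->
  exists2 xi : 'I_n -> 'rV[R]_n, forall j, inbox x y (xi j) &
    f y - f x = \sum_j (y 0 j - x 0 j) * pderiv j f (xi j).
Proof.
move=> df; pose z m : 'rV[R]_n := \row_(k < n) if (k < m)%N then y 0 k else x 0 k.
have zb (j : 'I_n) (c : R) : 0 <= c <= 1 -> inbox x y (z j + (c * (y 0 j - x 0 j)) *: 'e_j).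
  move=> c01 k; rewrite !mxE eqxx/=; have [->|kj] := eqVneq k j.
    by exists c; rewrite // ltnn mulr1.
  rewrite mulr0 addr0; case: ifP => _; last by exists 0; rewrite ?lexx ?ler01// mul0r addr0.
  by exists 1; rewrite ?lexx ?ler01// mul1r addrC subrK.
have zS (j : 'I_n) : z j + (y 0 j - x 0 j) *: 'e_j = z j.+1.
  apply/rowP => k; rewrite !mxE eqxx/= ltnS; have [->|kj] := eqVneq k j.
    by rewrite ltnn leqnn mulr1 addrC subrK.
  by move: kj; rewrite -val_eqE mulr0 addr0 [(k <= j)%N]leq_eqVlt => /negbTE ->.
have step (j : 'I_n) : exists xi, inbox x y xi /\
    f (z j.+1) - f (z j) = (y 0 j - x 0 j) * pderiv j f xi.
  have [c c01 E] := @line_MVT f (z j) j (y 0 j - x 0 j) (fun c c01 => df _ (zb j c c01) j).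
  by exists (z j + (c * (y 0 j - x 0 j)) *: 'e_j); split; [exact: zb|rewrite -E zS].
have [xi xiP] := choice step.
exists xi; first by move=> j; have [] := xiP j.
transitivity (f (z n) - f (z 0%N)).
  congr (f _ - f _); apply/rowP => k; rewrite mxE ?ltn_ord ?ltn0//.
rewrite -(telescope_sumr (fun m => f (z m)))// big_mkord.
by apply: eq_bigr => j _; have [_ ->] := xiP j.
Qed.

Lemma inbox_lt x y z u (d : R) : inbox x y z -> (forall k, `|x 0 k - u 0 k| < d) ->
  (forall k, `|y 0 k - u 0 k| < d) -> forall k, `|z 0 k - u 0 k| < d.
Proof.
move=> xyz xu yu k; have [c /andP[c0 c1] ->] := xyz k.
have -> : x 0 k + c * (y 0 k - x 0 k) - u 0 k =
  (1 - c) * (x 0 k - u 0 k) + c * (y 0 k - u 0 k) by ring.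
have := xu k; have := yu k; move: (x 0 k - u 0 k) (y 0 k - u 0 k) => p q qd pd.
pose M := Num.max `|p| `|q|; have Md : M < d by rewrite gt_max pd qd.
have pM : `|p| <= M by rewrite le_max lexx.
have qM : `|q| <= M by rewrite le_max lexx orbT.
rewrite (le_lt_trans _ Md)// (le_trans (ler_normD _ _))// !normrM.
rewrite ger0_norm ?subr_ge0// (ger0_norm c0).
have c2 : 0 <= 1 - c by rewrite subr_ge0.
rewrite (le_trans (lerD (ler_wpM2l c2 pM) (ler_wpM2l c0 qM)))//.
by rewrite -mulrDl subrK mul1r.
Qed.

(** The mean value theorem on the box expresses the increment by partial derivatives at points near
    [u], and these differ from their values at [u] by less than [e]. *)
Lemma strict_C1 f u (e : R) : 0 < e ->
  (forall j, \forall z \near nbhs u, derivable f z 'e_j) ->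
  (forall j, {for u, continuous (pderiv j f)}) ->
  exists2 d : R, 0 < d & forall y (y' : 'rV[R]_n), (forall k, `|y 0 k - u 0 k| < d) ->
    (forall k, `|y' 0 k - u 0 k| < d) ->
    `|f y - f y' - \sum_j (y 0 j - y' 0 j) * pderiv j f u| <= e * \sum_j `|y 0 j - y' 0 j|.
Proof.
move=> e0 df cf.
have : nbhs u [set z | forall j, derivable f z 'e_j /\ `|pderiv j f z - pderiv j f u| < e].
  apply: nbhs_forall => j.
  exact: (filterI (df j) (near_continuous_dist (cf j) e0)).
move=> /nbhs_rowP[d d0 dP]; exists d => // y y' yd yd'.
have [xi xib ->] : exists2 xi : 'I_n -> 'rV[R]_n, forall j, inbox y' y (xi j) &
    f y - f y' = \sum_j (y 0 j - y' 0 j) * pderiv j f (xi j).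
  apply: box_MVT => z zb j; apply: (dP z _ j).1; exact: inbox_lt zb _ _.
rewrite -sumrB mulr_sumr (le_trans (ler_norm_sum _ _ _))//; apply: ler_sum => j _.
rewrite -mulrBr normrM mulrC ler_wpM2r// ltW//.
apply: (dP (xi j) _ j).2; exact: inbox_lt (xib j) _ _.
Qed.

Lemma strict_derivative_C1 (T : 'rV[R]_n -> 'rV[R]_n) u :
  (forall i j, \forall z \near nbhs u, derivable (coordf T i) z 'e_j) ->
  (forall i j, {for u, continuous (pderiv j (coordf T i))}) ->
  strict_derivative T u (jac T u)^T.
Proof.
move=> dT cT e e0.
(* The sum of [n] coordinate differences is at most [n r]; dividing by [n.+1] instead of [n] covers
   [n = 0]. *)
have en0 : 0 < e / n.+1%:R by rewrite divr_gt0.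
have /choice[d dP] : forall i, exists d : R, 0 < d /\ forall y (y' : 'rV[R]_n),
    (forall k, `|y 0 k - u 0 k| < d) -> (forall k, `|y' 0 k - u 0 k| < d) ->
    `|coordf T i y - coordf T i y' - \sum_j (y 0 j - y' 0 j) * pderiv j (coordf T i) u| <=
      e / n.+1%:R * \sum_j `|y 0 j - y' 0 j|.
  by move=> i; have [d d0 dP] := strict_C1 en0 (dT i) (cT i); exists d.
pose d0 : R := \big[Num.min/1]_i d i.
have dd0 i : d0 <= d i by exact: bigmin_le_cond.
have d00 : 0 < d0.
  rewrite /d0; apply: (@big_ind R (fun v => 0 < v)) => // [a b a0 b0|i _].
    by rewrite lt_min a0.
  by have [] := dP i.
exists d0 => //.
move=> y y' r yd yd' yr j.
have := (dP j).2 y y' (fun k => lt_le_trans (yd k) (dd0 j)) (fun k => lt_le_trans (yd' k) (dd0 j)).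
have -> : (T y - T y' - (y - y') *m (jac T u)^T) 0 j =
    coordf T j y - coordf T j y' - \sum_k (y 0 k - y' 0 k) * pderiv k (coordf T j) u.
  by rewrite !mxE; congr (_ - _); apply: eq_bigr => k _; rewrite !mxE.
move=> /le_trans; apply.
rewrite -mulrA ler_pM2l// ler_pdivrMl//.
apply: (@le_trans _ _ (\sum_(k < n) r)); first exact: ler_sum.
rewrite sumr_const card_ord -[leLHS]mulr_natl ler_wpM2r ?ler_nat//.
exact: le_trans (yr j).
Qed.

(** For each [h] the increment of [g] is expanded by the mean value theorem on the box spanned by
    the two values of [T]. The intermediate points tend to [T u] by continuity of [T], so the
    coefficients tend to the partial derivatives of [g] at [T u]. *)
Lemma chain_rule g (T : 'rV[R]_n -> 'rV[R]_n) u k :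
  (forall z j, derivable g z 'e_j) -> (forall j, {for T u, continuous (pderiv j g)}) ->
  (forall i, {for u, continuous (coordf T i)}) -> (forall i, derivable (coordf T i) u 'e_k) ->
  is_derive u 'e_k (g \o T) (\sum_i pderiv i g (T u) * pderiv k (coordf T i) u).
Proof.
move=> dg cg cT dT.
have /choice[xi xiP] : forall h : R, exists xi : 'I_n -> 'rV[R]_n,
    (forall j, inbox (T u) (T (h *: 'e_k + u)) (xi j)) /\
    g (T (h *: 'e_k + u)) - g (T u) =
    \sum_j (T (h *: 'e_k + u) 0 j - T u 0 j) * pderiv j g (xi j).
  move=> h.
  by have [xi] := @box_MVT g (T u) (T (h *: 'e_k + u)) (fun z _ => dg z); exists xi.
have cline : (fun h : R => h *: 'e_k + u) @ 0^' --> u.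
  apply: cvg_row => j.
  rewrite (_ : (fun h : R => _) = fun h : R => h * ('e_k : 'rV_n) 0 j + u 0 j); last first.
    by apply/funext => h; rewrite !mxE.
  rewrite -[X in _ --> X]add0r -[X in _ --> X + _](mul0r (('e_k : 'rV_n) 0 j)).
  apply: cvgD; last exact: cvg_cst.
  by apply: cvgM; [exact: nbhs_dnbhs|exact: cvg_cst].
have cxi j : (fun h => xi h j) @ 0^' --> T u.
  apply: cvg_row => i; apply/cvgrPdist_lt => e e0.
  have := cvg_comp _ _ cline (cT i); move=> /cvgrPdist_lt/(_ e e0).
  apply: filterS => h /= hT; have [c /andP[c0 c1] ->] := (xiP h).1 j i.
  rewrite opprD addNKr normrN normrM ger0_norm// (le_lt_trans _ hT)//.
  by rewrite distrC ler_piMl.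
have lim : (fun h : R => \sum_j pderiv j g (xi h j) * (h^-1 *: (coordf T j (h *: 'e_k + u) - coordf T j u)))
    @ 0^' --> \sum_j pderiv j g (T u) * pderiv k (coordf T j) u.
  apply: cvg_sumr => j; apply: cvgM; last exact: dT.
  exact: (cvg_comp _ _ (cxi j) (cg j)).
have E : (fun h : R => h^-1 *: ((g \o T) (h *: 'e_k + u) - (g \o T) u)) =
    (fun h : R => \sum_j pderiv j g (xi h j) * (h^-1 *: (coordf T j (h *: 'e_k + u) - coordf T j u))).
  apply/funext => h /=; rewrite (xiP h).2 scaler_sumr; apply: eq_bigr => j _.
  by rewrite mulrC -scalerAr.
split; first by rewrite /derivable E; apply/cvg_ex; exists (\sum_j pderiv j g (T u) * pderiv k (coordf T j) u).
by rewrite /derive E; exact/cvg_lim.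
Qed.

(** The second difference of [f] over a small square is symmetric in [i] and [j]. Two applications
    of the mean value theorem, in either order, equate a value of one mixed derivative near [x] with
    a value of the other, which is impossible if their limits at [x] differ. *)
Lemma schwarz f x i j :
  (forall z k, derivable f z 'e_k) -> (forall z, derivable (pderiv i f) z 'e_j) ->
  (forall z, derivable (pderiv j f) z 'e_i) ->
  {for x, continuous (pderiv i (pderiv j f))} -> {for x, continuous (pderiv j (pderiv i f))} ->
  pderiv i (pderiv j f) x = pderiv j (pderiv i f) x.
Proof.
move=> df dfi dfj cij cji; apply: contrapT => /eqP neq.
set A := pderiv i (pderiv j f) x in neq; set B := pderiv j (pderiv i f) x in neq.
have e0 : 0 < `|A - B| / 2 by rewrite divr_gt0// normr_gt0 subr_eq0.
have : nbhs x [set z | `|pderiv i (pderiv j f) z - A| < `|A - B| / 2 /\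
                      `|pderiv j (pderiv i f) z - B| < `|A - B| / 2].
  exact: (filterI (near_continuous_dist cij e0) (near_continuous_dist cji e0)).
(* With side [d / 4], no coordinate moves by more than [d / 2], even when [i] and [j] coincide. *)
move=> /nbhs_rowP[d d0 dP]; pose a := d / 4.
have a0 : 0 < a by rewrite divr_gt0.
have dbl i1 j1 : (forall z, derivable (pderiv i1 f) z 'e_j1) -> exists z, (forall k, `|z 0 k - x 0 k| < d) /\
    f (x + a *: 'e_i1 + a *: 'e_j1) - f (x + a *: 'e_i1) - (f (x + a *: 'e_j1) - f x) =
    a * (a * pderiv j1 (pderiv i1 f) z).
  move=> d1; pose F z := f (z + a *: 'e_j1) - f z.
  have dF z : is_derive z 'e_i1 F (pderiv i1 f (z + a *: 'e_j1) - pderiv i1 f z).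
    exact: (is_deriveB (is_derive_shift (df (z + a *: 'e_j1) i1)) (derivableP (df z i1))).
  have drF z : derivable F z 'e_i1 by case: (dF z).
  have dFE z : pderiv i1 F z = pderiv i1 f (z + a *: 'e_j1) - pderiv i1 f z by case: (dF z).
  have [c c01] := @line_MVT F x i1 a (fun c _ => drF _).
  rewrite dFE => E.
  have [c' c'01 E'] := @line_MVT (pderiv i1 f) (x + (c * a) *: 'e_i1) j1 a (fun c _ => d1 _).
  exists (x + (c * a) *: 'e_i1 + (c' * a) *: 'e_j1); split; last by rewrite -E' -/(F _) -/(F _) E.
  move=> k; rewrite !mxE -[X in X - x 0 k]addrA [X in X - x 0 k]addrC addrK.
  have b1 (c1 : R) (b : bool) : 0 <= c1 <= 1 -> 0 <= c1 * a * b%:R <= a.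
    move=> /andP[p q]; have pa : 0 <= c1 * a by rewrite mulr_ge0// ltW.
    have qa : c1 * a <= a by rewrite ler_piMl// ltW.
    by case: b; rewrite ?mulr1 ?mulr0 ?pa ?qa ?lexx ?(ltW a0).
  have /andP[p1 p2] := b1 c (k == i1) c01; have /andP[p3 p4] := b1 c' (k == j1) c'01.
  rewrite !eqxx/= ger0_norm ?addr_ge0// (le_lt_trans (lerD p2 p4))// /a; move: d0; lra.
have [z1 [z1d E1]] := dbl i j dfi; have [z2 [z2d E2]] := dbl j i dfj.
have E : pderiv j (pderiv i f) z1 = pderiv i (pderiv j f) z2.
  have cancel2 (a1 p q : R) : a1 != 0 -> a1 * (a1 * p) = a1 * (a1 * q) -> p = q.
    by move=> a10 /(mulfI a10)/(mulfI a10).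
  apply: (cancel2 a); first exact: lt0r_neq0.
  have sw (p q r s : R) : p - q - (r - s) = p - r - (q - s) by ring.
  have xx : x + a *: 'e_i + a *: 'e_j = x + a *: 'e_j + a *: 'e_i := addrAC _ _ _.
  by rewrite -E1 -E2 xx; exact: sw.
have [_] := dP z1 z1d; have [+ _] := dP z2 z2d; rewrite E => h2 h1.
have far (w A1 B1 : R) : `|w - A1| < `|A1 - B1| / 2 -> `|w - B1| < `|A1 - B1| / 2 -> False.
  move=> hA hB; have := ltrD hA hB; rewrite -splitr distrC ltNge => /negP; apply.
  by have := ler_normD (A1 - w) (w - B1); rewrite subrKA.
exact: far h2 h1.
Qed.

End PartialDerivatives.

(** * Order of differentiation *)

Section PermutePartials.
Context {R : realType} {n : nat}.
Implicit Types f : 'rV[R]_n -> R.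

(** Schwarz's theorem exchanges the two outermost derivatives; [front] repeats this to bring any
    derivative to the outside, and induction on the sequence does the rest. *)
Lemma pderivs_perm k f s s' : class_C k setT f -> perm_eq s s' -> (size s <= k)%N ->
  pderivs s f = pderivs s' f.
Proof.
move=> cf; have swap i j l : ((size l).+1 < k)%N -> pderivs (i :: j :: l) f = pderivs (j :: i :: l) f.
  move=> lk; apply/funext => x /=; apply: schwarz.
  - by move=> z m; apply: (cf l _).2 => //; lia.
  - by move=> z; apply: (cf (i :: l) _).2 => //=; lia.
  - by move=> z; apply: (cf (j :: l) _).2 => //=; lia.
  - by apply: (cf [:: i, j & l] _).1 => //=; lia.
  - by apply: (cf [:: j, i & l] _).1 => //=; lia.
have front i a b : (size (a ++ b) < k)%N -> pderivs (a ++ i :: b) f = pderivs (i :: a ++ b) f.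
  elim: a => [//|j a IH] /= jk; rewrite IH; last by lia.
  by rewrite -[RHS]/(pderivs (i :: j :: a ++ b) f) -swap.
elim: s s' => [|i s IH] s' ss' sk; first by move: ss'; rewrite perm_sym => /perm_nilP ->.
have : i \in s' by rewrite -(perm_mem ss') mem_head.
move=> /splitPr is'; case: is' ss' => a b ss'.
have sab : perm_eq s (a ++ b) by rewrite -(perm_cons i) (perm_trans ss')// perm_catC/= perm_cons perm_catC.
rewrite front -?(perm_size sab)//= (IH (a ++ b))//.
exact: ltnW.
Qed.

End PermutePartials.

Lemma for_continuous_row {R : realType} (T : topologicalType) n (f : T -> 'rV[R]_n) x :
  (forall j, {for x, continuous (fun y => f y 0 j)}) -> {for x, continuous f}.
Proof. by move=> cf; apply: cvg_row => j; exact: cf. Qed.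

Lemma near_eq_continuous {R : realType} (T : topologicalType) (f g : T -> R) x :
  nbhs x [set y | f y = g y] -> {for x, continuous f} -> {for x, continuous g}.
Proof.
move=> fg cf; rewrite /prop_for/continuous_at -(nbhs_singleton fg).
by apply: cvg_trans cf; exact: near_eq_cvg.
Qed.

(** * Boundary growth of the integrand *)

Section Growth.
Context {R : realType} {d : nat}.
Implicit Types (f g q r : 'rV[R]_d -> R) (u x : 'rV[R]_d) (e : 'I_d -> R) (s l : seq 'I_d).
Local Notation "''e_' j" := (delta_mx 0 j : 'rV[R]_d) (at level 8, j at level 2, format "''e_' j").
Local Notation D := (@open_cube R d).

Lemma open_open_cube : open D.
Proof.
rewrite openE => u Du; apply: nbhs_forall => j.
have /andP[h0 h1] := Du j.
have n0 := near_continuous_gt (@continuous_row_coord R d j u) h0.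
have n1 := near_continuous_lt (@continuous_row_coord R d j u) h1.
by apply: filterS (filterI n0 n1) => x /= [-> ->].
Qed.

Lemma mindist_gt0 (x : R) : 0 < x < 1 -> 0 < mindist x.
Proof. by move=> /andP[x0 x1]; rewrite lt_min x0 subr_gt0. Qed.

Lemma mindist_itv (x : R) : 0 < x < 1 -> 0 < mindist x <= 1.
Proof.
by move=> x01; rewrite mindist_gt0// ge_min; case/andP: x01 => _ /ltW ->.
Qed.

Definition weight e u : R := \prod_k mindist (u 0 k) `^ (e k).

Lemma weight_ge0 e u : 0 <= weight e u.
Proof. by apply: prodr_ge0 => k _; exact: powR_ge0. Qed.

Lemma weightD e e' u : D u -> weight (fun k => e k + e' k) u = weight e u * weight e' u.
Proof.
move=> Du; rewrite -big_split; apply: eq_bigr => k _; rewrite powRD//.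
by apply/implyP => _; rewrite gt_eqF// mindist_gt0.
Qed.

Lemma weight_le e e' u : D u -> (forall k, e' k <= e k) -> weight e u <= weight e' u.
Proof.
move=> Du ee; apply: ler_prod => k _; rewrite powR_ge0/=.
by apply: ger_powR => //; exact: mindist_itv.
Qed.

Lemma weight0 u : weight (fun=> 0) u = 1.
Proof. by rewrite /weight big1// => k _; rewrite powRr0. Qed.

Lemma weight_delta m u : D u -> weight (fun k => - (k == m)%:R) u = (mindist (u 0 m))^-1.
Proof.
move=> Du; rewrite /weight (bigD1 m)//= eqxx powR_inv1; last exact/ltW/mindist_gt0.
by rewrite big1 ?mulr1// => k /negbTE ->; rewrite oppr0 powRr0.
Qed.

(* [growth s e q]: along every subsequence [l] of [s], the mixed derivative of
   [q] taken in the order of [l] exists on the open cube, is continuous there and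
   is O(prod_k mindist u_k ^ (e_k - multiplicity of k in l)). *)
Fixpoint growth s e q : Prop :=
  if s is k :: s' then
    [/\ growth s' e q, forall u, D u -> derivable q u 'e_k
      & growth s' (fun j => e j - (j == k)%:R) (pderiv k q)]
  else (forall u, D u -> {for u, continuous q}) /\
    exists C : R, forall u, D u -> `|q u| <= C * weight e u.

Lemma near_cube u : D u -> nbhs u D.
Proof. by move=> Du; apply: open_nbhs_nbhs; split; [exact: open_open_cube|]. Qed.

Lemma growth_ext s e q r : (forall u, D u -> q u = r u) -> growth s e q -> growth s e r.
Proof.
elim: s e q r => [|k s IH] e q r qr /=.
  move=> [cq [C qC]]; split; last by exists C => u Du; rewrite -qr//; exact: qC.
  move=> u Du; have n : nbhs u [set x | q x = r x] by apply: filterS (near_cube Du) => x /qr.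
  exact: near_eq_continuous n (cq u Du).
have n u : D u -> {near u, q =1 r} by move=> Du; apply: filterS (near_cube Du) => x /qr.
move=> [h1 h2 h3]; split; first exact: IH h1.
  by move=> u Du; apply: near_eq_derivable (h2 u Du); exact: n.
by apply: IH h3 => u Du; apply: near_eq_derive; exact: n.
Qed.

Lemma growth_eq_exp s e e' q : e =1 e' -> growth s e q -> growth s e' q.
Proof. by move=> /funext ->. Qed.

(** Exponents may be lowered, because [mindist] is at most 1 on the cube. *)
Lemma growth_le s e e' q : (forall k, e' k <= e k) -> growth s e q -> growth s e' q.
Proof.
elim: s e e' q => [|k s IH] e e' q ee /=.
  move=> [cq [C qC]]; split=> //; exists `|C| => u Du; rewrite (le_trans (qC u Du))//.
  rewrite (le_trans (ler_wpM2r (weight_ge0 _ _) (ler_norm C)))//.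
  by rewrite ler_wpM2l// weight_le.
by move=> [h1 h2 h3]; split=> //; [exact: IH h1|apply: IH h3 => j; rewrite lerD2r].
Qed.

Lemma growth_tail k s e q : growth (k :: s) e q -> growth s e q.
Proof. by case. Qed.

Lemma growth_nil s e q : growth s e q -> growth [::] e q.
Proof. by elim: s => // k s IH /growth_tail. Qed.

Lemma growthD s e q r : growth s e q -> growth s e r -> growth s e (fun u => q u + r u).
Proof.
elim: s e q r => [|k s IH] e q r /=.
  move=> [cq [C qC]] [cr [C' rC]]; split; first by move=> u Du; apply: for_continuousD; [exact: cq|exact: cr].
  exists (C + C') => u Du; rewrite mulrDl (le_trans (ler_normD _ _))//.
  by rewrite lerD// ?qC ?rC.
move=> [q1 q2 q3] [r1 r2 r3]; split; first exact: IH.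
  by move=> u Du; apply: derivableD; [exact: q2|exact: r2].
apply: growth_ext (IH _ _ _ q3 r3) => u Du; rewrite /pderiv.
by rewrite -deriveD//; [exact: q2|exact: r2].
Qed.

(** Leibniz' rule. In each of its terms a single factor is differentiated, so the loss of 1 in the
    exponent occurs once and the exponents simply add. *)
Lemma growthM s e e' q r : growth s e q -> growth s e' r ->
  growth s (fun k => e k + e' k) (fun u => q u * r u).
Proof.
elim: s e e' q r => [|k s IH] e e' q r /=.
  move=> [cq [C qC]] [cr [C' rC]]; split; first by move=> u Du; apply: for_continuousM; [exact: cq|exact: cr].
  exists (C * C') => u Du; rewrite weightD// normrM mulrACA.
  by rewrite ler_pM// ?qC ?rC.
move=> [q1 q2 q3] [r1 r2 r3]; split; first exact: IH.
  by move=> u Du; apply: derivableM; [exact: q2|exact: r2].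
have h1 := IH _ _ _ _ q1 r3; have h2 := IH _ _ _ _ q3 r1.
apply: growth_ext (growthD _ (growth_eq_exp _ h2)); last 2 first.
- by apply: growth_eq_exp h1 => j; rewrite addrA.
- by move=> j; rewrite addrAC.
move=> u Du /=; rewrite /pderiv [RHS]deriveM; [|exact: q2|exact: r2].
by rewrite [X in _ + X = _]mulrC.
Qed.

Lemma growth_cst0 s e : growth s e (fun=> 0).
Proof.
elim: s e => [|k s IH] e /=.
  split; first by move=> u _; exact: for_continuous_cst.
  by exists 0 => u _; rewrite normr0 mul0r.
split=> //.
by apply: growth_ext (IH _) => u _; rewrite /pderiv derive_cst.
Qed.

Lemma growth_cst s (c : R) : growth s (fun=> 0) (fun=> c).
Proof.
elim: s => [|k s IH] /=.
  split; first by move=> u _; exact: for_continuous_cst.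
  by exists `|c| => u _; rewrite weight0 mulr1.
split=> //.
by apply: growth_ext (growth_cst0 _ _) => u _; rewrite /pderiv derive_cst.
Qed.

Lemma growthZ s e (c : R) q : growth s e q -> growth s e (fun u => c * q u).
Proof.
move=> qe; apply: growth_eq_exp (growthM (growth_cst s c) qe) => k.
by rewrite add0r.
Qed.

Lemma growth_sum s e I (t : seq I) (F : I -> 'rV[R]_d -> R) :
  (forall i, growth s e (F i)) -> growth s e (fun u => \sum_(i <- t) F i u).
Proof.
move=> gF; elim: t => [|i t IH].
  by apply: growth_ext (growth_cst0 s e) => u _; rewrite big_nil.
by apply: growth_ext (growthD (gF i) IH) => u _; rewrite big_cons.
Qed.

Lemma growth_prod s I (t : seq I) (F : I -> 'rV[R]_d -> R) (e : I -> 'I_d -> R) :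
  (forall i, growth s (e i) (F i)) ->
  growth s (fun k => \sum_(i <- t) e i k) (fun u => \prod_(i <- t) F i u).
Proof.
move=> gF; elim: t => [|i t IH].
  apply: growth_eq_exp; last apply: growth_ext (growth_cst s 1).
    by move=> k; rewrite big_nil.
  by move=> u _; rewrite big_nil.
apply: growth_eq_exp; last apply: growth_ext (growthM (gF i) IH).
  by move=> k; rewrite big_cons.
by move=> u _; rewrite big_cons.
Qed.

Lemma pderivs_rcons l k q : pderivs (rcons l k) q = pderivs l (pderiv k q).
Proof. by rewrite /pderivs -cats1 foldr_cat. Qed.

(** Introduction rule from explicit bounds. [growth] differentiates first by the head of its list
    and [pderivs] by the last element, hence [rev l]. *)
Lemma growth_subseq s e q :
  (forall l, subseq l s -> (forall u, D u -> {for u, continuous (pderivs (rev l) q)}) /\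
     exists C : R, forall u, D u ->
       `|pderivs (rev l) q u| <= C * weight (fun k => e k - (count_mem k l)%:R) u) ->
  (forall l k u, subseq (rcons l k) s -> D u -> derivable (pderivs (rev l) q) u 'e_k) ->
  growth s e q.
Proof.
elim: s e q => [|k s IH] e q h1 h2 /=.
  have [cq [C qC]] := h1 [::] (sub0seq _); split => //; exists C => u Du.
  have := qC u Du; congr (_ <= C * weight _ u).
  by apply/funext => k; rewrite subr0.
split.
- apply: IH => [l ls|l j u ls].
    by apply: h1; apply: subseq_trans ls (subseq_cons _ _).
  by apply: h2; apply: subseq_trans ls (subseq_cons _ _).
- by move=> u Du; apply: (h2 [::]) => //=; rewrite eqxx sub0seq.
apply: IH => [l ls|l j u ls Du].
  have := h1 (k :: l); rewrite rev_cons pderivs_rcons /= eqxx => /(_ ls)[cl [C lC]].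
  split=> //; exists C => u Du; have := lC u Du; congr (_ <= C * weight _ u).
  by apply/funext => j; rewrite natrD opprD addrA [k == j]eq_sym.
have := h2 (k :: l) j u; rewrite rev_cons pderivs_rcons /= eqxx; exact.
Qed.

(** One application of the chain rule multiplies by a first derivative of [T], whose exponent is
    [- B] apart from the regular loss of 1 in the differentiated coordinate. Each element of [s]
    thus costs an extra [B]. The induction moves derivatives from [s] to [l], so the total order
    stays at most [N]. *)
Lemma growth_comp (T : 'rV[R]_d -> 'rV[R]_d) g N s e (B : R) :
  0 <= B -> class_C N setT g -> (forall i u, D u -> {for u, continuous (coordf T i)}) ->
  (forall i k u, D u -> derivable (coordf T i) u 'e_k) ->
  (forall i k, growth s (fun j => - B - (j == k)%:R) (pderiv k (coordf T i))) ->
  (forall l, (size l <= N)%N -> exists C : R, forall u, D u ->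
     `|pderivs l g (T u)| <= C * weight e u) ->
  forall l, (size l + size s <= N)%N ->
    growth s (fun j => e j - (size s)%:R * B) (pderivs l g \o T).
Proof.
move=> B0 cg cT dT; elim: s => [|k s IH] gT gl l lN.
  rewrite addn0 in lN; split.
    move=> u Du; apply: (@continuous_comp _ _ _ T (pderivs l g)).
      by apply: for_continuous_row => j; exact: cT.
    by apply: (cg l lN).1.
  have [C lC] := gl l lN; exists C => u Du; have := lC u Du; congr (_ <= C * weight _ u).
  by apply/funext => j; rewrite mul0r subr0.
rewrite /= addnS in lN.
have lN' : (size l < N)%N by lia.
have Dl u k' : D u -> is_derive u 'e_k' (pderivs l g \o T)
    (\sum_i pderiv i (pderivs l g) (T u) * pderiv k' (coordf T i) u).
  move=> Du; apply: chain_rule => [z j|j|i|i]; [exact: (cg l (ltnW lN')).2| |exact: cT|exact: dT].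
  by apply: (cg (j :: l) lN').1.
have gT' i k' : growth s (fun j => - B - (j == k')%:R) (pderiv k' (coordf T i)).
  exact: growth_tail (gT i k').
split.
- apply: growth_le (IH gT' gl l _); last by lia.
  by move=> j; rewrite lerD2l lerN2 ler_wpM2r// ler_nat.
- by move=> u Du; case: (Dl u k Du).
apply: (@growth_ext _ _ (fun u => \sum_i pderivs (i :: l) g (T u) * pderiv k (coordf T i) u)).
  by move=> u Du; rewrite /pderiv; case: (Dl u k Du).
apply: growth_sum => i.
apply: growth_eq_exp (growthM (IH gT' gl (i :: l) _) (gT' i k)); last by rewrite /=; lia.
by move=> j /=; rewrite -natr1 mulrDl mul1r !opprD !addrA.
Qed.

End Growth.

(** * The Jacobian determinant of a diffeomorphism *)

Section Diffeomorphism.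
Context {R : realType} {d : nat}.
Implicit Types (u x : 'rV[R]_d) (tau g : 'rV[R]_d -> 'rV[R]_d).
Local Notation "''e_' j" := (delta_mx 0 j : 'rV[R]_d) (at level 8, j at level 2, format "''e_' j").
Local Notation D := (@open_cube R d).

Lemma pderiv_coord i k u : pderiv k (fun x : 'rV[R]_d => x 0 i) u = (i == k)%:R.
Proof.
rewrite /pderiv /derive; apply/cvg_lim => //.
apply: (@cvg_trans _ ((fun=> (i == k)%:R : R) @ 0^')); last exact: cvg_cst.
apply: near_eq_cvg; near=> h.
have h0 : h != 0 by near: h; exact: nbhs_dnbhs_neq.
rewrite /= !mxE eqxx/= addrK; exact/esym/(mulKf h0).
Unshelve. all: end_near. Qed.

Section Inverse.
Variables (k : nat) (tau g : 'rV[R]_d -> 'rV[R]_d).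
Hypotheses (Ctau : class_C_vec k.+1 D tau) (Cg : class_C_vec k.+1 setT g)
  (gK : forall u, D u -> g (tau u) = u).

Lemma class_C1_derivable (U : set 'rV[R]_d) (f : 'rV[R]_d -> R) m j u :
  class_C m.+1 U f -> U u -> derivable f u 'e_j.
Proof. by move=> Cf Uu; apply: (Cf [::] _).2. Qed.

Lemma class_C1_continuous (U : set 'rV[R]_d) (f : 'rV[R]_d -> R) m j u :
  class_C m.+1 U f -> U u -> {for u, continuous (pderiv j f)}.
Proof. by move=> Cf Uu; apply: (Cf [:: j] _).1. Qed.

Lemma class_C_continuous (U : set 'rV[R]_d) (f : 'rV[R]_d -> R) m u :
  class_C m U f -> U u -> {for u, continuous f}.
Proof. by move=> Cf Uu; apply: (Cf [::] _).1. Qed.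

Lemma jac_inverse u : D u -> jac g (tau u) *m jac tau u = 1%:M.
Proof.
move=> Du; apply/matrixP => i j; rewrite !mxE.
transitivity (pderiv j (coordf g i \o tau) u).
  have [_ chainE] := @chain_rule _ _ (coordf g i) tau u j
    (fun z l => class_C1_derivable (Cg i) I) (fun l => class_C1_continuous (Cg i) I)
    (fun l => class_C_continuous (Ctau l) Du) (fun l => class_C1_derivable (Ctau l) Du).
  by rewrite [RHS]chainE; apply: eq_bigr => l _; rewrite !mxE.
rewrite -(pderiv_coord _ _ u); apply: near_eq_derive.
by apply: filterS (near_cube Du) => x Dx; rewrite /coordf/= gK.
Qed.

Lemma jac_det_inverse u : D u -> `|\det (jac g (tau u))| * `|\det (jac tau u)| = 1.
Proof. by move=> Du; rewrite -normrM -det_mulmx jac_inverse// det1 normr1. Qed.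

Lemma jac_det_neq0 u : D u -> \det (jac tau u) != 0.
Proof.
move=> Du; have := jac_det_inverse Du; have [->|//] := eqVneq.
by rewrite normr0 mulr0 => /esym/eqP; rewrite oner_eq0.
Qed.

Lemma continuous_det_jac (h : 'rV[R]_d -> 'rV[R]_d) u :
  (forall i j, {for u, continuous (pderiv j (coordf h i))}) ->
  {for u, continuous (fun x => \det (jac h x))}.
Proof.
move=> ch; apply: for_continuous_sum => s; apply: for_continuousM.
  exact: for_continuous_cst.
apply: for_continuous_prod => i.
rewrite (_ : (fun _ => _) = pderiv (s i) (coordf h i)); first exact: ch.
by apply/funext => x; rewrite mxE.
Qed.

(** The determinant is continuous and has no zero on the convex cube, so the intermediate value
    theorem on segments gives it a constant sign. The absolute value in the integrand is therefore
    multiplication by a constant and does not interfere with differentiation. *)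
Lemma jac_det_sign : exists c : R, forall u, D u ->
  `|\det (jac tau u)| = c * \det (jac tau u).
Proof.
(* The centre of the cube; [w] runs along the segment from it to [u]. *)
pose u0 : 'rV[R]_d := const_mx (2^-1).
have Du0 : D u0 by move=> j; rewrite mxE; apply/andP; split; lra.
exists (Num.sg (\det (jac tau u0))) => u Du.
pose w (t : R) : 'rV[R]_d := u0 + t *: (u - u0).
pose phi t := \det (jac tau (w t)).
have Dw t : t \in `[0, 1] -> D (w t).
  rewrite in_itv/= => /andP[t0 t1] j; rewrite !mxE.
  by have /andP[h0 h1] := Du j; apply/andP; split; nra.
have cphi : {within `[0, 1], continuous phi}.
  apply: continuous_in_subspaceT => t /set_mem/= t01.
  apply: (@continuous_comp _ _ _ w (fun x => \det (jac tau x))); last first.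
    apply: continuous_det_jac => i j; exact: class_C1_continuous (Ctau i) (Dw t t01).
  apply: for_continuous_row => j.
  rewrite (_ : (fun _ => _) = fun y : R => u0 0 j + y * (u - u0) 0 j); last first.
    by apply/funext => y; rewrite !mxE.
  apply: for_continuousD; first exact: for_continuous_cst.
  by apply: for_continuousM; [exact: cvg_id|exact: for_continuous_cst].
have phi0 : phi 0 = \det (jac tau u0) by rewrite /phi /w scale0r addr0.
have phi1 : phi 1 = \det (jac tau u) by rewrite /phi /w scale1r addrC subrK.
have nz t : t \in `[0, 1] -> phi t != 0 by move=> /Dw; exact: jac_det_neq0.
have sgE (a b : R) : 0 < a * b -> `|b| = Num.sg a * b.
  have [n0|n0|->] := ltgtP a 0; last by rewrite mul0r ltxx.
    by rewrite nmulr_rgt0// => n1; rewrite ltr0_norm// ltr0_sg// mulN1r.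
  by rewrite pmulr_rgt0// => n1; rewrite gtr0_norm// gtr0_sg// mul1r.
have minmax (a b : R) : a * b < 0 -> Num.min a b <= 0 <= Num.max a b.
  rewrite ge_min le_max; have [n0|n0|->] := ltgtP a 0; last by rewrite mul0r ltxx.
    by rewrite nmulr_rlt0// => /ltW ->; rewrite orbT.
  by rewrite pmulr_rlt0// => /ltW ->.
rewrite -phi0 -phi1; apply: sgE.
have nz0 : phi 0 * phi 1 != 0 by rewrite mulf_neq0 ?nz ?in_itv/= ?lexx ?ler01.
rewrite lt_neqAle eq_sym nz0/= leNgt; apply/negP => /minmax neg.
have [t t01 pt] := IVT ler01 cphi neg.
by have := nz t t01; rewrite pt eqxx.
Qed.

End Inverse.
End Diffeomorphism.

(** * Exponents of the factors of the integrand *)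

Section IntegrandGrowth.
Context {R : realType} {d : nat}.
Implicit Types (u x : 'rV[R]_d) (tau g : 'rV[R]_d -> 'rV[R]_d).
Local Notation "''e_' j" := (delta_mx 0 j : 'rV[R]_d) (at level 8, j at level 2, format "''e_' j").
Local Notation D := (@open_cube R d).

(** The assumptions on [f] and [p] speak of multi-indices, the chain rule produces sequences;
    sorting a sequence gives the multi-index of its multiplicities. *)
Lemma pderivs_multi N (f : 'rV[R]_d -> R) (l : seq 'I_d) :
  class_C N setT f -> (size l <= N)%N -> exists2 lambda : {ffun 'I_d -> nat},
  (\sum_i lambda i = size l)%N & pderivs l f = pderiv_multi lambda f.
Proof.
move=> Cf lN; pose lambda : {ffun 'I_d -> nat} := [ffun i => count_mem i l].
have perm : perm_eq l (flatten [seq nseq (lambda j) j | j <- enum 'I_d]).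
  rewrite /perm_eq; apply/allP => i _ /=; rewrite count_flatten -map_comp sumnE big_map.
  rewrite big_enum/= (bigD1 i)//= count_nseq/= eqxx mul1n ffunE big1 ?addn0//.
  by move=> j ji; rewrite count_nseq/= (negbTE ji).
exists lambda; last exact: pderivs_perm Cf perm lN.
rewrite (perm_size perm) size_flatten /shape -map_comp sumnE big_map big_enum/=.
by apply: eq_bigr => i _; rewrite size_nseq.
Qed.

Lemma cumulative_mindist_ge0 (F : cumulativeBounded (0 : R) (1 : R)) (x : R) : 0 <= mindist (F x).
Proof.
rewrite le_min; apply/andP; split; rewrite leNgt; apply/negP.
  move=> Fx; have h1 : \forall y \near -oo, F x < F y by exact: (cvgr_gt 0 (cumulativeNy F)).
  have h2 : \forall y \near -oo, y < x by exact: nbhs_ninfty_lt (num_real x).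
  have [y /= [h3 h4]] := filter_ex (filterI h1 h2).
  by have := cumulative_is_nondecreasing F _ _ (ltW h4); rewrite leNgt h3.
rewrite subr_lt0 => Fx; have h1 : \forall y \near +oo, F y < F x by exact: (cvgr_lt 1 (cumulativey F)).
have h2 : \forall y \near +oo, x < y by exact: nbhs_pinfty_gt (num_real x).
have [y /= [h3 h4]] := filter_ex (filterI h1 h2).
by have := cumulative_is_nondecreasing F _ _ (ltW h4); rewrite leNgt h3.
Qed.

(** At [x = 0] the assumption would put +oo below a real number, so [x] is positive and the powers
    are ordinary ones. *)
Lemma negpow_le (x W B : R) : 0 <= x -> (negpow x 1 <= W%:E)%E -> 0 < B ->
  (negpow x B <= (W `^ B)%:E)%E.
Proof.
move=> x0; rewrite /negpow !inver powRr1//; case: ifPn => // xn0 xW B0.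
rewrite powR_eq0 (negbTE xn0)/= lee_fin.
have xi : 0 < x^-1 by rewrite invr_gt0 lt_def xn0.
rewrite -powRN -mulN1r powRrM powR_inv1//.
apply: ge0_ler_powR; rewrite ?nnegrE ?(ltW B0)//; first exact: ltW.
by rewrite ltW// (lt_le_trans xi).
Qed.

Lemma powR_prod I (r : seq I) (F : I -> R) (B : R) : (forall i, 0 <= F i) ->
  (\prod_(i <- r) F i) `^ B = \prod_(i <- r) F i `^ B.
Proof.
move=> F0; elim: r => [|i r IH]; first by rewrite !big_nil powR1.
by rewrite !big_cons powRM// ?IH// prodr_ge0.
Qed.

Lemma weight_cst_pow (a B : R) u : weight (fun=> a) u `^ B = weight (fun=> a * B) u.
Proof.
rewrite /weight powR_prod => [|k]; last exact: powR_ge0.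
by apply: eq_bigr => k _; rewrite powRrM.
Qed.

Lemma growth_bound_f N (f : 'rV[R]_d -> R) tau (F : cumulativeBounded (0 : R) (1 : R)) :
  (0 < d)%N -> class_C N setT f ->
  (forall (l : {ffun 'I_d -> nat}) (B : R), (\sum_i l i <= N)%N -> 0 < B ->
     exists2 C1 : R, 0 < C1 & forall x : 'rV[R]_d,
       (`|pderiv_multi l f x|%:E <=
          C1%:E * \prod_(k < d) negpow (mindist (F (x 0%R k))) B)%E) ->
  (exists B0 C4 : R, [/\ 0 < B0, 0 < C4 &
        forall (k : 'I_d) u, open_cube u ->
          (negpow (mindist (F (tau u 0%R k))) 1 <=
             (C4 * \prod_(l < d) mindist (u 0 l) `^ (- B0))%:E)%E]) ->
  forall (B : R) (l : seq 'I_d), 0 < B -> (size l <= N)%N -> exists C : R, forall u, D u ->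
    `|pderivs l f (tau u)| <= C * weight (fun=> - B) u.
Proof.
move=> d0 Cf bf [B0 [C4 [B00 C40 bF]]] B l B_gt0 lN.
have dR : 0 < d%:R :> R by rewrite ltr0n.
have [lambda ls ->] := pderivs_multi Cf lN.
(* Each of the [d] factors is at most [W] to the power [B'], and [W] has exponent [- B0] in every
   coordinate, so the product has exponent [- B0 * B' * d = - B]. *)
pose B' := B / (B0 * d%:R); have B'0 : 0 < B' by rewrite divr_gt0// mulr_gt0.
have [C1 C10 C1P] := bf lambda B' ltac:(by rewrite ls) B'0.
exists (C1 * (C4 `^ B') ^+ d) => u Du.
rewrite -lee_fin (le_trans (C1P _))// -mulrA EFinM lee_pmul2l//.
pose W := C4 * \prod_(l < d) mindist (u 0 l) `^ (- B0).
apply: (@le_trans _ _ (\prod_(k < d) (W `^ B')%:E)%E).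
  suff /andP[] : (0 <= \prod_(k < d) negpow (mindist (F (tau u 0%R k))) B' <=
      \prod_(k < d) (W `^ B')%:E)%E by [].
  apply: (big_ind2 (fun a b : \bar R => 0 <= a <= b)%E) => [|a b a' b' /andP[a0 ab] /andP[a0' ab']|k _].
  - by rewrite lexx lee01.
  - by rewrite mule_ge0//= lee_pmul.
  apply/andP; split.
    by rewrite /negpow inver; case: ifPn => // _; rewrite lee_fin invr_ge0 powR_ge0.
  by apply: negpow_le => //; [exact: cumulative_mindist_ge0|exact: bF].
rewrite prodEFin lee_fin prodr_const card_ord /W -/(weight (fun=> - B0) u).
rewrite powRM ?weight_ge0 ?(ltW C40)// weight_cst_pow exprMn_comm; last exact: mulrC.
rewrite ler_wpM2l ?exprn_ge0 ?powR_ge0// -powR_mulrn ?weight_ge0// weight_cst_pow.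
rewrite le_eqVlt; apply/orP; left; apply/eqP; congr weight; apply/funext => k.
by rewrite /B'; field; rewrite !gt_eqF.
Qed.

(** The lower bound on [tau] is logarithmic in [mindist], so the exponential decay of the density
    becomes the power [alpha * C5]; the constant [C'] contributes the factor [expR (alpha * C')] per
    coordinate. *)
Lemma growth_bound_p N (p : 'rV[R]_d -> R) tau (alpha C5 C' : R) :
  0 < alpha -> class_C N setT p ->
  (exists2 C2 : R, 0 < C2 & forall l : {ffun 'I_d -> nat}, (\sum_i l i <= N)%N ->
     forall x : 'rV[R]_d, `|pderiv_multi l p x| <=
          C2 * \prod_(k < d) expR (- (alpha * `|x 0 k|))) ->
  (forall (j : 'I_d) u, open_cube u -> C5 * `|ln (mindist (u 0 j))| - C' <= `|tau u 0 j|) ->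
  forall l : seq 'I_d, (size l <= N)%N -> exists C : R, forall u, D u ->
    `|pderivs l p (tau u)| <= C * weight (fun=> alpha * C5) u.
Proof.
move=> alpha0 Cp [C2 C20 bp] btau l lN.
have [lambda ls ->] := pderivs_multi Cp lN.
exists (C2 * expR (alpha * C') ^+ d) => u Du.
rewrite (le_trans (bp lambda _ _)) ?ls// -mulrA ler_pM2l//.
rewrite -[X in _ ^+ X](card_ord d) -prodr_const -big_split/=; apply: ler_prod => k _.
rewrite expR_ge0/=; have m := mindist_itv (Du k); have /andP[m0 m1] := m.
rewrite /powR gt_eqF// -expRD ler_expR.
have := btau k u Du; rewrite ler0_norm ?ln_le0// => h.
have := ler_wpM2l (ltW alpha0) h; lra.
Qed.

(** The list is the reversed enumeration, so the reversal of a subsequence is increasing and equals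
    [enum] of a set. The assumed bound then applies without any exchange of derivatives on the cube,
    and its extra factor for the coordinate [m] is the term [(j == k)] in the exponent. *)
Lemma growth_jac k tau (v_bound : forall (v : {set 'I_d}) (m j : 'I_d) (B : R), 0 < B ->
        exists2 C3 : R, 0 < C3 & forall u, open_cube u ->
          `|pderiv_set v (pderiv m (coordf tau j)) u| <=
            C3 * (mindist (u 0 m))^-1 *
            \prod_(k < d) mindist (u 0 k) `^ (- B - (k \in v)%:R)) :
  class_C_vec d.+1 D tau -> forall (B : R) i, 0 < B ->
  growth (rev (enum 'I_d)) (fun j => - B - (j == k)%:R) (pderiv k (coordf tau i)).
Proof.
move=> Ctau B i B0.
have szE l : subseq l (rev (enum 'I_d)) -> (size l <= d)%N.
  by move/size_subseq; rewrite size_rev size_enum_ord.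
apply: growth_subseq => [l ls|l j u ls Du].
  split.
    move=> u Du; have := (Ctau i (rcons (rev l) k) _).1 u Du; rewrite pderivs_rcons; apply.
    by rewrite size_rcons size_rev ltnS szE.
  have [C3 C30 bC] := v_bound [set j in l] k i B B0; exists C3 => u Du.
  have lu : uniq l by apply: subseq_uniq ls _; rewrite rev_uniq enum_uniq.
  have -> : rev l = enum [set j in l].
    have : subseq (rev l) (enum 'I_d) by rewrite -[enum _]revK subseq_rev.
    move/(subseq_uniqP (enum_uniq _)) => ->.
    have -> : enum [set j in l] = [seq j <- enum 'I_d | j \in [set j in l]] by rewrite enumT.
    by apply: eq_filter => j; rewrite !inE mem_rev.
  rewrite (le_trans (bC u Du))// le_eqVlt; apply/orP; left; apply/eqP.
  rewrite -mulrA -weight_delta// -weightD//; congr (_ * weight _ u).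
  apply/funext => j; rewrite count_uniq_mem// inE; ring.
have := (Ctau i (rcons (rev l) k) _).2; rewrite pderivs_rcons; apply => //.
  by rewrite size_rcons size_rev ltnW// ltnS; apply: leq_trans (szE _ ls); rewrite size_rcons.
by rewrite size_rcons size_rev ltnS; apply: leq_trans (szE _ ls); rewrite size_rcons.
Qed.

(** In each product of the Leibniz expansion a permutation selects every differentiation index
    exactly once, so every coordinate loses 1 just once, while the [d] small losses [B] add up. *)
Lemma growth_det s tau (B : R) :
  (forall i k, growth s (fun j => - B - (j == k)%:R) (pderiv k (coordf tau i))) ->
  growth s (fun=> - (d%:R * B) - 1) (fun u => \det (jac tau u)).
Proof.
move=> gt; apply: growth_sum => sg; apply: growthZ.
apply: (@growth_ext _ _ _ _ (fun u => \prod_i pderiv (sg i) (coordf tau i) u)).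
  by move=> u _; apply: eq_bigr => i _; rewrite mxE.
apply: growth_eq_exp (growth_prod _ (fun i => gt i (sg i))) => j.
rewrite big_split/= sumr_const card_ord; congr (_ + _); first by rewrite mulNrn mulr_natl.
rewrite sumrN (bigD1 ((sg^-1)%g j))//= permKV eqxx big1 ?addr0// => i ij.
by case: eqP => // ji; rewrite ji permK eqxx in ij.
Qed.

End IntegrandGrowth.

Section IntegrandBound.
Context {R : realType} {d : nat}.
Local Notation D := (@open_cube R d).
Implicit Types (e : 'I_d -> R) (q : 'rV[R]_d -> R) (s : seq 'I_d).

Lemma integrand_growth (F : cumulativeBounded (0 : R) (1 : R)) (alpha : R)
  (f p : 'rV[R]_d -> R) (tau : 'rV[R]_d -> 'rV[R]_d) :
  (0 < d)%N -> 0 < alpha -> class_C d setT f -> class_C d setT p -> diffeo_cube d.+1 tau ->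
  (forall (l : {ffun 'I_d -> nat}) (B : R),
     (\sum_i l i <= d)%N -> 0 < B ->
     exists2 C1 : R, 0 < C1 & forall x : 'rV[R]_d,
       (`|pderiv_multi l f x|%:E <=
          C1%:E * \prod_(k < d) negpow (mindist (F (x 0%R k))) B)%E) ->
  (exists2 C2 : R, 0 < C2 &
     forall l : {ffun 'I_d -> nat}, (\sum_i l i <= d)%N ->
     forall x : 'rV[R]_d,
       `|pderiv_multi l p x| <=
          C2 * \prod_(k < d) expR (- (alpha * `|x 0 k|))) ->
  transport_growth F alpha tau ->
  exists2 delta : R, 0 < delta < 1 & growth (rev (enum 'I_d)) (fun=> delta)
    (fun u => f (tau u) * p (tau u) * `|\det (jac tau u)|).
Proof.
move=> d0 alpha0 Cf Cp [Ctau [g [gD gK tauK Cg]]] bf bp [ta tb [C5 [C' [C5a tc]]]].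
have dR : 0 < d%:R :> R by rewrite ltr0n.
have aC5 : 1 < alpha * C5 by rewrite -ltr_pdivrMl// mulr1.
(* The factors contribute [- eta - d B] for [f], [4 eta + 1 - d B] for the density and [- 1 - d B]
   for the determinant. With [3 d B = eta] the total is [2 eta], which leaves room for [delta]. *)
pose eta := (alpha * C5 - 1) / 4.
have eta0 : 0 < eta by rewrite divr_gt0// subr_gt0.
pose B := eta / (3 * d%:R).
have B0 : 0 < B by rewrite divr_gt0// mulr_gt0.
have gtau i k : growth (rev (enum 'I_d)) (fun j => - B - (j == k)%:R) (pderiv k (coordf tau i)).
  exact: growth_jac.
have ctau i u : D u -> {for u, continuous (coordf tau i)}.
  exact: class_C_continuous (Ctau i).
have dtau i k u : D u -> derivable (coordf tau i) u (delta_mx 0 k).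
  exact: class_C1_derivable (Ctau i).
have szd : (size ([::] : seq 'I_d) + size (rev (enum 'I_d)) <= d)%N.
  by rewrite size_rev size_enum_ord.
have gf := @growth_comp _ _ tau f d _ (fun=> - eta) B (ltW B0) Cf ctau dtau gtau
  (fun l ld => growth_bound_f d0 Cf bf tb eta0 ld) [::] szd.
have gp := @growth_comp _ _ tau p d _ (fun=> alpha * C5) B (ltW B0) Cp ctau dtau gtau
  (fun l ld => growth_bound_p alpha0 Cp bp tc ld) [::] szd.
have [c detE] := jac_det_sign Ctau Cg gK.
have gh := growthM (growthM gf gp) (growthZ c (growth_det gtau)).
(* Any exponent below [2 eta] would do; the cap 1/2 ensures [delta < 1]. *)
exists (Num.min eta (2^-1)).
  by rewrite lt_min eta0 invr_gt0 ltr0n/= gt_min; apply/orP; right; lra.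
apply: growth_ext (growth_le _ gh); first by move=> u Du /=; rewrite detE.
move=> k; rewrite size_rev size_enum_ord ge_min; apply/orP; left.
have dB : 3 * d%:R * B = eta by rewrite /B mulrC divfK// mulf_neq0// gt_eqF.
by move: dB; rewrite -mulrA; move: (d%:R * B) => x; rewrite /eta => dB; lra.
Qed.

(** Because of the reversal, a suffix of the enumeration is the part that is differentiated
    first. *)
Lemma growth_pderivs s1 s2 e q : growth (rev (s1 ++ s2)) e q ->
  growth (rev s1) (fun k => e k - (count_mem k s2)%:R) (pderivs s2 q).
Proof.
elim/last_ind: s2 e q => [|s2 k IH] e q.
  by rewrite cats0; apply: growth_eq_exp => k; rewrite subr0.
rewrite -rcons_cat rev_rcons pderivs_rcons => -[_ _ /IH].
apply: growth_eq_exp => j; rewrite -cats1 count_cat/= addn0 natrD opprD [k == j]eq_sym.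
by rewrite addrAC addrA.
Qed.

(** All exponents are lowered to [e k - 1], so that one and the same weight serves for all
    derivatives in the chain. *)
Lemma growth_pderivs_drop e q (j : nat) : growth (rev (enum 'I_d)) e q ->
  (forall u, D u -> {for u, continuous (pderivs (drop j (enum 'I_d)) q)}) /\
  exists C : R, forall u, D u ->
    `|pderivs (drop j (enum 'I_d)) q u| <= C * weight (fun k => e k - 1) u.
Proof.
move=> gq; have gq' := gq; rewrite -(cat_take_drop j (enum 'I_d)) in gq'.
have /growth_nil/= := growth_pderivs gq'.
case=> cj [C Cj]; split=> //; exists `|C| => u Du.
rewrite (le_trans (Cj u Du))// (le_trans (ler_wpM2r (weight_ge0 _ _) (ler_norm C)))//.
rewrite ler_wpM2l// weight_le// => k; rewrite lerD2l lerN2.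
have du : uniq (drop j (enum 'I_d)) by rewrite drop_uniq// enum_uniq.
by rewrite count_uniq_mem//; case: (_ \in _); rewrite ?lexx ?ler01.
Qed.

(** Only the coordinates above [j] have been differentiated here, so the exponent in coordinate [j]
    is still [e j]. This is what makes the function vanish at the face where coordinate [j] is 0. *)
Lemma growth_pderivs_step e q (j : 'I_d) : growth (rev (enum 'I_d)) e q ->
  pderivs (drop j (enum 'I_d)) q = pderiv j (pderivs (drop j.+1 (enum 'I_d)) q) /\
  (forall u, D u -> derivable (pderivs (drop j.+1 (enum 'I_d)) q) u (delta_mx 0 j)) /\
  exists C : R, forall u, D u ->
    `|pderivs (drop j.+1 (enum 'I_d)) q u| <=
    C * weight (fun k => e k - (j < k)%:R) u.
Proof.
move=> gq; have jd : (j < size (enum 'I_d))%N by rewrite size_enum_ord.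
have dj : drop j (enum 'I_d) = j :: drop j.+1 (enum 'I_d).
  by rewrite (drop_nth j jd) nth_ord_enum.
have gq' := gq; rewrite -(cat_take_drop j.+1 (enum 'I_d)) in gq'.
have := growth_pderivs gq'; rewrite (take_nth j jd) nth_ord_enum rev_rcons => gj.
split; first by rewrite dj.
split; first by case: gj.
have /growth_nil/= [_ [C Cj]] := gj; exists C => u Du.
have := Cj u Du; congr (_ <= C * weight _ u); apply/funext => k.
rewrite count_uniq_mem ?drop_uniq ?enum_uniq//; congr (_ - (nat_of_bool _)%:R).
apply/idP/idP.
  move=> /(nthP j)[i]; rewrite size_drop size_enum_ord nth_drop => id <-.
  have jid : (j.+1 + i < d)%N by lia.
  by rewrite -[(j.+1 + i)%N]/(nat_of_ord (Ordinal jid)) nth_ord_enum /=; lia.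
move=> jk; apply/(nthP j); exists (k - j.+1)%N.
  by rewrite size_drop size_enum_ord; have := ltn_ord k; lia.
by rewrite nth_drop subnKC// nth_ord_enum.
Qed.

End IntegrandBound.

(** * Integration of the mixed derivative *)

Section ImproperFTC.
Context {R : realType}.
Local Notation leb := (@lebesgue_measure R).

Lemma FTC_segment (phi g : R -> R) (a b : R) : 0 < a -> a < b -> b < 1 ->
  (forall s : R, 0 < s < 1 -> is_derive s (1 : R) phi (g s)) ->
  (forall s : R, 0 < s < 1 -> {for s, continuous g}) ->
  (\int[leb]_(x in `[a, b]) (g x)%:E = (phi b - phi a)%:E)%E.
Proof.
move=> a0 ab b1 dphi cg.
have in01 s : a <= s <= b -> 0 < s < 1.
  by move=> /andP[? ?]; apply/andP; split; lra.
have cphi s : a <= s <= b -> {for s, continuous phi}.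
  move=> sab; apply: differentiable_continuous; apply/derivable1_diffP.
  by case: (dphi s (in01 s sab)).
rewrite (@continuous_FTC2 _ g phi)//.
- by apply: continuous_in_subspaceT => s /set_mem/=; rewrite in_itv/= => /in01; exact: cg.
- split.
  + move=> s; rewrite in_itv/= => /andP[sa sb].
    by case: (dphi s); rewrite ?in01// !ltW.
  + by apply: cvg_at_right_filter; apply: cphi; rewrite lexx ltW.
  + by apply: cvg_at_left_filter; apply: cphi; rewrite lexx ltW.
- move=> s; rewrite in_itv/= => /andP[sa sb]; rewrite derive1E.
  by case: (dphi s); rewrite ?in01// !ltW.
Qed.

Lemma FTC_from0 (phi g : R -> R) (y : R) : 0 < y < 1 ->
  (forall s : R, 0 < s < 1 -> is_derive s (1 : R) phi (g s)) ->
  (forall s : R, 0 < s < 1 -> {for s, continuous g}) ->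
  leb.-integrable `]0, 1[ (EFin \o g) -> phi x @[x --> 0^'+] --> (0 : R) ->
  (\int[leb]_(x in `]0%R, y[) (g x)%:E = (phi y)%:E)%E.
Proof.
move=> /andP[y0 y1] dphi cg ig phi0.
(* Nothing is known about [g] outside the open unit interval; its extension by 0 is integrable on
   the line. *)
pose g' : R -> R := g \_ `]0, 1[.
have ig'T : leb.-integrable setT (EFin \o g').
  have mI : @measurable _ (measurableTypeR R) `]0, 1[%classic by exact: measurable_itv.
  have ig0 := iffLR (@integrable_mkcond _ (measurableTypeR R) R leb _ (EFin \o g) mI) ig.
  by apply: eq_integrable ig0 => // x _; rewrite /= /g' !patchE; case: ifP.
have ig' (A : set R) : measurable A -> leb.-integrable A (EFin \o g').
  by move=> mA; exact: integrableS ig'T.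
have g'E s : 0 < s < 1 -> g' s = g s.
  by move=> s01; rewrite /g' patchE mem_set//= in_itv.
have key x : 0 < x < y -> \int[leb]_(t in `[0, y]) g' t -
    \int[leb]_(t in `[0, x]) g' t = phi y - phi x.
  move=> /andP[x0 xy]; rewrite Rintegral_itvB; last 3 first.
  - exact: ig'.
  - by rewrite bnd_simp ltW.
  - by rewrite bnd_simp ltW.
  rewrite Rintegral_itv_obnd_cbnd; last exact: ig'.
  rewrite /Rintegral; transitivity (fine (\int[leb]_(t in `[x, y]) (g t)%:E)%E); last first.
    by rewrite (@FTC_segment phi g x y).
  congr fine; apply: eq_integral => t /set_mem/=; rewrite in_itv/= => /andP[xt ty].
  by congr EFin; apply: g'E; apply/andP; split; lra.
pose I := \int[leb]_(t in `[0, y]) g' t.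
have IE : I = phi y.
  have c1 : (fun x => \int[leb]_(t in `[0, x]) g' t + (phi y - phi x)) @ 0^'+ --> 0 + (phi y - 0).
    apply: cvgD; last by apply: cvgB => //; exact: cvg_cst.
    apply: cvg_at_right_filter; apply: (parameterized_integral_cvg_left y0).
    exact: ig'.
  have c2 : (fun x => \int[leb]_(t in `[0, x]) g' t + (phi y - phi x)) @ 0^'+ --> I.
    apply: (@cvg_trans _ ((fun=> I) @ 0^'+)); last exact: cvg_cst.
    apply: near_eq_cvg; near=> x; rewrite -key; first by rewrite addrC subrK.
    by apply/andP; split; near: x; [exact: nbhs_right_gt|exact: nbhs_right_lt].
  by have := cvg_unique _ c1 c2; rewrite add0r subr0 => ->.
rewrite -IE /I /Rintegral fineK; last first.
  by apply: integrable_fin_num => //; exact: ig'.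
have mg' (A : set R) : measurable_fun A (EFin \o g').
  by apply: measurable_funS (measurable_int _ ig'T).
rewrite [RHS]integral_itv_bndoo; last exact: mg'.
apply: eq_integral => t /set_mem/=; rewrite in_itv/= => /andP[t0 ty].
by congr EFin; rewrite g'E// t0 (lt_trans ty).
Unshelve. all: end_near. Qed.

(** Over any compact subinterval the integral is a difference of two values of [Phi], hence at most
    [2 M]; monotone convergence extends this to the open interval. *)
Lemma integral_derivative_bounded (Phi H : R -> R) (M : R) :
  (forall s : R, 0 < s < 1 -> is_derive s (1 : R) Phi (H s)) ->
  (forall s : R, 0 < s < 1 -> {for s, continuous H}) ->
  (forall s : R, 0 < s < 1 -> 0 <= H s) -> (forall s : R, 0 < s < 1 -> `|Phi s| <= M) ->
  measurable_fun setT H -> (\int[leb]_(x in `]0%R, 1%R[) (H x)%:E < +oo)%E.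
Proof.
move=> dPhi cH H0 bPhi mH.
(* Starting at 1/3 keeps [a n < 1 - a n], so no segment is degenerate. *)
pose a n : R := n.+3%:R^-1; pose F n := `[a n, 1 - a n]%classic.
have a0 n : 0 < a n by rewrite invr_gt0.
have a13 n : a n <= 3^-1 by rewrite lef_pV2 ?posrE// ler_nat.
have Fsub n s : F n s -> 0 < s < 1.
  by rewrite /F/= in_itv/= => /andP[h1 h2]; have := a0 n; move=> h; apply/andP; split; lra.
have FE : `]0, 1[%classic = \bigcup_n F n.
  apply/seteqP; split => [s|s [n _ /Fsub s01]]; last by rewrite /= in_itv.
  rewrite /= in_itv/= => /andP[s0 s1].
  pose m := Num.min s (1 - s); have m0 : 0 < m by rewrite lt_min s0 subr_gt0.
  exists (Num.truncn m^-1) => //; rewrite /F/= in_itv/=.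
  have am : a (Num.truncn m^-1) <= m.
    rewrite -[leRHS]invrK lef_pV2 ?posrE ?invr_gt0//.
    by rewrite (le_trans (ltW (truncnS_gt _)))// ler_nat; exact/leqW/leqW.
  have h1 : m <= s by rewrite ge_min lexx.
  have h2 : m <= 1 - s by rewrite ge_min lexx orbT.
  apply/andP; split; lra.
have ndF : {homo F : n m / (n <= m)%N >-> (n <= m)%O}.
  move=> n m nm; apply/subsetPset => s; rewrite /F/= !in_itv/= => /andP[h1 h2].
  have h : a m <= a n by rewrite lef_pV2 ?posrE// ler_nat; lia.
  apply/andP; split; lra.
apply: (@le_lt_trans _ _ (M + M)%:E); last exact: ltry.
have mF n : @measurable _ (measurableTypeR R) (F n) by exact: measurable_itv.
have mHF n : @measurable_fun _ _ (measurableTypeR R) _ (F n) (EFin \o H).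
  by apply/measurable_EFinP; exact: measurable_funTS.
have HF0 n (s : measurableTypeR R) : F n s -> (0 <= (EFin \o H) s)%E.
  by move=> /Fsub; rewrite lee_fin; exact: H0.
have cv := @ge0_nondecreasing_set_cvg_integral _ (measurableTypeR R) R F _ leb ndF mF mHF HF0.
rewrite FE; apply: (cvge_le _ cv); apply: nearW => n; have h1 := a0 n; have h2 := a13 n.
rewrite (@FTC_segment Phi H)//; [|lra|lra].
have b1 : `|Phi (1 - a n)| <= M by apply: bPhi; apply/andP; split; lra.
have b2 : `|Phi (a n)| <= M by apply: bPhi; apply/andP; split; lra.
by rewrite lee_fin (le_trans (ler_norm _))// (le_trans (ler_normB _ _))// lerD.
Qed.

Lemma is_derive_powR (s delta : R) : 0 < s -> delta != 0 ->
  is_derive s (1 : R) (fun x : R => delta^-1 * x `^ delta) (s `^ (delta - 1)).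
Proof.
move=> s0 d0; have s0' : s \in `]0, +oo[ by rewrite in_itv/= s0.
have D : is_derive s (1 : R) (fun x : R => x `^ delta) (delta * s `^ (delta - 1)).
  by apply: DeriveDef; [exact: derivable_powR|rewrite -derive1E powR_derive1].
have := is_deriveZ delta^-1 D; rewrite /GRing.scale/= mulKf//.
Qed.

Lemma continuous_powR (s a : R) : 0 < s -> {for s, continuous (fun x : R => x `^ a)}.
Proof.
move=> s0; apply: differentiable_continuous; apply/derivable1_diffP.
by apply: derivable_powR; rewrite in_itv/= s0.
Qed.

(** The integrand is below the sum of the same powers of [x] and [1 - x], whose primitive is bounded
    because [delta] is positive. *)
Lemma integral_mindist_powR (delta : R) : 0 < delta < 1 ->
  (\int[leb]_(x in `]0%R, 1%R[) (mindist x `^ (delta - 1))%:E < +oo)%E.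
Proof.
move=> /andP[d0 d1].
pose H (s : R) := s `^ (delta - 1) + (1 - s) `^ (delta - 1).
have m1 : measurable_fun setT (fun s : R => 1 - s) by exact: measurable_funB.
have mpow : measurable_fun setT (fun x : R => x `^ (delta - 1)) by exact: measurable_powR.
have mH : measurable_fun setT H.
  apply: measurable_funD => //.
  exact: (measurableT_comp mpow m1).
apply: (@le_lt_trans _ _ (\int[leb]_(x in `]0%R, 1%R[) (H x)%:E)%E).
  apply: ge0_le_integral => //.
  - by move=> x _; rewrite lee_fin powR_ge0.
  - apply/measurable_EFinP; apply: measurable_funTS; apply: (measurableT_comp mpow).
    exact: measurable_minr.
  - by apply/measurable_EFinP; exact: measurable_funTS.
  move=> x _; rewrite lee_fin /mindist /H minEle; case: ifP => _.
    by rewrite lerDl powR_ge0.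
  by rewrite lerDr powR_ge0.
pose Phi (s : R) := delta^-1 * s `^ delta - delta^-1 * (1 - s) `^ delta.
apply: (@integral_derivative_bounded Phi H (delta^-1 + delta^-1)) => //.
- move=> s /andP[s0 s1].
  have D1 := is_derive_powR s0 (lt0r_neq0 d0).
  have s1' : 0 < 1 - s by rewrite subr_gt0.
  have D2 : is_derive s (1 : R) (fun x : R => 1 - x) (-1).
    have := is_deriveB (is_derive_cst (1 : R) s (1 : R)) (is_derive_id s (1 : R)).
    by rewrite sub0r.
  have D3 := @is_derive1_comp _ (fun x : R => delta^-1 * x `^ delta) (fun x => 1 - x) s _ _
     (is_derive_powR s1' (lt0r_neq0 d0)) D2.
  have := is_deriveB D1 D3; rewrite /H mulrN1 opprK; exact.
- move=> s /andP[s0 s1]; apply: for_continuousD; first exact: continuous_powR.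
  apply: (@continuous_comp _ _ _ (fun x : R => 1 - x) (fun x => x `^ (delta - 1))).
    by apply: for_continuousD; [exact: for_continuous_cst|apply: cvgN; exact: cvg_id].
  by apply: continuous_powR; rewrite subr_gt0.
- by move=> s _; rewrite addr_ge0// powR_ge0.
- have b (s : R) : 0 <= s <= 1 -> `|delta^-1 * s `^ delta| <= delta^-1.
    have di : 0 <= delta^-1 by rewrite invr_ge0 ltW.
    move=> /andP[s0 s1]; rewrite ger0_norm ?mulr_ge0 ?powR_ge0// ler_piMr//.
    have := @ge0_ler_powR _ delta (ltW d0) s 1.
    by rewrite !nnegrE powR1; exact.
  move=> s /andP[s0 s1]; rewrite (le_trans (ler_normB _ _))// lerD// b//.
    by rewrite !ltW.
  by apply/andP; split; lra.
Qed.

End ImproperFTC.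

(** * The fundamental theorem in several variables *)

Section MixedFTC.
Context {R : realType}.
Local Notation leb := (@lebesgue_measure R).
Local Notation lam := (lebesgue_tuple R).
Variable w : R -> R.
Hypotheses (mw : measurable_fun setT w) (w0 : forall x, 0 <= w x)
  (wfin : (\int[leb]_(x in `]0%R, 1%R[) (w x)%:E < +oo)%E).

Lemma measurable_cube n : measurable (@row_of_tuple R n @^-1` (@open_cube R n)).
Proof. apply: open_measurable_row; exact: open_open_cube. Qed.

(** The dominating function is a product over the coordinates, so its integral is a power of a
    finite one-dimensional integral. *)
Lemma integrable_cube n (G : 'rV[R]_n -> R) (C : R) :
  (forall u, open_cube u -> {for u, continuous G}) ->
  (forall u, open_cube u -> `|G u| <= C * \prod_k w (u 0 k)) ->
  (lam n).-integrable (@row_of_tuple R n @^-1` (@open_cube R n)) (EFin \o (G \o row_of_tuple)).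
Proof.
move=> cG bG; have mD := @measurable_cube n.
have mG := open_continuous_measurable open_open_cube cG.
apply/integrableP; split; first exact/measurable_EFinP.
pose v : R -> R := w \_ `]0, 1[%classic.
have mv : measurable_fun setT v by apply/(measurable_restrictT w (measurable_itv `]0, 1[)); exact: measurable_funTS.
have v0 x : 0 <= v x by rewrite /v patchE; case: ifP.
have mI : @measurable _ (measurableTypeR R) `]0, 1[%classic by exact: measurable_itv.
have vint : (\int[leb]_x (v x)%:E = \int[leb]_(x in `]0%R, 1%R[) (w x)%:E)%E.
  by rewrite [RHS]integral_mkcond; apply: eq_integral => x _; rewrite /v !patchE; case: ifP.
have mprod : measurable_fun setT (fun t : n.-tuple R => \prod_k v (row_of_tuple t 0 k)).
  apply: measurable_prod => k _; apply: measurableT_comp => //.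
  exact: measurable_row_coord.
apply: (@le_lt_trans _ _ (\int[lam n]_t (`|C|%:E * (\prod_k v (row_of_tuple t 0 k))%:E))%E).
  rewrite integral_mkcond; apply: ge0_le_integral => //.
  - by move=> t _; rewrite patchE; case: ifP.
  - apply/(measurable_restrictT _ mD)/measurable_EFinP.
    by apply: measurableT_comp.
  - exact/measurable_EFinP/measurable_funM.
  move=> t _; rewrite patchE; case: ifPn => [/set_mem Dt|_]; last first.
    by rewrite -EFinM lee_fin mulr_ge0// prodr_ge0.
  rewrite /= -EFinM lee_fin (le_trans (bG _ Dt))//.
  have -> : \prod_k v (row_of_tuple t 0 k) = \prod_k w (row_of_tuple t 0 k).
    by apply: eq_bigr => k _; rewrite /v patchE mem_set//= in_itv; exact: Dt.
  by rewrite ler_wpM2r ?prodr_ge0// ler_norm.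
rewrite ge0_integralZl_EFin//; last 2 first.
- by move=> t _; rewrite lee_fin prodr_ge0.
- exact/measurable_EFinP.
rewrite (@ge0_integral_prod _ _ (fun=> v))// vint.
rewrite -[X in (_ * X)%E]fineK; first exact: ltry.
by apply: (big_ind (fun x : \bar R => x \is a fin_num)) => // [x y|k _]; [exact: fin_numM|rewrite ge0_fin_numE// integral_ge0// => x _; rewrite lee_fin].
Qed.

Definition set_coord n (u : 'rV[R]_n) (j : 'I_n) (s : R) : 'rV[R]_n :=
  \row_k (if k == j then s else u 0 k).

Definition lower_box n (y : 'rV[R]_n) : set 'rV[R]_n := [set v | forall k, 0 < v 0 k < y 0 k].

(* [G j.+1] is the primitive of [G j] in the coordinate [j] that vanishes at 0. *)
Definition ftc_chain n (G : nat -> 'rV[R]_n -> R) :=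
  [/\ forall j u, (j <= n)%N -> open_cube u -> {for u, continuous (G j)},
      forall j, (j <= n)%N -> exists C : R, forall u, open_cube u ->
        `|G j u| <= C * \prod_k w (u 0 k)
    & forall (j : 'I_n) u, open_cube u ->
        (\int[leb]_(s in `]0%R, (u 0%R j)[) (G j (set_coord u j s))%:E = (G j.+1 u)%:E)%E].

Lemma measurable_lower_box n (y : 'rV[R]_n) : measurable (@row_of_tuple R n @^-1` lower_box y).
Proof.
apply: open_measurable_row; rewrite openE => u uy; apply: nbhs_forall => j.
have /andP[h0 h1] := uy j.
have n0 := near_continuous_gt (@continuous_row_coord R n j u) h0.
have n1 := near_continuous_lt (@continuous_row_coord R n j u) h1.
by apply: filterS (filterI n0 n1) => x /= [-> ->].
Qed.

Lemma lower_box_cube n (y : 'rV[R]_n) : open_cube y -> lower_box y `<=` @open_cube R n.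
Proof.
move=> Dy v vy j; have /andP[-> h] := vy j.
by have /andP[_ h'] := Dy j; exact: lt_trans h'.
Qed.

(** Induction on the dimension. Fubini, justified by the product bound, puts the integral over
    coordinate 0 inside; the chain evaluates it and replaces [G 0] by [G 1] at the upper end
    point. *)
Lemma mixed_FTC n (G : nat -> 'rV[R]_n -> R) (y : 'rV[R]_n) : ftc_chain G -> open_cube y ->
  (\int[lam n]_(t in @row_of_tuple R n @^-1` lower_box y) (G 0 (row_of_tuple t))%:E = (G n y)%:E)%E.
Proof.
elim: n G y => [|n IH] G y [cG bG fG] Dy.
  transitivity (\int[lam 0]_(t in [set: 0.-tuple R]) cst (G 0 y)%:E t)%E.
    rewrite (_ : _ @^-1` _ = setT); last by apply/seteqP; split => // t _ [].
    by apply: eq_integral => t _; rewrite /cst; congr (G 0%N _)%:E; apply/rowP => -[].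
  by rewrite integral_cst//= diracT mule1.
have [C bC] := bG 0%N isT.
have ig := integrable_cube (fun u => cG 0%N u isT) bC.
set B := _ @^-1` lower_box y; have mB : measurable B by exact: measurable_lower_box.
have igB : (lam n.+1).-integrable B (EFin \o (G 0%N \o row_of_tuple)).
  by apply: integrableS ig => //; [exact: measurable_cube|move=> t; exact: lower_box_cube].
rewrite integral_mkcond integrable_lebesgue_cons; last exact/(integrable_mkcond _ mB).
pose y0 := y 0 0; pose y' : 'rV[R]_n := rsubmx (y : 'rV_(1 + n)).
have y'E k : y' 0 k = y 0 (lift ord0 k).
  by rewrite mxE; congr (y _ _); exact: val_inj.
have Dy' : open_cube y' by move=> k; rewrite y'E.
have mx0 (x : R) (v : 'rV[R]_n) : (row_mx x%:M v : 'rV_(1 + n)) 0 (0 : 'I_n.+1) = x.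
  rewrite -[RHS](_ : (row_mx x%:M v : 'rV_(1 + n)) 0 (lshift n ord0) = x).
    by congr (row_mx _ _ _ _); exact: val_inj.
  by rewrite row_mxEl mxE eqxx mulr1n.
have mxS (x : R) (v : 'rV[R]_n) k : (row_mx x%:M v : 'rV_(1 + n)) 0 (lift ord0 k : 'I_n.+1) = v 0 k.
  by rewrite -[RHS](row_mxEr x%:M); congr (row_mx _ _ _ _); exact: val_inj.
(* The remaining links of the chain, with coordinate 0 frozen at the upper end point [y0]; the
   constant [w y0] is absorbed into the bound. *)
pose G' j (v : 'rV[R]_n) := G j.+1 (row_mx y0%:M v).
have Drow v : open_cube v -> open_cube (row_mx y0%:M v : 'rV_n.+1).
  move=> Dv k; case: (unliftP (0 : 'I_n.+1) k) => [k'|] ->; first by rewrite mxS.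
  by rewrite mx0; exact: Dy.
have chain' : ftc_chain G'.
  split.
  - move=> j u jn Du; apply: (@continuous_comp _ _ _ (fun v : 'rV[R]_n => row_mx y0%:M v : 'rV_n.+1) (G j.+1)).
      apply: for_continuous_row => k; case: (unliftP (0 : 'I_n.+1) k) => [k'|] ->.
        rewrite (_ : (fun _ => _) = fun v : 'rV[R]_n => v 0 k'); first exact: continuous_row_coord.
        by apply/funext => v; exact: mxS.
      rewrite (_ : (fun _ => _) = fun=> y0); first exact: for_continuous_cst.
      by apply/funext => v; exact: mx0.
    by apply: cG => //; exact: Drow.
  - move=> j jn; have [C' bC'] := bG j.+1 jn; exists (C' * w y0) => u Du.
    rewrite (le_trans (bC' _ (Drow _ Du)))// big_ord_recl mx0 mulrA.
    by rewrite (eq_bigr _ (fun k _ => congr1 w (mxS y0 u k))).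
  - move=> j u Du; have := fG (lift ord0 j) _ (Drow u Du); rewrite mxS lift0 => <-.
    apply: eq_integral => s _; congr (G _ _)%:E; apply/rowP => k.
    rewrite [RHS]mxE; case: (unliftP (0 : 'I_n.+1) k) => [k'|] ->; last by rewrite !mx0.
    by rewrite !mxS mxE (inj_eq lift_inj).
rewrite -(_ : G' n y' = G n.+1 y); last first.
  congr (G _ _); apply/rowP => k; case: (unliftP (0 : 'I_n.+1) k) => [k'|] ->; last by rewrite mx0.
  by rewrite mxS y'E.
rewrite -(IH G')// [RHS]integral_mkcond; apply: eq_integral => t _.
rewrite [RHS]patchE; case: ifPn => [/set_mem /= ty|nty].
  have Dt : open_cube (row_of_tuple t) by exact: lower_box_cube ty.
  rewrite /G' -(fG ord0 _ (Drow _ Dt)) [RHS]integral_mkcond; apply: eq_integral => x _.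
  have BE : (cons_pair (x, t) \in B) = (x \in `]0, (row_mx y0%:M (row_of_tuple t) : 'rV_n.+1) 0 ord0[%classic).
    apply/idP/idP => /set_mem.
      move=> /(_ 0); rewrite row_of_tuple_cons mx0 => h; apply/mem_set.
      by rewrite /= in_itv/= mx0.
    rewrite /= in_itv/= mx0 => h; apply/mem_set => k; rewrite row_of_tuple_cons.
    case: (unliftP (0 : 'I_n.+1) k) => [k'|] ->; last by rewrite mx0.
    by rewrite mxS -y'E; exact: ty.
  rewrite !patchE BE; case: ifP => // _; congr (G _ _)%:E; rewrite row_of_tuple_cons.
  apply/rowP => k; rewrite [RHS]mxE; case: (unliftP (0 : 'I_n.+1) k) => [k'|] ->.
    by rewrite !mxS.
  by rewrite !mx0.
rewrite (eq_integral (cst 0%E)) ?integral0// => x _; rewrite patchE memNset// => h.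
move/negP : nty; apply; apply/mem_set => k; rewrite /= y'E.
by have := h (lift ord0 k); rewrite row_of_tuple_cons mxS.
Qed.

End MixedFTC.

(** * Discrepancy of nets *)

Section CellNumbers.
Context {R : realType}.
Variable b : nat.
Hypothesis b1 : (1 < b)%N.
Implicit Types (x v : R) (k a : nat).

Let b0 : 0 < (b%:R : R). Proof. by rewrite ltr0n ltnW. Qed.
Let bX k : 0 < (b%:R ^+ k : R). Proof. exact: exprn_gt0. Qed.
(** For [x] in [[0, 1)] this is the number formed by the first [k] base-[b] digits, the index of the
    [b]-adic cell of level [k] that contains [x]. *)
Definition cellno k x : nat := Num.truncn (b%:R ^+ k * x).

Lemma cellnoP k x a : 0 <= x ->
  (cellno k x == a) = (a%:R / b%:R ^+ k <= x < a.+1%:R / b%:R ^+ k).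
Proof.
move=> x0; rewrite truncn_eq ?mulr_ge0 ?(ltW (bX k))//.
by rewrite ler_pdivrMr// ltr_pdivlMr// [x * _]mulrC.
Qed.

Lemma cellno_itv k x : 0 <= x -> (cellno k x)%:R / b%:R ^+ k <= x < (cellno k x).+1%:R / b%:R ^+ k.
Proof. by move=> x0; rewrite -cellnoP. Qed.

Lemma cellnoS k x : 0 <= x -> (cellno k.+1 x %/ b)%N = cellno k x.
Proof.
move=> x0; apply/esym/eqP; rewrite cellnoP//.
have /andP[h1 h2] := cellno_itv k.+1 x0.
have bn : (0 < b)%N by rewrite ltnW.
rewrite exprS invfM !mulrA in h1 h2.
apply/andP; split.
  apply: le_trans h1; rewrite ler_pM2r ?invr_gt0// ler_pdivlMr// -natrM ler_nat.
  exact: leq_divM.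
apply: lt_le_trans h2 _; rewrite ler_pM2r ?invr_gt0// ler_pdivrMr// -natrM ler_nat.
by rewrite -ltn_divLR.
Qed.

Lemma cellno0 x : 0 <= x < 1 -> cellno 0 x = 0%N.
Proof.
by move=> /andP[x0 x1]; apply/eqP; rewrite cellnoP// expr0 mul0r divr1 x0.
Qed.

Lemma cellno_lt k x : 0 <= x < 1 -> (cellno k x < b ^ k)%N.
Proof.
move=> /andP[x0 x1]; rewrite -(ltr_nat R) natrX.
have /andP[h _] := cellno_itv k x0.
by rewrite -[ltRHS]mul1r -ltr_pdivrMr// (le_lt_trans h).
Qed.

Lemma cellno_le k x v : x <= v -> (cellno k x <= cellno k v)%N.
Proof. by move=> xv; apply: le_truncn; rewrite ler_wpM2l// ltW. Qed.

(** A cell of level [k + 1] above that of [v] either lies in a cell of level [k] above that of [v],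
    or is a sibling with a larger last digit [r]. *)
Lemma upper_cells_step k x v : 0 <= x -> 0 <= v ->
  ((cellno k.+1 v < cellno k.+1 x)%N : nat)%:R = ((cellno k v < cellno k x)%N : nat)%:R +
  \sum_(r < b) ((cellno k.+1 v < b * cellno k v + r)%N : nat)%:R *
     ((cellno k.+1 x == b * cellno k v + r)%N : nat)%:R :> R.
Proof.
move=> x0 v0; have bn : (0 < b)%N by rewrite ltnW.
have := cellnoS k x0; have := cellnoS k v0.
move: (cellno k.+1 x) (cellno k.+1 v) (cellno k x) (cellno k v) => X V x' v' VE XE.
have [xv|xv] := eqVneq x' v'.
  have rX : (X %% b < b)%N by rewrite ltn_mod.
  rewrite xv ltnn add0r (bigD1 (Ordinal rX))//= big1 ?addr0 => [|r rne].
    have XE' : X = (b * v' + X %% b)%N by rewrite {1}(divn_eq X b) XE xv mulnC.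
    by rewrite -XE' eqxx mulr1.
  case: (X =P _) => [XE'|]; last by rewrite mulr0.
  have : r = Ordinal rX by apply: val_inj; rewrite /= XE' mulnC modnMDl modn_small.
  by move=> re; rewrite re eqxx in rne.
rewrite big1 ?addr0 => [|r _]; last first.
  case: (X =P _) => [XE'|]; last by rewrite mulr0.
  move: xv; rewrite -XE XE' mulnC divnMDl// divn_small ?addn0//.
  by rewrite eqxx.
congr (nat_of_bool _)%:R; rewrite -VE -XE in xv *.
apply/idP/idP => h.
  by rewrite ltn_neqAle eq_sym xv leq_div2r// ltnW.
by rewrite ltnNge; apply/negP => XV; move: h; rewrite ltnNge leq_div2r.
Qed.

(** The same decomposition for lengths: [1 - (cellno k v).+1 / b^k] is the total length of the cells
    of level [k] above that of [v]. *)
Lemma upper_cells_volume k v : 0 <= v ->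
  (1 - (cellno k.+1 v).+1%:R / b%:R ^+ k.+1) = (1 - (cellno k v).+1%:R / b%:R ^+ k) +
  \sum_(r < b) ((cellno k.+1 v < b * cellno k v + r)%N : nat)%:R * (b%:R ^+ k.+1)^-1 :> R.
Proof.
move=> v0; rewrite -mulr_suml.
have bn : (0 < b)%N by rewrite ltnW.
set V := cellno k.+1 v; set v' := cellno k v.
have VE : V = (b * v' + V %% b)%N by rewrite {1}(divn_eq V b) cellnoS// mulnC.
have rV : (V %% b < b)%N by rewrite ltn_mod.
have -> : \sum_(r < b) ((V < b * v' + r)%N : nat)%:R = (b - (V %% b).+1)%:R :> R.
  rewrite -natr_sum; congr (_%:R).
  rewrite (eq_bigr (fun r : 'I_b => ((V %% b < r)%N : nat))); last first.
    by move=> r _; rewrite [in LHS]VE ltn_add2l.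
  elim: (b) (V %% b)%N => [|n IH] q; first by rewrite big_ord0.
  by rewrite big_ord_recr /= IH; lia.
rewrite natrB// exprS {1}VE -addnS natrD natrM.
move: (b%:R ^+ k) (bX k) => B B0; field.
by rewrite !gt_eqF.
Qed.

(* [v, 1[ is cut into at most [b] cells of each level [k <= m], up to a part of a
   single cell of level [m]. *)
Lemma threshold_discrepancy (I : finType) (y rho : I -> R) (rv c v : R) m :
  (forall i, 0 <= y i < 1) -> (forall i, 0 <= rho i <= 1) -> 0 <= rv <= 1 ->
  (forall k a, (a < b ^ k)%N ->
    `|\sum_i (cellno k (y i) == a)%:R * rho i - b%:R ^+ m * (b%:R ^- k * rv)| <= c) ->
  (forall a, (a < b ^ m)%N -> \sum_i (cellno m (y i) == a)%:R <= c) ->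
  1 <= c -> 0 <= v < 1 ->
  `|\sum_i (v < y i)%R%:R * rho i - b%:R ^+ m * ((1 - v) * rv)| <= (m * b).+1%:R * c.
Proof.
move=> y01 rho01 /andP[rv0 rv1] Hc Hm c1 v01.
have v0 : 0 <= v by case/andP: v01.
have c0 : 0 <= c by rewrite (le_trans _ c1).
have y0 i : 0 <= y i by case/andP: (y01 i).
have bn : (0 < b)%N by rewrite ltnW.
pose U k i : R := (cellno k v < cellno k (y i))%N%:R.
pose V k : R := 1 - (cellno k v).+1%:R / b%:R ^+ k.
(* [U k] and [V k] keep only whole cells of level [k]. Refining the level adds at most [b] sibling
   cells, each with error at most [c]. *)
have HU k : `|\sum_i U k i * rho i - b%:R ^+ m * (V k * rv)| <= (k * b)%:R * c.
  elim: k => [|k IH].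
    rewrite mul0n mul0r /V cellno0// expr0 divr1 subrr mul0r mulr0 subr0.
    rewrite big1 ?normr0// => i _.
    by rewrite /U !cellno0// ltnn mul0r.
  have -> : \sum_i U k.+1 i * rho i - b%:R ^+ m * (V k.+1 * rv) =
     (\sum_i U k i * rho i - b%:R ^+ m * (V k * rv)) +
     \sum_(r < b) ((cellno k.+1 v < b * cellno k v + r)%N : nat)%:R *
       (\sum_i (cellno k.+1 (y i) == (b * cellno k v + r)%N)%:R * rho i
         - b%:R ^+ m * (b%:R ^- k.+1 * rv)).
    rewrite /V upper_cells_volume//.
    under eq_bigr => i _ do rewrite /U upper_cells_step// mulrDl mulr_suml.
    rewrite big_split/= exchange_big/=.
    under [X in _ = _ + X]eq_bigr => r _ do rewrite mulrBr mulr_sumr.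
    rewrite sumrB.
    under [X in _ + X - _ = _]eq_bigr => r _ do under eq_bigr => i _ do rewrite -mulrA.
    rewrite [X in _ - b%:R ^+ m * X]mulrDl mulrDr mulr_suml mulr_sumr.
    under [X in _ - (_ + X)]eq_bigr => r _ do rewrite mulrCA -!mulrA.
    under [X in _ = _ + (_ - X)]eq_bigr => r _ do rewrite mulrCA.
    rewrite opprD addrACA; congr (_ + (_ - _)); apply: eq_bigr => r _.
    by rewrite [RHS]mulrCA; congr (_ * _); rewrite mulrCA.
  apply: le_trans (ler_normD _ _) _.
  rewrite mulSn natrD [leRHS]mulrDl [leRHS]addrC lerD//.
  apply: le_trans (ler_norm_sum _ _ _) _.
  have -> : b%:R * c = \sum_(r < b) c by rewrite sumr_const card_ord mulr_natl.
  apply: ler_sum => r _.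
  rewrite normrM normr_nat; case: ltnP => _; last by rewrite mul0r.
  rewrite mul1r; apply: Hc; rewrite expnS.
  apply: (@leq_trans (b * (cellno k v).+1)); last by rewrite leq_mul2l cellno_lt ?orbT.
  by rewrite mulnS addnC ltn_add2r.
(* The part missed by whole cells: points above [v] within its own cell of level [m]. Their weighted
   number lies in [[0, c]] and the scaled volume in [[0, 1]], so the difference is at most [c]
   because [1 <= c]. *)
pose D i : R := (v < y i)%R%:R - U m i.
have D0 i : 0 <= D i <= (cellno m (y i) == cellno m v)%:R.
  rewrite /D /U; have [vy|yv] := ltP v (y i).
    have := cellno_le m (ltW vy); rewrite leq_eqVlt => /orP[/eqP ->|h].
      by rewrite ltnn eqxx subr0 ler01 lexx.
    by rewrite h subrr lexx ler0n.
  by rewrite ltnNge cellno_le// subrr lexx ler0n.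
have /andP[V1 V2] := cellno_itv m v0.
have -> : \sum_i (v < y i)%R%:R * rho i - b%:R ^+ m * ((1 - v) * rv) =
   (\sum_i U m i * rho i - b%:R ^+ m * (V m * rv)) +
   (\sum_i D i * rho i - b%:R ^+ m * (1 - v - V m) * rv).
  under [X in _ = _ + (X - _)]eq_bigr => i _ do rewrite /D mulrBl.
  rewrite sumrB; move: (\sum_i _) (\sum_i _) => A B; ring.
have -> : (m * b).+1%:R * c = (m * b)%:R * c + c by rewrite -natr1 mulrDl mul1r.
apply: le_trans (ler_normD _ _) _; apply: lerD; first exact: HU.
have h1 : 0 <= \sum_i D i * rho i <= c.
  apply/andP; split.
    by apply: sumr_ge0 => i _; case/andP: (D0 i) (rho01 i) => ? _ /andP[? _]; exact: mulr_ge0.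
  apply: le_trans (Hm _ (cellno_lt m v01)); apply: ler_sum => i _.
  case/andP: (D0 i) (rho01 i) => ? ? /andP[? ?].
  by apply: le_trans (_ : D i <= _) => //; rewrite ler_piMr.
have h2 : 0 <= b%:R ^+ m * (1 - v - V m) * rv <= 1.
  have e : b%:R ^+ m * (1 - v - V m) = (cellno m v).+1%:R - b%:R ^+ m * v.
    by rewrite /V; field; rewrite gt_eqF.
  have h : 0 <= b%:R ^+ m * (1 - v - V m) <= 1.
    rewrite e; move: V1 V2; rewrite ler_pdivrMr// ltr_pdivlMr// -natr1.
    by rewrite mulrC; move: (b%:R ^+ m * v) => z ? ?; lra.
  by case/andP: h => h h'; rewrite mulr_ge0// mulr_ile1.
move: h1 h2; move: (\sum_i _) (_ * rv) => A B; rewrite ler_norml => /andP[? ?] /andP[? ?].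
by apply/andP; split; lra.
Qed.

End CellNumbers.

Lemma elementary_intervalE {R : realType} {d b : nat} (k a : {ffun 'I_d -> nat})
    (x : 'rV[R]_d) : (1 < b)%N -> (forall j, 0 <= x 0 j) ->
  elementary_interval b k a x = [forall j, cellno b (k j) (x 0 j) == a j].
Proof. by move=> b1 x0; apply: eq_forallb => j; rewrite cellnoP. Qed.

(** * Counting points of a net *)

Section NetDiscrepancy.
Context {R : realType} {d b t m : nat}.
Variable x : 'I_(b ^ m) -> 'rV[R]_d.
Hypotheses (d0 : (0 < d)%N) (b1 : (1 < b)%N) (net : tmd_net t x).

Implicit Types k a : {ffun 'I_d -> nat}.

Let tm : (t <= m)%N. Proof. by case: net. Qed.
Let x01 i j : 0 <= x i 0 j < 1. Proof. by case: net. Qed.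
Let x0 i j : 0 <= x i 0 j. Proof. by case/andP: (x01 i j). Qed.

Let in_cell (k a : {ffun 'I_d -> nat}) i :=
  [forall j, cellno b (k j) (x i 0 j) == a j].

Let count k a := (\sum_i in_cell k a i)%N.

Let upd (f : {ffun 'I_d -> nat}) j n : {ffun 'I_d -> nat} :=
  [ffun l => if l == j then n else f l].

Lemma in_cell_upd k a j n c i :
  in_cell (upd k j n) (upd a j c) i =
  (cellno b n (x i 0 j) == c) && [forall (l : 'I_d | l != j), cellno b (k l) (x i 0 l) == a l].
Proof.
apply/forallP/andP => [h|[h1 /forallP h2] l].
  split; first by have := h j; rewrite !ffunE eqxx.
  by apply/forallP => l; apply/implyP => lj; have := h l; rewrite !ffunE (negPf lj).
rewrite !ffunE; have [->//|lj] := eqVneq l j.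
by have := h2 l; rewrite lj.
Qed.

Lemma in_cell_split k a j i :
  in_cell k a i = (cellno b (k j) (x i 0 j) == a j) &&
    [forall (l : 'I_d | l != j), cellno b (k l) (x i 0 l) == a l].
Proof.
rewrite -in_cell_upd; congr in_cell; apply/ffunP => l; rewrite !ffunE;
by have [->|] := eqVneq l j.
Qed.

Lemma sum_upd k j n : (\sum_l upd k j n l + k j = \sum_l k l + n)%N.
Proof.
rewrite (bigD1 j)//= [in RHS](bigD1 j)//= ffunE eqxx addnAC [in RHS]addnAC.
rewrite [(n + _)%N]addnC; congr (_ + _)%N; apply: eq_bigr => l lj.
by rewrite ffunE (negPf lj).
Qed.

(** An elementary interval larger than those in the definition of a net is cut into [b] pieces along
    one coordinate, repeatedly, until the definition applies. *)
Lemma count_coarse e k a : (\sum_j k j + e = m - t)%N -> (forall j, a j < b ^ k j)%N ->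
  count k a = (b ^ (t + e))%N.
Proof.
elim: e k a => [|e IH] k a ke ak.
  rewrite addn0; case: net => _ _ /(_ k a); rewrite -ke addn0 => <-//.
  rewrite -sum1_card [RHS]big_mkcond /=; apply: eq_bigr => i _.
  rewrite (_ : (i \in _) = in_cell k a i); first by case: in_cell.
  rewrite /in_cell -elementary_intervalE//; apply/idP/idP => [h|h]; last exact: (mem_set h).
  exact: (@set_mem _ [set i | is_true (elementary_interval b k a (x i))] i h).
(* Any coordinate can be refined; the first one is taken, which exists because [d] is positive. *)
pose j := Ordinal d0.
have -> : count k a = (\sum_(r < b) count (upd k j (k j).+1) (upd a j (b * a j + r)))%N.
  rewrite /count exchange_big /=; apply: eq_bigr => i _.
  rewrite (eq_bigr _ (fun r _ => congr1 nat_of_bool (in_cell_upd k a j (k j).+1 _ i))).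
  rewrite (in_cell_split k a j); case: [forall (l | _), _]; last first.
    by rewrite andbF big1// => r _; rewrite andbF.
  rewrite andbT -(cellnoS b1 (k j) (x0 i j)); move: (cellno b _ _) => X.
  under eq_bigr do rewrite andbT.
  have bn : (0 < b)%N by rewrite ltnW.
  have rX : (X %% b < b)%N by rewrite ltn_mod.
  have [Xa|Xa] := eqVneq (X %/ b)%N (a j).
    rewrite (bigD1 (Ordinal rX))//= big1 ?addn0 => [|r rne].
      by rewrite {1}(divn_eq X b) Xa mulnC eqxx.
    apply/eqP; rewrite eqb0; apply: contra rne => /eqP Xr; apply/eqP/val_inj => /=.
    by rewrite Xr mulnC modnMDl modn_small.
  rewrite big1// => r _; apply/eqP; rewrite eqb0; apply: contra Xa => /eqP ->.
  by rewrite mulnC divnMDl// divn_small// addn0.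
rewrite (eq_bigr (fun=> b ^ (t + e)))%N; first by rewrite sum_nat_const card_ord addnS expnS.
move=> r _; apply: IH => [|l].
  by have := sum_upd k j (k j).+1; lia.
rewrite !ffunE; have [_|//] := eqVneq l j; rewrite expnS.
apply: (@leq_trans (b * (a j).+1)); last by rewrite leq_mul2l ak orbT.
by rewrite mulnS addnC ltn_add2r.
Qed.

(** A smaller elementary interval is enlarged, by dropping a last digit in some coordinate of
    positive level, until its volume is [b^(t - m)]. *)
Lemma count_fine k a : (m - t <= \sum_j k j)%N -> (forall j, a j < b ^ k j)%N ->
  (count k a <= b ^ t)%N.
Proof.
move=> /subnKC; move: (_ - (m - t))%N => e.
elim: e k a => [|e IH] k a ke ak.
  by rewrite (@count_coarse 0) ?addn0//; lia.
have [j kj] : exists j, (0 < k j)%N.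
  apply/existsP; apply: contraPT ke => /existsPn h.
  by rewrite big1 => [|j _]; [lia|have := h j; lia].
apply: (@leq_trans (count (upd k j (k j).-1) (upd a j (a j %/ b)))).
  apply: leq_sum => i _; rewrite (in_cell_split _ _ j) in_cell_upd.
  have := cellnoS b1 (k j).-1 (x0 i j); rewrite prednK// => <-.
  by case: eqP => [->|]//=; rewrite eqxx.
apply: IH => [|l]; first by have := sum_upd k j (k j).-1; lia.
rewrite !ffunE; have [_|//] := eqVneq l j.
by rewrite ltn_divLR ?(ltnW b1)// -expnSr prednK.
Qed.

(* The coordinates in [s] carry upper intervals, the others elementary intervals;
   moving one coordinate into [s] costs a factor [m b + 1]. *)
Lemma net_discrepancy_mixed (v : 'I_d -> R) (s : seq 'I_d) k a :
  (forall j, 0 <= v j < 1) -> uniq s -> (forall j, a j < b ^ k j)%N ->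
  `|\sum_i \prod_j (if j \in s then (v j < x i 0 j)%R
                     else cellno b (k j) (x i 0 j) == a j)%:R -
    b%:R ^+ m * \prod_j (if j \in s then 1 - v j else b%:R ^- k j)|
  <= (b ^ t)%:R * (m * b).+1%:R ^+ size s.
Proof.
move=> v01; have bn : (0 < b)%N by rewrite ltnW.
have b0 : 0 < (b%:R : R) by rewrite ltr0n.
have bk0 (e : nat) : 0 < (b%:R ^+ e : R) by rewrite exprn_gt0.
elim: s k a => [|j s IH] k a /= => [_ ak|/andP[js us] ak].
  rewrite expr0 mulr1 prodfV prodrXr.
  have -> : \sum_i \prod_j (cellno b (k j) (x i 0 j) == a j)%:R = (count k a)%:R :> R.
    rewrite natr_sum; apply: eq_bigr => i _.
    case: (boolP (in_cell k a i)) => [/forallP h|].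
      by rewrite big1// => j _; rewrite h.
    by rewrite negb_forall => /existsP[j /negPf h]; rewrite (bigD1 j)//= h mul0r.
  set S := (X in _ / b%:R ^+ X).
  have cc e : (S + e = m - t)%N -> count k a = (b ^ (t + e))%N.
    by move=> h; exact: count_coarse.
  have cf : (m - t <= S)%N -> (count k a <= b ^ t)%N by move=> h; exact: count_fine.
  clearbody S.
  (* Up to total level [m - t] the count is exact and the error is 0. Beyond it, the count and the
     scaled volume both lie in [[0, b^t]]. *)
  have [lekm|/ltnW lekm] := leqP S (m - t).
    rewrite (cc (m - t - S)%N) ?subnKC// natrX -exprB ?unitfE ?gt_eqF//; last lia.
    rewrite (_ : (t + _)%N = (m - S)%N); last lia.
    by rewrite subrr normr0 ler0n.
  have := cf lekm; rewrite -(ler_nat R) => ct.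
  have : 0 <= (b%:R : R) ^+ m / b%:R ^+ S <= (b ^ t)%:R.
    apply/andP; split; first by apply: divr_ge0; exact: ltW.
    rewrite ler_pdivrMr// natrX -exprD ler_weXn2l ?ler1n//; lia.
  have : 0 <= (count k a)%:R :> R by rewrite ler0n.
  move: ct; move: (count k a)%:R (_ / _) => p q ? ? /andP[? ?].
  by rewrite ler_norml; apply/andP; split; lra.
pose c : R := (b ^ t)%:R * (m * b).+1%:R ^+ size s.
have c1 : (b ^ t)%:R <= c by rewrite ler_peMr ?ler0n// exprn_ege1// ler1n.
pose rho i : R := \prod_(l | l != j) (if l \in s then (v l < x i 0 l)%R
                     else cellno b (k l) (x i 0 l) == a l)%:R.
pose rv : R := \prod_(l | l != j) (if l \in s then 1 - v l else b%:R ^- k l).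
have h1 : \sum_i \prod_l (if l \in j :: s then (v l < x i 0 l)%R
      else cellno b (k l) (x i 0 l) == a l)%:R = \sum_i (v j < x i 0 j)%R%:R * rho i.
  apply: eq_bigr => i _; rewrite (bigD1 j)//= mem_head; congr (_ * _).
  by apply: eq_bigr => l /negPf lj; rewrite inE lj.
have h2 : \prod_l (if l \in j :: s then 1 - v l else b%:R ^- k l) = (1 - v j) * rv.
  rewrite (bigD1 j)//= mem_head; congr (_ * _).
  by apply: eq_bigr => l /negPf lj; rewrite inE lj.
rewrite h1 h2 exprSr [leRHS]mulrA -/c [leRHS]mulrC.
apply: (threshold_discrepancy b1 (y := fun i => x i 0 j)) => //.
- move=> i; apply/andP; split; first by apply: prodr_ge0 => l _; rewrite ler0n.
  by apply: prodr_ile1 => l _; rewrite ler0n lern1 leq_b1.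
- have h l : 0 <= (if l \in s then 1 - v l else b%:R ^- k l) <= 1.
    case: ifP => _; first by case/andP: (v01 l) => ? ?; apply/andP; split; lra.
    by rewrite invr_ge0 ltW//= invf_le1// exprn_ege1// ler1n.
  apply/andP; split; first by apply: prodr_ge0 => l _; case/andP: (h l).
  by apply: prodr_ile1 => l _; exact: h.
(* The induction hypothesis is used with an arbitrary cell [r] of level [n] in the coordinate [j],
   which is not in [s]. *)
- move=> n r rb.
  have := IH (upd k j n) (upd a j r) us.
  have -> : \sum_i \prod_l (if l \in s then (v l < x i 0 l)%R
      else cellno b (upd k j n l) (x i 0 l) == upd a j r l)%:R
      = \sum_i (cellno b n (x i 0 j) == r)%:R * rho i.
    apply: eq_bigr => i _; rewrite (bigD1 j)//= (negPf js) !ffunE eqxx; congr (_ * _).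
    by apply: eq_bigr => l /negPf lj; rewrite !ffunE lj.
  have -> : \prod_l (if l \in s then 1 - v l else b%:R ^- upd k j n l) = b%:R ^- n * rv.
    rewrite (bigD1 j)//= (negPf js) !ffunE eqxx; congr (_ * _).
    by apply: eq_bigr => l /negPf lj; rewrite !ffunE lj.
  apply=> l; rewrite !ffunE; case: (l =P j) => [_|_] //.
(* A cell of level [m] in the coordinate [j] alone, with level 0 elsewhere, is an elementary
   interval of volume [b^-m] and contains at most [b^t] points. *)
- move=> r rm.
  apply: le_trans c1.
  have := @count_fine (upd [ffun=> 0%N] j m) (upd [ffun=> 0%N] j r).
  have km : (m - t <= \sum_l upd [ffun=> 0%N] j m l)%N.
    by have := sum_upd [ffun=> 0%N] j m; rewrite ffunE; lia.
  move=> /(_ km); rewrite -(ler_nat R) => h; apply: le_trans (h _).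
    rewrite natr_sum; apply: ler_sum => i _; rewrite in_cell_upd ler_nat.
    case: eqP => //= _; rewrite (_ : [forall (_ | _), _])//.
    by apply/forallP => l; apply/implyP => _; rewrite !ffunE cellno0.
  by move=> l; rewrite !ffunE; case: (l =P j) => [_|_] //; rewrite expn0.
- by rewrite (le_trans _ c1)// ler1n expn_gt0 bn.
Qed.

Lemma net_discrepancy (v : 'I_d -> R) : (forall j, 0 <= v j < 1) ->
  `|\sum_i [forall j, v j < x i 0 j]%:R - b%:R ^+ m * \prod_j (1 - v j)|
  <= (b ^ t)%:R * (m * b).+1%:R ^+ d.
Proof.
move=> v01.
have := @net_discrepancy_mixed v (enum 'I_d) [ffun=> 0%N] [ffun=> 0%N] v01 (enum_uniq _).
rewrite size_enum_ord => h; have /h{h} : forall j : 'I_d,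
    (([ffun=> 0%N] : {ffun 'I_d -> nat}) j < b ^ ([ffun=> 0%N] : {ffun 'I_d -> nat}) j)%N.
  by move=> j; rewrite !ffunE expn0.
congr (`|_ - _ * _| <= _); apply: eq_bigr => i _; last by rewrite mem_enum.
case: (boolP [forall j, _]) => [/forallP h|].
  by rewrite big1// => j _; rewrite mem_enum h.
by rewrite negb_forall => /existsP[j /negPf h]; rewrite (bigD1 j)//= mem_enum h mul0r.
Qed.

End NetDiscrepancy.

(** * Scrambling *)

Section Scramble.
Context {R : realType} {b : nat} (hb : (1 < b)%N).

Let b0 : 0 < (b%:R : R). Proof. by rewrite ltr0n ltnW. Qed.
Let bX k : 0 < (b%:R ^+ k : R). Proof. exact: exprn_gt0. Qed.

Definition expansion (e : nat -> 'I_b) : R^nat :=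
  series (fun k => (e k : nat)%:R / b%:R ^+ k.+1).

(** Digits are at most [b - 1], and with all digits equal to [b - 1] the sum telescopes to the upper
    bound. *)
Lemma expansion_tail e k n : (k <= n)%N ->
  0 <= expansion e n - expansion e k <= b%:R ^- k - b%:R ^- n.
Proof.
elim: n => [|n IH]; first by rewrite leqn0 => /eqP ->; rewrite !subrr lexx.
rewrite leq_eqVlt => /predU1P[->|]; first by rewrite !subrr lexx.
rewrite ltnS => /IH; rewrite /expansion seriesS.
set p := series _ n; set q := series _ k => /andP[h1 h2].
have e0 : 0 <= (e n)%:R / b%:R ^+ n.+1 :> R by rewrite divr_ge0// ltW.
have e1 : (e n)%:R / b%:R ^+ n.+1 <= b%:R ^- n - b%:R ^- n.+1 :> R.
  rewrite [leRHS](_ : _ = (b%:R - 1) / b%:R ^+ n.+1); last first.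
    by rewrite exprS; field; rewrite !gt_eqF.
  rewrite ler_pM2r ?invr_gt0// lerBrDr natr1 ler_nat; exact: ltn_ord.
by apply/andP; split; lra.
Qed.

Lemma expansion_itv e n : 0 <= expansion e n < 1.
Proof.
have := expansion_tail e (leq0n n).
rewrite {2 4}/expansion /series/= big_geq// expr0 invr1 subr0 => /andP[-> h].
by rewrite (le_lt_trans h)// ltrBlDr ltrDl invr_gt0.
Qed.

Lemma is_cvg_expansion e : cvgn (expansion e).
Proof.
apply: nondecreasing_is_cvgn.
  by move=> k n kn; have /andP[+ _] := expansion_tail e kn; rewrite subr_ge0.
by exists 1 => _ [n _ <-]; have /andP[_ /ltW] := expansion_itv e n.
Qed.

(** A finite expansion stays strictly below the end of its cell, so its cell number can be read off
    the digits. For an infinite expansion ending in digits [b - 1] this would fail. *)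
Lemma cellno_expansionS e k n : (k < n)%N ->
  cellno b k.+1 (expansion e n) = (b * cellno b k (expansion e n) + e k)%N.
Proof.
have H j : (j <= n)%N ->
    (cellno b j (expansion e n))%:R = b%:R ^+ j * expansion e j.
  elim: j => [_|j IH jn].
    by rewrite cellno0 ?expansion_itv// /expansion /series/= big_geq// mulr0.
  have y0 : 0 <= expansion e n by case/andP: (expansion_itv e n).
  have E : b%:R ^+ j.+1 * expansion e j.+1 = (b * cellno b j (expansion e n) + e j)%:R.
    rewrite natrD natrM IH ?(ltnW jn)// /expansion seriesS/= exprS.
    by field; rewrite !gt_eqF.
  rewrite E; congr (_%:R); apply/eqP; rewrite cellnoP// -natr1 -E.
  rewrite mulrAC mulfV ?gt_eqF// mul1r.
  rewrite mulrDl mulrAC mulfV ?gt_eqF// !mul1r.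
  have /andP[h1 h2] := expansion_tail e jn; have := bX n; rewrite -invr_gt0 => h3.
  by apply/andP; split; lra.
move=> kn; apply/eqP; rewrite -(eqr_nat R) H// natrD natrM H ?(ltnW kn)//.
by rewrite /expansion seriesS/= exprS; apply/eqP; field; rewrite !gt_eqF.
Qed.

Variable s : seq 'I_b -> {perm 'I_b}.

Definition scrambled_digit (x : R) k : 'I_b := s (mkseq (digit hb x) k) (digit hb x k).

Lemma scramble_coordE x : scramble_coord hb s x = limn (expansion (scrambled_digit x)).
Proof. by []. Qed.

Lemma val_digit (x : R) k : digit hb x k = (cellno b k.+1 x %% b)%N :> nat.
Proof. by []. Qed.

(* Scrambling permutes the [b]-adic cells of every level; the digit prefix [p] is
   needed to identify the permutation acting on the next digit. *)
Lemma scramble_cell n k a : (k <= n)%N -> (a < b ^ k)%N ->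
  exists a' p, [/\ (a' < b ^ k)%N,
    forall x : R, 0 <= x < 1 ->
      (cellno b k (expansion (scrambled_digit x) n) == a) = (cellno b k x == a')
    & forall x : R, 0 <= x < 1 -> cellno b k x = a' -> mkseq (digit hb x) k = p].
Proof.
elim: k a => [|k IH] a kn ak.
  exists 0%N, [::]; split => // x x01; rewrite !cellno0 ?expansion_itv//.
  by move: ak; rewrite expn0 ltnS leqn0 eq_sym.
have bn : (0 < b)%N by rewrite ltnW.
have [] := IH (a %/ b)%N (ltnW kn); first by rewrite ltn_divLR// -expnSr.
move=> a' [p [a'k Hc Hp]].
pose r : 'I_b := Ordinal (ltn_pmod a bn).
(* The digit that the permutation attached to the prefix [p] sends to [r], the last digit of [a]. *)
pose q := ((s p)^-1)%g r.
have split_eq (c w : nat) (y : 'I_b) : (b * w + y == c)%N = (w == c %/ b)%N && (y == c %% b :> nat)%N.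
  apply/eqP/andP => [<-|[/eqP -> /eqP ->]]; last by rewrite mulnC -divn_eq.
  by rewrite mulnC divnMDl// divn_small// addn0 eqxx modnMDl modn_small.
have q_eq (x : R) : 0 <= x < 1 -> (cellno b k.+1 x == b * a' + q)%N =
    (cellno b k x == a') && (digit hb x k == q).
  move=> x01; have x0 : 0 <= x by case/andP: x01.
  rewrite {1}(divn_eq (cellno b k.+1 x) b) cellnoS// mulnC -val_digit split_eq.
  by rewrite mulnC divnMDl// divn_small// addn0 modnMDl modn_small.
exists (b * a' + q)%N, (rcons p q); split.
- rewrite expnS; apply: (@leq_trans (b * a'.+1)); last by rewrite leq_mul2l a'k orbT.
  by rewrite mulnS addnC ltn_add2r.
- move=> x x01; rewrite q_eq// cellno_expansionS// split_eq Hc//.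
  case: (cellno b k x =P a') => //= xa; rewrite /scrambled_digit (Hp _ x01 xa).
  by apply/eqP/eqP => [h|->]; [apply: (@perm_inj _ (s p)); apply: val_inj; rewrite permKV|
    rewrite permKV].
- move=> x x01 /eqP; rewrite q_eq// => /andP[/eqP xa /eqP xq].
  by rewrite mkseqS (Hp _ x01 xa) xq.
Qed.

End Scramble.

Section ScrambledNet.
Context {R : realType} {d b : nat} (hb : (1 < b)%N).
Variable s : 'I_d -> seq 'I_b -> {perm 'I_b}.

(* Scrambled points need not lie in half-open cells (all digits may end up being
   [b - 1], with value 1), but their truncations do. *)
Definition truncated_scramble n (x : 'rV[R]_d) : 'rV[R]_d :=
  \row_j expansion (scrambled_digit hb (s j) (x 0 j)) n.

(** The elementary intervals to be tested have level at most [m - t] in each coordinate, so [m]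
    digits determine membership. Membership of a truncated scrambled point is membership of the
    original point in another elementary interval with the same levels. *)
Lemma truncated_scramble_net t m n (x : 'I_(b ^ m) -> 'rV[R]_d) : (m <= n)%N ->
  tmd_net t x -> tmd_net t (fun i => truncated_scramble n (x i)).
Proof.
move=> mn [tm x01 net]; split => // [i j|k a km ak].
  by rewrite mxE expansion_itv.
have x0 i j : 0 <= x i 0 j by case/andP: (x01 i j).
have kn j : (k j <= n)%N.
  by rewrite (leq_trans _ mn)// (leq_trans _ (leq_subr t m))// -km (bigD1 j)//= leq_addr.
have exa : forall j : 'I_d, exists a' : nat, (a' < b ^ k j)%N /\
    forall x : R, 0 <= x < 1 ->
     (cellno b (k j) (expansion (scrambled_digit hb (s j) x) n : R) == a j) =
     (cellno b (k j) x == a').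
  by move=> j; have [a' [p [h1 h2 _]]] := @scramble_cell R b hb (s j) n _ _ (kn j) (ak j); exists a'.
have [a' Ha'] := choice exa.
rewrite -(net k [ffun j => a' j])//; last by move=> j; rewrite ffunE; case: (Ha' j).
apply: eq_card => i; congr (i \in (_ : {pred _})).
apply: funext => {}i; congr (asbool (is_true _)).
have y0 j : 0 <= truncated_scramble n (x i) 0 j.
  by rewrite mxE; case/andP: (@expansion_itv R b hb (scrambled_digit hb (s j) (x i 0 j)) n).
rewrite !elementary_intervalE//.
by apply: eq_forallb => j; rewrite mxE ffunE; case: (Ha' j) => _ ->.
Qed.

Lemma scramble_coord_itv (u : seq 'I_b -> {perm 'I_b}) (x : R) :
  0 <= scramble_coord hb u x <= 1.
Proof.
rewrite scramble_coordE; have c := @is_cvg_expansion R b hb (scrambled_digit hb u x).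
have h n := @expansion_itv R b hb (scrambled_digit hb u x) n.
apply/andP; split.
  by apply: limr_ge => //; apply: nearW => n; case/andP: (h n).
by apply: limr_le => //; apply: nearW => n; case/andP: (h n) => _ /ltW.
Qed.

Lemma cvg_truncated_scramble (x : 'rV[R]_d) :
  truncated_scramble n x @[n --> \oo] --> \row_j scramble_coord hb (s j) (x 0 j).
Proof.
apply: cvg_row => j; rewrite mxE scramble_coordE.
rewrite (_ : (fun n => _) = (expansion (scrambled_digit hb (s j) (x 0 j)) : R^nat)); last first.
  by apply/funext => n; rewrite mxE.
exact: (@is_cvg_expansion R b hb).
Qed.

End ScrambledNet.

(** * The Koksma-Hlawka inequality *)

Section GrowthChain.
Context {R : realType} {d : nat}.
Local Notation leb := (@lebesgue_measure R).
Local Notation D := (@open_cube R d).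
Implicit Types (q : 'rV[R]_d -> R) (u : 'rV[R]_d).

Lemma set_coordE u j (s : R) : set_coord u j s = (u - u 0 j *: 'e_j) + s *: 'e_j.
Proof.
apply/rowP => k; rewrite !mxE eqxx /=.
by case: (k =P j) => [->|_]; rewrite ?mulr1 ?mulr0 ?subrr ?add0r ?subr0 ?addr0.
Qed.

Lemma set_coord_cube u j (s : R) : D u -> 0 < s < 1 -> D (set_coord u j s).
Proof. by move=> Du s01 k; rewrite mxE; case: ifP. Qed.

Lemma continuous_set_coord u j (s : R) : {for s, continuous (set_coord u j)}.
Proof.
apply: for_continuous_row => k.
have [->|kj] := eqVneq k j.
  rewrite (_ : (fun y => _) = id); first exact: cvg_id.
  by apply/funext => y; rewrite mxE eqxx.
rewrite (_ : (fun y => _) = fun=> u 0 k); first exact: cvg_cst.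
by apply/funext => y; rewrite mxE (negPf kj).
Qed.

Lemma weight_set_coord (e : 'I_d -> R) u j (s : R) :
  weight e (set_coord u j s) =
  mindist s `^ e j * \prod_(k | k != j) mindist (u 0 k) `^ e k.
Proof.
rewrite /weight (bigD1 j)//= mxE eqxx; congr (_ * _).
by apply: eq_bigr => k /negPf kj; rewrite mxE kj.
Qed.

Definition mindist_weight (delta x : R) : R := mindist x `^ (delta - 1).

Lemma measurable_mindist_weight delta : measurable_fun setT (mindist_weight delta).
Proof.
apply: (@measurableT_comp _ _ _ _ _ _ (fun x : R => x `^ (delta - 1))); first exact: measurable_powR.
by apply: measurable_minr => //; exact: measurable_funB.
Qed.

Lemma continuous_mindist (x : R) : {for x, continuous (@mindist R)}.
Proof. by apply: continuous_min; [exact: cvg_id|apply: cvgB; [exact: cvg_cst|exact: cvg_id]]. Qed.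

(** With the other coordinates fixed, the exponent [delta - 1] makes the more differentiated
    function integrable in coordinate [j]. Its primitive, not yet differentiated in [j], is bounded
    by a multiple of [s] to the power [delta] and tends to 0 with [s]. *)
Lemma growth_ftc_chain (delta : R) q : 0 < delta < 1 ->
  growth (rev (enum 'I_d)) (fun=> delta) q ->
  ftc_chain (mindist_weight delta) (fun j => pderivs (drop j (enum 'I_d)) q).
Proof.
move=> d01 gq; split.
- by move=> j u _ Du; case: (growth_pderivs_drop j gq) => + _; exact.
- by move=> j _; case: (growth_pderivs_drop j gq).
move=> j u Du.
have [E [dG [C bG]]] := growth_pderivs_step j gq.
have [cg [C' bg]] := growth_pderivs_drop j gq.
have [cG _] := growth_pderivs_drop j.+1 gq.
set G := pderivs (drop j.+1 _) q in E dG bG cG *.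
set g := pderivs (drop j _) q in E cg bg *.
rewrite [RHS](_ : _ = (G (set_coord u j (u 0 j)))%:E); last first.
  congr (G _)%:E; apply/rowP => k; rewrite mxE; by case: (k =P j) => [->|].
apply: (@FTC_from0 R (fun s => G (set_coord u j s)) (fun s => g (set_coord u j s)) (u 0 j)).
- exact: Du.
- move=> s s01; rewrite E /pderiv.
  have := dG _ (set_coord_cube j Du s01); rewrite set_coordE => /is_derive_line.
  by under eq_fun do rewrite -set_coordE.
- move=> s s01; apply: (@continuous_comp R _ R (set_coord u j) g s (@continuous_set_coord u j s)).
  exact: cg (set_coord_cube j Du s01).
- pose M := `|C'| * \prod_(k | k != j) mindist (u 0 k) `^ (delta - 1).
  have M0 : 0 <= M by rewrite mulr_ge0// prodr_ge0// => k _; exact: powR_ge0.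
  have mI : @measurable _ (measurableTypeR R) `]0, 1[%classic by exact: measurable_itv.
  have cs s : `]0, 1[%classic s -> {for s, continuous (fun s : R => g (set_coord u j s))}.
    rewrite /= in_itv/= => s01; apply: (@continuous_comp R _ R (set_coord u j) g s (@continuous_set_coord u j s)).
    exact: cg (set_coord_cube j Du s01).
  have mg : @measurable_fun _ _ (measurableTypeR R) _ `]0, 1[ (fun s : R => g (set_coord u j s)).
    apply: subspace_continuous_measurable_fun => //.
    by apply: continuous_in_subspaceT => s /set_mem; exact: cs.
  apply: (@le_integrable _ (measurableTypeR R) R leb _ mI _
     (fun s => (M * mindist_weight delta s)%:E)).
  + exact/measurable_EFinP.
  + move=> s; rewrite /= in_itv/= => s01.
    rewrite lee_fin [leRHS]ger0_norm; last by rewrite mulr_ge0// powR_ge0.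
    apply: le_trans (bg _ (set_coord_cube j Du s01)) _.
    rewrite weight_set_coord mulrCA mulrC; apply: ler_wpM2r; first exact: powR_ge0.
    by apply: ler_wpM2r; [rewrite prodr_ge0// => k _; exact: powR_ge0|exact: ler_norm].
  + apply: (@integrableZl _ (measurableTypeR R) R leb _ mI M (fun s => (mindist_weight delta s)%:E)).
    apply/integrableP; split.
      by apply/measurable_EFinP; apply: measurable_funTS; exact: measurable_mindist_weight.
    under eq_integral => s _ do rewrite abse_EFin ger0_norm ?powR_ge0//.
    exact: integral_mindist_powR.
- pose M := `|C| * \prod_(k | k != j) mindist (u 0 k) `^ (delta - (j < k)%N%:R).
  have M0 : 0 <= M by rewrite mulr_ge0// prodr_ge0// => k _; exact: powR_ge0.
  have cM : M * s `^ delta @[s --> 0^'+] --> (0 : R).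
    rewrite -[X in _ --> X](mulr0 M); apply: cvgM; first exact: cvg_cst.
    by apply: powR_cvg0; case/andP: d01.
  apply: (@squeeze_cvgr _ _ _ _ (fun s => - (M * s `^ delta)) (fun s => M * s `^ delta)) => //.
    near=> s; rewrite -ler_norml.
    have s01 : 0 < s < 1.
      by apply/andP; split; near: s; [exact: nbhs_right_gt|exact: nbhs_right_lt].
    apply: le_trans (bG _ (set_coord_cube j Du s01)) _.
    rewrite weight_set_coord ltnn subr0; set P := \prod_(k | _) _.
    have P0 : 0 <= P by rewrite prodr_ge0// => k _; exact: powR_ge0.
    have h : mindist s `^ delta <= s `^ delta.
      have ms : mindist s <= s by rewrite ge_min lexx.
      have /andP[m0 _] := mindist_itv s01; case/andP: s01 => s0 s1.
      by apply: ge0_ler_powR => //; rewrite ?nnegrE ltW//; case/andP: d01.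
    apply: le_trans (ler_wpM2r (mulr_ge0 (powR_ge0 _ _) P0) (ler_norm C)) _.
    by rewrite /M -mulrA [P * _]mulrC ler_wpM2l// ler_wpM2r.
  by rewrite -[X in _ --> X]oppr0; exact: cvgN cM.
Unshelve. all: by end_near.
Qed.

End GrowthChain.

Lemma measurable_set_lt {R : realType} d (T : measurableType d) (f g : T -> R) :
  measurable_fun setT f -> measurable_fun setT g -> measurable [set x | f x < g x].
Proof.
move=> mf mg; have := measurable_fun_ltr mf mg; move=> /(_ measurableT [set true]).
rewrite setTI => h; rewrite (_ : mkset _ = (fun x => f x < g x) @^-1` [set true]); first exact: h.
by apply/seteqP; split => x.
Qed.

Section KoksmaHlawka.
Context {R : realType} {d : nat}.
Local Notation leb := (@lebesgue_measure R).
Local Notation lam := (lebesgue_tuple R d).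
Local Notation D := (@row_of_tuple R d @^-1` (@open_cube R d)).
Variables (w : R -> R) (G : nat -> 'rV[R]_d -> R).
Hypotheses (mw : measurable_fun setT w) (w0 : forall x, 0 <= w x)
  (wfin : (\int[leb]_(x in `]0%R, 1%R[) (w x)%:E < +oo)%E) (chain : ftc_chain w G).

Let mD : measurable D. Proof. exact: measurable_cube. Qed.

Lemma integrable_chain j : (j <= d)%N -> lam.-integrable D (EFin \o (G j \o row_of_tuple)).
Proof.
move=> jd; case: chain => cG bG _.
have [C bC] := bG j jd.
by apply: (integrable_cube mw w0 wfin (C := C)) => // u Du; exact: cG.
Qed.

Lemma integrable_chainM (r : d.-tuple R -> R) : measurable_fun D r ->
  (forall t, D t -> `|r t| <= 1) ->
  lam.-integrable D (EFin \o (fun t => r t * G 0 (row_of_tuple t))).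
Proof.
move=> mr r1; have i0 := integrable_chain (leq0n d).
apply: le_integrable i0 => //.
  apply/measurable_EFinP; apply: measurable_funM => //.
  by have /integrableP[/measurable_EFinP] := integrable_chain (leq0n d).
move=> t Dt; rewrite /= lee_fin normrM.
by apply: ler_piMl => //; exact: r1.
Qed.

Let complement_volume (t : d.-tuple R) : R := \prod_j (1 - tnth t j).

Let volume1 t : D t -> `|complement_volume t| <= 1.
Proof.
move=> Dt; have h j : 0 <= 1 - tnth t j <= 1.
  by have := Dt j; rewrite mxE => /andP[? ?]; apply/andP; split; lra.
rewrite ger0_norm; first by apply: prodr_ile1 => j _; exact: h.
by apply: prodr_ge0 => j _; case/andP: (h j).
Qed.

Let measurable_volume (A : set (d.-tuple R)) : measurable_fun A complement_volume.
Proof.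
apply: measurable_funTS; apply: measurable_prod => j _.
by apply: measurable_funB => //; exact: measurable_tnth.
Qed.

(** The pairs of points of the cube whose second component lies strictly below the first; [f] is
    [G 0] of the second component on this set. Integrating [f] in the two possible orders gives the
    two sides of the identity below. *)
Let A : set (d.-tuple R * d.-tuple R) :=
  [set z | forall j, [/\ 0 < tnth z.2 j, tnth z.2 j < tnth z.1 j & tnth z.1 j < 1]].

Let measurable_A : measurable A.
Proof.
rewrite (_ : A = \bigcap_(j in [set: 'I_d]) ([set z | 0 < tnth z.2 j] `&`
   [set z | tnth z.2 j < tnth z.1 j] `&` [set z | tnth z.1 j < 1])); last first.
  apply/seteqP; split => z /=; first by move=> h j _; case: (h j).
  by move=> h j; have [[]] := h j I.
have m1 j : measurable_fun setT (fun z : d.-tuple R * d.-tuple R => tnth z.1 j).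
  exact: (measurableT_comp (measurable_tnth j) measurable_fst).
have m2 j : measurable_fun setT (fun z : d.-tuple R * d.-tuple R => tnth z.2 j).
  exact: (measurableT_comp (measurable_tnth j) measurable_snd).
apply: fin_bigcap_measurable => // j _.
by apply: measurableI; [apply: measurableI|]; apply: measurable_set_lt.
Qed.

Let f : d.-tuple R * d.-tuple R -> \bar R :=
  (fun z => (G 0 (row_of_tuple z.2))%:E) \_ A.

Let A_cube z : A z -> D z.1 /\ D z.2.
Proof.
move=> Az; split => j; rewrite mxE; have [h1 h2 h3] := Az j.
  by rewrite h3 (lt_trans h1).
by rewrite h1 (lt_trans h2).
Qed.

Let measurable_f : measurable_fun setT f.
Proof.
apply/(measurable_restrictT _ measurable_A)/measurable_EFinP.
apply: (@measurable_comp _ _ _ _ _ _ D (G 0 \o row_of_tuple) A snd) => //.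
- by move=> _ [z Az <-]; case: (A_cube Az).
- by have /integrableP[/measurable_EFinP] := integrable_chain (leq0n d).
- exact: measurable_funTS.
Qed.

Let inner1 s : (\int[lam]_t f (s, t) = ((fun s => (G d (row_of_tuple s))%:E) \_ D) s)%E.
Proof.
rewrite [RHS]patchE; case: ifP => [/set_mem Ds|/negP Ds].
  rewrite -(mixed_FTC mw w0 wfin chain Ds) [RHS]integral_mkcond.
  apply: eq_integral => t _; rewrite /f !patchE.
  suff -> : ((s, t) \in A) = (t \in row_of_tuple @^-1` lower_box (row_of_tuple s)) by [].
  apply/idP/idP => /set_mem h; apply/mem_set => j; rewrite ?mxE/=.
    by have [-> ->] := h j.
  by have := h j; rewrite !mxE => /andP[h1 h2]; have := Ds j; rewrite mxE => /andP[].
rewrite integral0_eq// => t _; rewrite /f patchE memNset// => /A_cube[] /mem_set.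
by move/Ds.
Qed.

Let inner2 t (c : R) : D t -> (\int[lam]_s ((cst c%:E \_ (A : set _)) (s, t)) = (complement_volume t * c)%:E)%E.
Proof.
move=> Dt; pose B := [set s : d.-tuple R | forall j, `]tnth t j, 1[%classic (tnth s j)].
transitivity (\int[lam]_(s in B) cst c%:E s)%E.
  rewrite [RHS]integral_mkcond; apply: eq_integral => s _; rewrite !patchE.
  suff -> : ((s, t) \in A) = (s \in B) by [].
  apply/idP/idP => /set_mem h; apply/mem_set => j.
    by have [h1 h2 h3] := h j; rewrite /= in_itv/= h2.
  by have := h j; rewrite /= in_itv/= => /andP[h1 h2]; have := Dt j; rewrite mxE => /andP[].
rewrite integral_cst; last first.
  rewrite (_ : B = \bigcap_(j in [set: 'I_d]) ((@tnth d R)^~ j @^-1` `]tnth t j, 1[)).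
    apply: fin_bigcap_measurable => // j _; rewrite -[X in measurable X]setTI.
    by apply: measurable_tnth => //; exact: measurable_itv.
  by apply/seteqP; split => [s sB j _|s sB j]; [exact: sB|exact: (sB j I)].
transitivity (c%:E * \prod_j leb (`]tnth t j, 1[%classic)%R)%E.
  by congr (_ * _)%E; apply: (@lebesgue_tuple_box R d (fun j => `]tnth t j, 1[%classic)) => j; exact: measurable_itv.
rewrite muleC EFinM; congr (_ * _)%E; rewrite /complement_volume -prodEFin.
apply: eq_bigr => j _; rewrite lebesgue_measure_itv/= lte_fin.
by have := Dt j; rewrite mxE => /andP[_ ->].
Qed.

Let inner2f t : (\int[lam]_s f (s, t) =
  ((fun t => (complement_volume t * G 0 (row_of_tuple t))%:E) \_ D) t)%E.
Proof.
rewrite [RHS]patchE; case: ifP => [/set_mem Dt|/negP Dt].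
  by rewrite -inner2//; apply: eq_integral => s _; rewrite /f !patchE.
rewrite integral0_eq// => s _; rewrite /f patchE memNset// => /A_cube[_] /mem_set.
by move/Dt.
Qed.

Let inner2_abs t : (\int[lam]_s `|f (s, t)| =
  ((fun t => `|(complement_volume t * G 0 (row_of_tuple t))%:E|) \_ D) t)%E.
Proof.
rewrite [RHS]patchE; case: ifP => [/set_mem Dt|/negP Dt].
  transitivity (complement_volume t * `|G 0 (row_of_tuple t)|)%:E.
    rewrite -inner2//; apply: eq_integral => s _; rewrite /f !patchE.
    by case: ifP => _; rewrite ?abse0.
  have v0 : 0 <= complement_volume t.
    apply: prodr_ge0 => j _; have := Dt j; rewrite mxE => /andP[_ /ltW].
    by rewrite subr_ge0.
  by rewrite abse_EFin normrM (ger0_norm v0).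
rewrite integral0_eq// => s _; rewrite /f patchE memNset ?abse0// => /A_cube[_] /mem_set.
by move/Dt.
Qed.

(** [G d] at [s] is the integral of [G 0] over the [t] below [s]; exchanging the integrals weights
    [G 0] at [t] by the volume of the points above [t]. Since that volume is at most 1, the
    integrability of [G 0] justifies Fubini. *)
Lemma integral_chain_top :
  (\int[lam]_(t in D) (G d (row_of_tuple t))%:E =
   \int[lam]_(t in D) (complement_volume t * G 0 (row_of_tuple t))%:E)%E.
Proof.
rewrite [LHS]integral_mkcond [RHS]integral_mkcond.
transitivity (\int[lam]_s \int[lam]_t f (s, t))%E.
  by apply: eq_integral => s _; rewrite inner1.
transitivity (\int[lam]_t \int[lam]_s f (s, t))%E.
  apply: Fubini; apply/(integrable21ltyP _ _ measurable_f).
  under eq_integral => t _ do rewrite inner2_abs.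
  rewrite -integral_mkcond.
  by have /integrableP[] := integrable_chainM (@measurable_volume D) volume1.
by apply: eq_integral => t _; rewrite inner2f.
Qed.

Definition lower_indicator (y : 'rV[R]_d) (t : d.-tuple R) : R := [forall j, tnth t j < y 0 j]%R%:R.

Lemma measurable_lower_indicator (y : 'rV[R]_d) (B : set (d.-tuple R)) : measurable_fun B (lower_indicator y).
Proof.
apply: measurable_funTS.
rewrite (_ : lower_indicator y = \1_[set t | forall j, `]-oo, y 0 j[%classic (tnth t j)]).
  apply: measurable_indic.
  rewrite (_ : mkset _ = \bigcap_(j in [set: 'I_d]) ((@tnth d R)^~ j @^-1` `]-oo, y 0 j[)).
    apply: fin_bigcap_measurable => // j _; rewrite -[X in measurable X]setTI.
    by apply: measurable_tnth => //; exact: measurable_itv.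
  by apply/seteqP; split => [s sB j _|s sB j]; [exact: sB|exact: (sB j I)].
apply/funext => t; rewrite indicE /lower_indicator; congr (nat_of_bool _)%:R.
apply/forallP/idP => [h|/set_mem h j]; last by have := h j; rewrite /= in_itv.
by apply/mem_set => j; rewrite /= in_itv/=; exact: h.
Qed.

(** A point of the half-open cube outside the open one has a coordinate equal to 0, so no [t] of the
    cube lies below it and the integral is 0, as is the extended value. *)
Lemma integral_lower_indicator (y : 'rV[R]_d) : (forall j, 0 <= y 0 j < 1) ->
  (\int[lam]_(t in D) (lower_indicator y t * G 0 (row_of_tuple t))%:E =
   (if y \in @open_cube R d then G d y else 0)%:E)%E.
Proof.
move=> y01; case: ifP => [/set_mem Dy|/negP Dy].
  rewrite -(mixed_FTC mw w0 wfin chain Dy) [LHS]integral_mkcond [RHS]integral_mkcond.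
  apply: eq_integral => t _; rewrite !patchE /lower_indicator.
  have [/set_mem ty|/negP ty] := boolP (t \in row_of_tuple @^-1` lower_box y).
    rewrite mem_set; last exact: (lower_box_cube Dy ty).
    rewrite (introT forallP) ?mul1r// => j; have := ty j; rewrite mxE.
    by case/andP.
  case: ifP => // /set_mem Dt; case: forallP => [h|_]; last by rewrite mul0r.
  exfalso; apply: ty; apply/mem_set => j; rewrite mxE h andbT.
  by have := Dt j; rewrite mxE => /andP[].
rewrite integral0_eq// => t Dt; rewrite /lower_indicator.
case: forallP => [h|_]; last by rewrite mul0r.
exfalso; apply: Dy; apply/mem_set => j; case/andP: (y01 j) => _ ->; rewrite andbT.
by apply: le_lt_trans (h j); have := Dt j; rewrite mxE => /andP[/ltW].
Qed.

Lemma Rintegral_sum (I : Type) (s : seq I) (F : I -> d.-tuple R -> R) :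
  (forall i, lam.-integrable D (EFin \o F i)) ->
  lam.-integrable D (EFin \o (fun t => \sum_(i <- s) F i t)) /\
  \int[lam]_(t in D) (\sum_(i <- s) F i t) = \sum_(i <- s) \int[lam]_(t in D) F i t.
Proof.
move=> iF; elim: s => [|i s [IH1 IH2]].
  rewrite (_ : (fun t => _) = fun=> 0); last by apply/funext => t; rewrite big_nil.
  rewrite big_nil; split; first exact: integrable0.
  by rewrite /Rintegral integral0_eq.
have E : (fun t => \sum_(j <- i :: s) F j t) = (fun t => F i t + \sum_(j <- s) F j t).
  by apply/funext => t; rewrite big_cons.
rewrite E big_cons; split.
  exact: (integrableD mD (iF i) IH1).
by rewrite RintegralD// IH2.
Qed.

(** The sample mean integrates [G 0] against the proportion of points above [t], the exact value
    against the volume of the points above [t]. Their difference is the local discrepancy at [t], at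
    most [c / n]. *)
Lemma Koksma_Hlawka n (y : 'I_n -> 'rV[R]_d) (c : R) : (0 < n)%N ->
  (forall i j, 0 <= y i 0 j < 1) ->
  (forall v : 'I_d -> R, (forall j, 0 <= v j < 1) ->
    `|\sum_i [forall j, v j < y i 0 j]%R%:R - n%:R * \prod_j (1 - v j)| <= c) ->
  `|n%:R^-1 * \sum_i (if y i \in @open_cube R d then G d (y i) else 0) -
     \int[lam]_(t in D) G d (row_of_tuple t)|
  <= c / n%:R * \int[lam]_(t in D) `|G 0 (row_of_tuple t)|.
Proof.
move=> n0 y01 disc.
have n0' : 0 < n%:R :> R by rewrite ltr0n.
have i0 := integrable_chain (leq0n d).
have iV := integrable_chainM (@measurable_volume D) volume1.
have iI i : lam.-integrable D (EFin \o (fun t => lower_indicator (y i) t * G 0 (row_of_tuple t))).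
  apply: integrable_chainM; first exact: measurable_lower_indicator.
  by move=> t _; rewrite /lower_indicator normr_nat lern1 leq_b1.
have [iS ES] := Rintegral_sum (index_enum 'I_n) iI.
have EV : \int[lam]_(t in D) G d (row_of_tuple t) =
    \int[lam]_(t in D) (complement_volume t * G 0 (row_of_tuple t)).
  by rewrite /Rintegral integral_chain_top.
have -> : \sum_i (if y i \in @open_cube R d then G d (y i) else 0) =
   \int[lam]_(t in D) (\sum_i lower_indicator (y i) t * G 0 (row_of_tuple t)).
  rewrite ES; apply: eq_bigr => i _.
  by rewrite /Rintegral (integral_lower_indicator (y01 i)).
rewrite EV -[X in `|X - _|]RintegralZl//.
have iS' : lam.-integrable D (EFin \o (fun t =>
    n%:R^-1 * (\sum_i lower_indicator (y i) t * G 0 (row_of_tuple t)))).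
  exact: (integrableZl mD _ iS).
rewrite -RintegralB//.
apply: le_trans (le_normr_Rintegral mD _) _; first exact: (integrableB mD iS' iV).
rewrite -[leRHS]RintegralZl//; last exact: (integrable_norm i0).
apply: le_Rintegral => //.
- exact: (integrable_norm (integrableB mD iS' iV)).
- exact: (integrableZl mD _ (integrable_norm i0)).
move=> t Dt.
rewrite -mulr_suml mulrA -mulrBl normrM; apply: ler_wpM2r => //.
have := disc (fun j => tnth t j); rewrite -/(complement_volume t).
have t01 j : 0 <= tnth t j < 1.
  by have := Dt j; rewrite mxE => /andP[/ltW -> ->].
move=> /(_ t01) h; rewrite ler_pdivlMr// -[X in _ * X]ger0_norm ?(ltW n0')// -normrM.
rewrite mulrBl -mulrA [X in n%:R^-1 * X]mulrC mulrA mulVf ?gt_eqF// mul1r [complement_volume t * _]mulrC.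
exact: h.
Qed.

End KoksmaHlawka.

(** * The error for one outcome of the scrambling *)

Section ScrambledNetError.
Context {R : realType} {d : nat}.
Local Notation D := (@open_cube R d).
Local Notation lam := (lebesgue_tuple R d).
Implicit Types (q : 'rV[R]_d -> R) (y : 'rV[R]_d).

Definition zero_extension q y : R := if y \in D then q y else 0.

(** Inside the cube this is continuity. At a boundary point some coordinate has [mindist] 0; the
    power [delta] of that factor tends to 0 while all other factors are at most 1. *)
Lemma cvg_zero_extension (delta : R) q (y_ : nat -> 'rV[R]_d) y :
  0 < delta -> growth [::] (fun=> delta) q ->
  (forall j, 0 <= y 0 j <= 1) -> y_ n @[n --> \oo] --> y ->
  zero_extension q (y_ n) @[n --> \oo] --> zero_extension q y.
Proof.
move=> d0 [cq [C bq]] y01 yy; rewrite {2}/zero_extension.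
have [/set_mem Dy|/negP nDy] := boolP (y \in D).
  have c1 : q (y_ n) @[n --> \oo] --> q y by exact: (@cvg_comp _ _ _ y_ q _ _ _ yy (cq y Dy)).
  apply: cvg_trans c1.
  apply: near_eq_cvg.
  have : nbhs y D by move: (@open_open_cube R d); rewrite openE => /(_ y Dy).
  move=> /yy Dn; have {}Dn : \forall n \near \oo, D (y_ n) by exact: Dn.
  by apply: filterS Dn => n Dn; rewrite /zero_extension mem_set.
have [j yj] : exists j, mindist (y 0 j) = 0.
  apply: contrapT => h; apply: nDy; apply/mem_set => j; have /andP[y0 y1] := y01 j.
  apply/andP; split; rewrite lt_neqAle ?y0 ?y1 andbT; apply/eqP => e; apply: h; exists j.
    by rewrite /mindist -e subr0 min_l.
  by rewrite /mindist e subrr min_r.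
apply/cvgr0Pnorm_lt => e e0.
have C1 : 0 < `|C| + 1 by rewrite ltr_wpDl.
have /cvgr0Pnorm_lt/(_ (e / (`|C| + 1)))/(_ (divr_gt0 e0 C1)) := powR_cvg0 d0.
move=> /nbhs_ballP[r /= r0 Hr].
have cm : mindist (y_ n 0 j) @[n --> \oo] --> (0 : R).
  rewrite -yj; apply: (@cvg_comp _ _ _ (fun n => y_ n 0 j) (@mindist R) _ _ _ _ (@continuous_mindist R (y 0 j))).
  exact: (@cvg_comp _ _ _ y_ (fun z : 'rV[R]_d => z 0 j) _ _ _ yy (@continuous_row_coord R d j y)).
move/cvgr0Pnorm_lt : cm => /(_ r r0); apply: filterS => n nr.
rewrite /zero_extension; case: ifP => [/set_mem Dn|_]; last by rewrite normr0.
have m0 := mindist_gt0 (Dn j).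
have := Hr (mindist (y_ n 0 j)); rewrite /ball/= sub0r normrN => /(_ nr m0).
rewrite ger0_norm ?powR_ge0// ltr_pdivlMr// => h; apply: le_lt_trans h.
apply: le_trans (bq _ Dn) _.
apply: le_trans (ler_wpM2r (weight_ge0 _ _) (le_trans (ler_norm C) (_ : _ <= `|C| + 1))) _.
  by rewrite lerDl.
rewrite mulrC; apply: ler_wpM2r; first exact: ltW.
rewrite /weight (bigD1 j)//= ler_piMr ?powR_ge0//.
apply: prodr_ile1 => k _; rewrite powR_ge0/=.
have /andP[k0 k1] := mindist_itv (Dn k).
have := @ge0_ler_powR R delta (ltW d0) (mindist (y_ n 0 k)) 1.
by rewrite !nnegrE powR1 ler01; apply=> //; exact: ltW.
Qed.

(** [M] is fixed before the base, the net and the permutations, so the bound is uniform in all of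
    them. *)
Lemma scrambled_net_error (delta : R) q : (0 < d)%N -> 0 < delta < 1 ->
  growth (rev (enum 'I_d)) (fun=> delta) q ->
  lam.-integrable (@row_of_tuple R d @^-1` D) (EFin \o (q \o row_of_tuple)) /\
  exists M : R, forall b t m (hb : (1 < b)%N) (x : 'I_(b ^ m) -> 'rV[R]_d)
    (s : 'I_d -> seq 'I_b -> {perm 'I_b}), tmd_net t x ->
  `|(b ^ m)%:R^-1 * \sum_i zero_extension q (\row_j scramble_coord hb (s j) (x i 0 j)) -
    \int[lam]_(u in @row_of_tuple R d @^-1` D) q (row_of_tuple u)|
  <= (b ^ t)%:R * (m * b).+1%:R ^+ d / (b ^ m)%:R * M.
Proof.
move=> d_gt0 d01 gq; have chain := growth_ftc_chain d01 gq.
have mw := @measurable_mindist_weight R delta.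
have w0 x : 0 <= mindist_weight delta x by exact: powR_ge0.
have wfin := integral_mindist_powR d01.
have topE : pderivs (drop d (enum 'I_d)) q = q by rewrite drop_oversize// size_enum_ord.
split.
  have := integrable_chain mw w0 wfin chain (leqnn d).
  by rewrite topE.
exists (\int[lam]_(u in @row_of_tuple R d @^-1` D) `|pderivs (drop 0 (enum 'I_d)) q (row_of_tuple u)|).
move=> b t m hb x s net; set c := (b ^ t)%:R * _.
have bm : (0 < b ^ m)%N by rewrite expn_gt0 ltnW.
set I := \int[lam]_(u in _) q _; set M := \int[lam]_(u in _) `|_|.
pose y n i := truncated_scramble hb s n (x i).
have bound n : (m <= n)%N -> `|(b ^ m)%:R^-1 * \sum_i zero_extension q (y n i) - I| <= c / (b ^ m)%:R * M.
  move=> mn; have ynet := truncated_scramble_net hb s mn net.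
  have := Koksma_Hlawka mw w0 wfin chain (y := y n) (c := c) bm.
  rewrite topE; apply; first by case: ynet.
  move=> v v01; rewrite natrX; apply: (net_discrepancy d_gt0 hb ynet v01).
have cv : `|(b ^ m)%:R^-1 * \sum_i zero_extension q (y n i) - I| @[n --> \oo] -->
  `|(b ^ m)%:R^-1 * \sum_i zero_extension q (\row_j scramble_coord hb (s j) (x i 0 j)) - I|.
  apply: cvg_norm; apply: cvgB; last exact: cvg_cst.
  apply: cvgM; first exact: cvg_cst.
  apply: cvg_sumr => i; case/andP: d01 => d0 _.
  apply: (cvg_zero_extension d0 (growth_nil gq)).
    by move=> j; rewrite mxE; exact: scramble_coord_itv.
  exact: cvg_truncated_scramble.
rewrite -(cvg_lim (@Rhausdorff R) cv); apply: limr_le; first by apply/cvg_ex; eexists; exact: cv.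
near=> n; apply: bound; near: n; exact: nbhs_infty_ge.
Unshelve. all: by end_near.
Qed.

End ScrambledNetError.

(** * The expectation as an integral over the cube *)

Section TransportedIntegral.
Context {R : realType} {d : nat}.
Local Notation D := (@open_cube R d).
Local Notation lam := (lebesgue_tuple R d).

Lemma strict_derivative_class k (U : set 'rV[R]_d) (T : 'rV[R]_d -> 'rV[R]_d) u :
  open U -> class_C_vec k.+1 U T -> U u -> strict_derivative T u (jac T u)^T.
Proof.
move=> oU CT Uu; have nU : nbhs u U by move: oU; rewrite openE; exact.
apply: strict_derivative_C1 => [i j|i j]; last exact: (class_C1_continuous (CT i) Uu).
by apply: (filterS _ nU) => z Uz; exact: (class_C1_derivable (CT i) Uz).
Qed.

(** Restricts integrals to the set where the integrand is positive: the change of variables compares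
    [psi] with constants multiplicatively and therefore asks for [psi] to be positive. *)
Lemma integral_pos_support (A B : set 'rV[R]_d) (F G : 'rV[R]_d -> R) :
  (forall x, A x -> F x = 0 \/ B x) -> (B `<=` A) -> (forall x, B x -> F x = G x) ->
  (\int[lam]_(t in @row_of_tuple R d @^-1` A) (F (row_of_tuple t))%:E =
   \int[lam]_(t in @row_of_tuple R d @^-1` B) (G (row_of_tuple t))%:E)%E.
Proof.
move=> FAB BA FG; rewrite [LHS]integral_mkcond [RHS]integral_mkcond.
apply: eq_integral => t _; rewrite !patchE.
have [/set_mem/= Bt|/negP nB] := boolP (t \in row_of_tuple @^-1` B).
  by rewrite mem_set ?FG//; exact: BA.
case: ifP => // /set_mem/= At; case: (FAB _ At) => [->//|Bt].
by exfalso; apply: nB; exact/mem_set.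
Qed.

Lemma ge0_change_of_variables k (tau : 'rV[R]_d -> 'rV[R]_d) (G : 'rV[R]_d -> R) :
  diffeo_cube k.+1 tau -> continuous G -> (forall x, 0 <= G x) ->
  (\int[lam]_t (G (row_of_tuple t))%:E =
   \int[lam]_(t in @row_of_tuple R d @^-1` D)
      (G (tau (row_of_tuple t)) * `|\det (jac tau (row_of_tuple t))|)%:E)%E.
Proof.
move=> [Ct [g [gD gK tauK Cg]]] cG G0.
have ctau u : D u -> {for u, continuous tau}.
  by move=> Du; apply: for_continuous_row => j; exact: (class_C_continuous (Ct j) Du).
have cg x : {for x, continuous g}.
  by apply: for_continuous_row => j; exact: (class_C_continuous (Cg j) I).
have cdtau u : D u -> {for u, continuous (fun z => \det (jac tau z))}.
  by move=> Du; apply: continuous_det_jac => i j; exact: (class_C1_continuous (Ct i) Du).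
have cdg x : {for x, continuous (fun z => \det (jac g z))}.
  by apply: continuous_det_jac => i j; exact: (class_C1_continuous (Cg i) I).
have cGtau u : D u -> {for u, continuous (G \o tau)}.
  by move=> Du; exact: (continuous_comp (ctau u Du) (cG _)).
pose V : set 'rV[R]_d := [set x | 0 < G x].
pose U : set 'rV[R]_d := [set u | D u /\ 0 < G (tau u)].
have oV : open V.
  by rewrite openE => x Vx; exact: (near_continuous_gt (cG x) Vx).
have oU : open U.
  rewrite openE => u [Du Gu]; apply: filterS (filterI (near_cube Du) (near_continuous_gt (cGtau u Du) Gu)).
  by move=> z [].
have cT (J : 'rV[R]_d -> 'M[R]_d) u : {for u, continuous (fun z => \det (J z))} ->
    {for u, continuous (fun z => \det (J z)^T)}.
  by rewrite (_ : (fun z => \det (J z)^T) = fun z => \det (J z))//; apply/funext => z; rewrite det_tr.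
have dn0 := jac_det_neq0 Ct Cg gK.
(* The integrand for the inverse map: composed with [tau] it is the integrand on the cube, and times
   the Jacobian determinant of [g] in absolute value it is [G]. *)
pose psi x := G x * `|\det (jac tau (g x))|.
have -> : (\int[lam]_t (G (row_of_tuple t))%:E =
    \int[lam]_(t in @row_of_tuple R d @^-1` V) (G (row_of_tuple t))%:E)%E.
  apply: (@integral_pos_support setT V G G) => // x _.
  by have := G0 x; rewrite le_eqVlt => /predU1P[<-|]; [left|right].
have -> : (\int[lam]_(t in @row_of_tuple R d @^-1` D)
      (G (tau (row_of_tuple t)) * `|\det (jac tau (row_of_tuple t))|)%:E =
    \int[lam]_(t in @row_of_tuple R d @^-1` U)
      (G (tau (row_of_tuple t)) * `|\det (jac tau (row_of_tuple t))|)%:E)%E.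
  have H u : D u -> G (tau u) * `|\det (jac tau u)| = 0 \/ U u.
    by move=> Du; have := G0 (tau u); rewrite le_eqVlt => /predU1P[<-|]; [left; rewrite mul0r|right].
  have UD : U `<=` D by move=> u [].
  exact: (@integral_pos_support D U (fun u => G (tau u) * `|\det (jac tau u)|)
    (fun u => G (tau u) * `|\det (jac tau u)|) H UD (fun _ _ => erefl)).
apply/eqP; rewrite eq_le; apply/andP; split.
  have := @change_of_variables_le R d U V tau g (fun u => (jac tau u)^T) (G \o tau) oU oV.
  under [X in _ -> (X <= _)%E]eq_integral => t _ do rewrite /= tauK.
  under [X in _ -> (_ <= X)%E]eq_integral => t _ do rewrite /= det_tr.
  apply.
  - by move=> x Vx; split; rewrite ?tauK.
  - by move=> x _.
  - by move=> x _; exact: cg.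
  - by move=> u [Du _]; rewrite unitmxE det_tr unitfE; exact: dn0.
  - by move=> u [].
  - by move=> u [Du _]; exact: cGtau.
  - by move=> u [Du _]; exact: (cT _ _ (cdtau u Du)).
  - by move=> u [Du _]; exact: (strict_derivative_class (@open_open_cube R d) Ct Du).
have dg0 x : \det (jac g x) != 0.
  have := jac_det_inverse Ct Cg gK (gD x); rewrite tauK.
  by have [->|//] := eqVneq; rewrite normr0 mul0r => /esym/eqP; rewrite oner_eq0.
have -> : (\int[lam]_(t in @row_of_tuple R d @^-1` V) (G (row_of_tuple t))%:E =
    \int[lam]_(t in @row_of_tuple R d @^-1` V)
      (psi (row_of_tuple t) * `|\det (jac g (row_of_tuple t))^T|)%:E)%E.
  apply: eq_integral => t _; rewrite /psi det_tr -mulrA [X in _ * X]mulrC.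
  have := jac_det_inverse Ct Cg gK (gD (row_of_tuple t)); rewrite tauK => ->.
  by rewrite mulr1.
have -> : (\int[lam]_(t in @row_of_tuple R d @^-1` U)
      (G (tau (row_of_tuple t)) * `|\det (jac tau (row_of_tuple t))|)%:E =
   \int[lam]_(t in @row_of_tuple R d @^-1` U) (psi (tau (row_of_tuple t)))%:E)%E.
  by apply: eq_integral => t /set_mem[Dt _]; rewrite /psi gK.
apply: (@change_of_variables_le R d V U g tau (fun x => (jac g x)^T) psi oV oU).
- by move=> u [].
- by move=> u [Du _]; exact: gK.
- by move=> u [Du _]; exact: ctau.
- by move=> x _; rewrite unitmxE det_tr unitfE; exact: dg0.
- by move=> x Vx; rewrite mulr_gt0// normr_gt0; exact: dn0.
- move=> x _; apply: for_continuousM; first exact: cG.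
  apply: for_continuous_norm.
  exact: (continuous_comp (cg x) (cdtau _ (gD x))).
- by move=> x _; exact: (cT _ _ (cdg x)).
- by move=> x _; exact: (strict_derivative_class (@openT _) Cg I).
Qed.

End TransportedIntegral.

(** [nu] is absolutely continuous with respect to [mu], and [p] agrees almost everywhere with the
    Radon-Nikodym derivative because both have the same integrals over measurable sets. *)
Lemma ge0_integral_density {R : realType} dT (T : measurableType dT)
    (nu : probability T R) (mu : {sigma_finite_measure set T -> \bar R}) (p : T -> R)
    (phi : T -> \bar R) :
  measurable_fun setT p ->
  (forall A, measurable A -> nu A = \int[mu]_(x in A) (p x)%:E)%E ->
  measurable_fun setT phi -> (forall x, 0 <= phi x)%E ->
  (\int[nu]_x phi x = \int[mu]_x (phi x * (p x)%:E))%E.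
Proof.
move=> mp nup mphi phi0.
have numu : nu `<< mu.
  apply/null_content_dominatesP => A mA muA.
  rewrite nup//; apply: null_set_integral => //.
  exact/measurable_EFinP/measurable_funTS.
rewrite -(Radon_Nikodym_SigmaFinite.change_of_variables numu phi0 measurableT mphi).
have irn := Radon_Nikodym_SigmaFinite.f_integrable numu.
apply: ae_eq_integral => //.
- by apply: emeasurable_funM => //; exact: (measurable_int _ irn).
- by apply: emeasurable_funM => //; exact/measurable_EFinP.
- apply: ae_eqe_mul2l; apply: integral_ae_eq => //; first exact/measurable_EFinP.
  move=> A _ mA; transitivity (nu A); last exact: nup.
  by rewrite -Radon_Nikodym_SigmaFinite.f_integral.
Qed.

Section Expectation.
Context {R : realType} {d : nat}.
Local Notation D := (@open_cube R d).
Local Notation lam := (lebesgue_tuple R d).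

(** The change of variables concerns nonnegative functions, so [f] is split into its positive and
    negative parts. Since [p] and the absolute determinant are nonnegative, this also splits the
    integrand on the cube, whose integrability makes the result finite. *)
Lemma expectation_transport k (tau : 'rV[R]_d -> 'rV[R]_d) (f p : 'rV[R]_d -> R)
    dX (OX : measurableType dX) (Q : probability OX R) (X : {RV Q >-> d.-tuple R}) :
  diffeo_cube k.+1 tau -> continuous f -> continuous p -> (forall x, 0 <= p x) ->
  has_density X p ->
  lam.-integrable (@row_of_tuple R d @^-1` D)
    (EFin \o ((fun u => f (tau u) * p (tau u) * `|\det (jac tau u)|) \o row_of_tuple)) ->
  ('E_Q[(fun w => f (row_of_tuple (X w)))] =
   (\int[lam]_(t in @row_of_tuple R d @^-1` D)
     (f (tau (row_of_tuple t)) * p (tau (row_of_tuple t)) * `|\det (jac tau (row_of_tuple t))|))%:E)%E.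
Proof.
move=> htau cf cp p0 hX hi.
have mrow (g : 'rV[R]_d -> R) : continuous g -> measurable_fun setT (g \o @row_of_tuple R d).
  exact: continuous_measurable_row.
have part (g : 'rV[R]_d -> R) : continuous g -> (forall x, 0 <= g x) ->
    (\int[Q]_w (g (row_of_tuple (X w)))%:E =
     \int[lam]_(t in @row_of_tuple R d @^-1` D)
       (g (tau (row_of_tuple t)) * p (tau (row_of_tuple t)) * `|\det (jac tau (row_of_tuple t))|)%:E)%E.
  move=> cg g0.
  rewrite -(@ge0_change_of_variables R d k tau (fun x => g x * p x) htau) => [||x]; last 2 first.
  - by move=> x; apply: for_continuousM; [exact: cg|exact: cp].
  - exact: mulr_ge0.
  rewrite -(ge0_integral_distribution X (f := EFin \o (g \o row_of_tuple))); last 2 first.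
  - by apply/measurable_EFinP; exact: (mrow g cg).
  - by move=> t; rewrite lee_fin; exact: g0.
  rewrite (@ge0_integral_density _ _ _ _ lam (p \o row_of_tuple)) //.
  - exact: (mrow p cp).
  - by apply/measurable_EFinP; exact: (mrow g cg).
  - by move=> t; rewrite lee_fin; exact: g0.
pose fp x := Num.max (f x) 0; pose fn x : R := Num.max (- f x) 0.
have cfp : continuous fp by move=> x; apply: continuous_max; [exact: cf|exact: cst_continuous].
have cfn : continuous fn.
  have cnf x : {for x, continuous (fun x => - f x)} by apply: continuousN; exact: cf.
  by move=> x; exact: (@continuous_max R _ (fun x => - f x) (cst 0) x (cnf x) (@cst_continuous _ _ _ _)).
rewrite unlock /expectation integralE.
have -> : (\int[Q]_w ((fun w => (f (row_of_tuple (X w)))%:E)^\+ w) =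
    \int[Q]_w (fp (row_of_tuple (X w)))%:E)%E.
  by apply: eq_integral => w _; rewrite funeposE /fp EFin_max.
have -> : (\int[Q]_w ((fun w => (f (row_of_tuple (X w)))%:E)^\- w) =
    \int[Q]_w (fn (row_of_tuple (X w)))%:E)%E.
  by apply: eq_integral => w _; rewrite funenegE /fn EFin_max EFinN.
have fp0 x : 0 <= fp x by rewrite le_max lexx orbT.
have fn0 x : 0 <= fn x by rewrite le_max lexx orbT.
rewrite (part fp cfp fp0) (part fn cfn fn0).
have fin := integrable_fin_num _ hi.
rewrite /Rintegral fineK; last by apply: fin; exact: measurable_cube.
rewrite [RHS]integralE; congr (_ - _)%E; apply: eq_integral => t _.
  rewrite funeposE -EFin_max /fp; congr EFin.
  by rewrite maxr_pMl ?mul0r// maxr_pMl ?mul0r.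
rewrite funenegE -EFinN -EFin_max /fn; congr EFin.
by rewrite maxr_pMl ?mul0r// maxr_pMl ?mul0r// !mulNr.
Qed.

End Expectation.

(** * Rate of convergence *)

Section IntegralBound.
Import HBNNSimple.

(** The integral is a supremum over the simple functions below [f], and each of them is at most [c].
    In this form the bound applies directly to the squared error. *)
Lemma ge0_integral_le_cst {R : realType} dT (T : measurableType dT)
    (P : probability T R) (f : T -> \bar R) (c : R) :
  (forall x, 0 <= f x <= c%:E)%E -> (\int[P]_x f x <= c%:E)%E.
Proof.
move=> f0c; have f0 x : (0 <= f x)%E by case/andP: (f0c x).
rewrite ge0_integralTE//; apply: ge_ereal_sup => _ [h /= hf <-].
have -> : sintegral P h = (\int[P]_x (h x)%:E)%E.
  by rewrite integral_nnsfun// patch_setT.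
have -> : c%:E = (\int[P]_x cst c%:E x)%E.
  by rewrite integral_cst//; have := @probability_setT _ _ _ P => /= ->; rewrite mule1.
apply: ge0_le_integral => //.
- by move=> x _; rewrite lee_fin.
- exact/measurable_EFinP.
- by move=> x _; rewrite (le_trans (hf x))//; case/andP: (f0c x).
Qed.

End IntegralBound.

Lemma rmse_le {R : realType} dO (Omega : measurableType dO) (P : probability Omega R)
    (Y : Omega -> R) (mu e : R) :
  (forall w, `|Y w - mu| <= e) -> (rmse P Y mu%:E <= e%:E)%E.
Proof.
move=> Ye.
(* The total mass 1 provides an outcome, and the bound at that outcome shows that [e] is
   nonnegative. *)
have e0 : 0 <= e.
  have : P setT != 0%E by rewrite probability_setT.
  have [->|/set0P[w _] _] := eqVneq (setT : set Omega) set0; first by rewrite measure0 eqxx.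
  exact: le_trans (Ye w).
rewrite /rmse.
have h : (\int[P]_w (`|(Y w)%:E - mu%:E| ^+ 2) <= (e ^+ 2)%:E)%E.
  apply: ge0_integral_le_cst => w.
  by rewrite -EFinB abse_EFin -EFin_expe !lee_fin sqr_ge0 lerXn2r// nnegrE.
apply: (@le_trans _ _ (poweR (e ^+ 2)%:E 2^-1)).
  apply: gt0_ler_poweR => //; rewrite ?in_itv/= ?leey ?andbT ?lee_fin ?sqr_ge0//.
  by apply: integral_ge0 => w _; rewrite lee_fin mulr_ge0.
by rewrite poweR_EFin powR12_sqrt ?sqr_ge0// sqrtr_sqr ger0_norm.
Qed.

(** With [c = eps * ln b], the power of [b^m] is [expR (m c)], which exceeds the term [(m c)^d / d!]
    of its series. For [m >= 1], [m b + 1] is at most [2 m b], that is, [2 b / c] times [m c]; hence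
    the constant. *)
Lemma polylog_le_powR {R : realType} (b d : nat) (eps : R) :
  (1 < b)%N -> (0 < d)%N -> 0 < eps -> exists2 K : R, 0 <= K &
  forall m, (0 < m)%N -> (m * b).+1%:R ^+ d <= K * (b ^ m)%:R `^ eps.
Proof.
move=> b1 d0 e0; have lnb : 0 < ln (b%:R : R) by rewrite ln_gt0// ltr1n.
pose c : R := eps * ln b%:R; have c0 : 0 < c by exact: mulr_gt0.
have b0 : (b%:R : R) != 0 by rewrite pnatr_eq0 -lt0n ltnW.
have K0 : 0 <= (2 * b%:R / c) ^+ d.
  by apply: exprn_ge0; apply: divr_ge0; [rewrite mulr_ge0|exact: ltW].
exists ((2 * b%:R / c) ^+ d * d`!%:R) => [|m m0].
  by rewrite mulr_ge0.
have -> : (b ^ m)%:R `^ eps = expR (m%:R * c) :> R.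
  rewrite /powR pnatr_eq0 expn_eq0 -(pnatr_eq0 R) (negPf b0)/= natrX lnXn ?lt0r ?b0 ?ler0n//.
  by rewrite mulrnAr [in RHS]mulr_natl.
have hx : 0 <= m%:R * c by rewrite mulr_ge0// ltW.
have := expR_ge1Dxn d.-1 hx; rewrite prednK// => h.
have {}h : (m%:R * c) ^+ d <= d`!%:R * expR (m%:R * c).
  rewrite [leRHS]mulrC -ler_pdivrMr ?ltr0n ?fact_gt0//; apply: le_trans h.
  by rewrite lerDr.
rewrite -[leRHS]mulrA; apply: le_trans (ler_wpM2l K0 h).
rewrite -exprMn (_ : 2 * b%:R / c * (m%:R * c) = (2 * (m * b))%:R); last first.
  by rewrite !natrM; field; rewrite gt_eqF.
rewrite lerXn2r ?nnegrE// ler_nat; nia.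
Qed.

Theorem corollary12 (R : realType) (d : nat) (hd : (0 < d)%N)
  (F : cumulativeBounded (0 : R) (1 : R)) (alpha : R) (halpha : 0 < alpha)
  (f p : 'rV[R]_d -> R) (tau : 'rV[R]_d -> 'rV[R]_d)
  (hf : class_C d setT f)
  (hp : class_C d setT p) (hdens : is_density p)
  (htau : diffeo_cube d.+1 tau)
  (growth_f : forall (l : {ffun 'I_d -> nat}) (B : R),
     (\sum_i l i <= d)%N -> 0 < B ->
     exists2 C1 : R, 0 < C1 & forall x : 'rV[R]_d,
       (`|pderiv_multi l f x|%:E <=
          C1%:E * \prod_(k < d) negpow (mindist (F (x 0%R k))) B)%E)
  (growth_p : exists2 C2 : R, 0 < C2 &
     forall l : {ffun 'I_d -> nat}, (\sum_i l i <= d)%N ->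
     forall x : 'rV[R]_d,
       `|pderiv_multi l p x| <=
          C2 * \prod_(k < d) expR (- (alpha * `|x 0 k|)))
  (growth_tau : transport_growth F alpha tau)
  (dX : measure_display) (OX : measurableType dX) (Q : probability OX R)
  (X : {RV Q >-> d.-tuple R}) (hX : has_density X p)
  (b t : nat) (hb : (1 < b)%N)
  (net : forall m : nat, 'I_(b ^ m) -> 'rV[R]_d)
  (hnet : forall m : nat, (t <= m)%N -> tmd_net t (net m))
  (dO : nat -> measure_display)
  (Omega : forall m : nat, measurableType (dO m))
  (P : forall m : nat, probability (Omega m) R)
  (sigma : forall m : nat, 'I_d -> seq 'I_b -> Omega m -> {perm 'I_b})
  (hsigma : forall m : nat, nested_uniform (P m) (sigma m))
  (eps : R) (heps : 0 < eps) :
  let mu := ('E_Q[(fun w => f (row_of_tuple (X w)))])%E in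
  let mu_hat := fun m : nat =>
    sample_mean (transported_integrand f p tau)
      (fun i : 'I_(b ^ m) => scramble hb (sigma m) (net m i)) in
  exists C : R, \forall m \near \oo,
    (rmse (P m) (mu_hat m) mu <= (C * (b ^ m)%N%:R `^ (- 1 + eps))%:E)%E.
Proof.
move=> mu mu_hat.
have [p0 _] := hdens.
have [delta d01 gq] := integrand_growth hd halpha hf hp htau growth_f growth_p growth_tau.
have [hi [M HM]] := scrambled_net_error hd d01 gq.
have cf : continuous f by move=> x; exact: (class_C_continuous hf I).
have cp : continuous p by move=> x; exact: (class_C_continuous hp I).
have muE := expectation_transport htau cf cp p0 hX hi.
have [K K0 HK] := @polylog_le_powR R b d eps hb hd heps.
(* [b^t] comes from the quality of the net, [K] from absorbing the polynomial in [m] into n^eps, and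
   [M] from the error bound. *)
exists ((b ^ t)%:R * K * `|M|).
near=> m.
have m0 : (0 < m)%N by near: m; exact: nbhs_infty_gt.
have tm : (t <= m)%N by near: m; exact: nbhs_infty_ge.
have bm0 : 0 < (b ^ m)%:R :> R by rewrite ltr0n expn_gt0 ltnW.
have err : (rmse (P m) (mu_hat m) mu <=
    ((b ^ t)%:R * (m * b).+1%:R ^+ d / (b ^ m)%:R * M)%:E)%E.
  rewrite /mu muE; apply: rmse_le => w.
  exact: (HM b t m hb (net m) (fun j s => sigma m j s w) (hnet m tm)).
apply: le_trans err _.
rewrite lee_fin; apply: le_trans (ler_wpM2l _ (ler_norm M)) _.
  by rewrite divr_ge0// mulr_ge0// exprn_ge0.
rewrite [leRHS]mulrAC; apply: ler_wpM2r => //.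
rewrite powRD; last by rewrite (gt_eqF bm0) implybT.
rewrite (powR_inv1 (ltW bm0)) -!mulrA; apply: ler_wpM2l => //.
rewrite mulrCA [leLHS]mulrC; apply: ler_wpM2l; first by rewrite invr_ge0 ltW.
exact: HK.
Unshelve. all: by end_near.
Qed.
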